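(* Let $p$ be holomorphic on $\mathbb{D}$ with $\mathrm{Re}(p)>0$. Let $f_t$, $t\in[a,\infty)$, be a Loewner chain on $[a,\infty)$ with initial point $f_a$, satisfying the Loewner partial differential equation with constant infinitesimal generator $$\frac{\partial f_t}{\partial t}(z)=zp(z)f_t'(z)$$ for almost every $t$. Then the power matrix of $f_t$ is given by $$[f_t]=[f_a]\exp\big((t-a)\langle zp\rangle\big).$$ In particular, the first $n$ coefficients of $f_t$ form the first row of the $(1,n)$ principal block of $[f_a]\exp((t-a)\langle zp\rangle)$.
   Context: $\mathbb{D}$ is the open unit disc. A Loewner chain on $[a,\infty)$ is a one-parameter family of univalent (holomorphic injective) functions $f_t$ on $\mathbb{D}$, $t\in[a,\infty)$, with $f_t(0)=0$, $f_t'(0)=e^{\alpha t}$ for some constant $\alpha$ (necessarily $\alpha=p(0)$), and $f_t(\mathbb{D})\subset f_s(\mathbb{D})$ whenever $t\le s$. Matrices are doubly infinite, indexed by $\mathbb{Z}\times\mathbb{Z}$; $A^m_n$ is the entry in row $m$, column $n$. For $f(z)=\sum_{k\ge1}a_kz^k$ with $a_1\neq0$, the power matrix $[f]$ has entries given by $f(z)^n=\sum_{k\geq n}[f]^n_kz^k$, $n\in\mathbb{Z}$. For $h(z)=\sum_{k\ge1}h_kz^k$, $\langle h\rangle$ is the matrix with entry $m\,h_{n-m+1}$ in row $m$, column $n$ ($h_j=0$ for $j\le0$); $\langle zp\rangle$ is this matrix for $h(z)=zp(z)$. $\exp$ is the entrywise matrix exponential (all matrices are upper triangular, so products are finite sums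 and the exponential converges entrywise). The $(m,n)$ principal block of $A$ is the matrix of entries $A^i_j$ with $m\le i\le n$, $m\le j\le n$. *)

(* Defs.v *)
From Stdlib Require Import Reals ZArith List ClassicalEpsilon.
From Coquelicot Require Import Coquelicot.

Open Scope R_scope.

Definition Cexp (z : C) : C := (exp (Re z) * cos (Im z), exp (Re z) * sin (Im z)).

Definition Cpowz (z : C) (n : Z) : C :=
  match n with
  | Z0 => RtoC 1
  | Zpos p => Cpow z (Pos.to_nat p)
  | Zneg p => Cinv (Cpow z (Pos.to_nat p))
  end.

(* Sum of a complex series, through real and imaginary parts because
   Coquelicot's total operator [Series] is real-valued. *)
Definition CSeries (u : nat -> C) : C :=
  (Series (fun k => Re (u k)), Series (fun k => Im (u k))).

(* Functions on the disc are represented by total functions [C -> C]; only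
   their values on the disc matter. *)
Definition unit_disc (z : C) : Prop := Cmod z < 1.

Definition holomorphic_on_disc (f : C -> C) : Prop :=
  forall z, unit_disc z -> @ex_derive C_AbsRing C_NormedModule f z.

Definition univalent (f : C -> C) : Prop :=
  holomorphic_on_disc f /\
  forall z w, unit_disc z -> unit_disc w -> f z = f w -> z = w.

Definition loewner_chain (a : R) (f : R -> C -> C) : Prop :=
  (forall t, a <= t -> univalent (f t)) /\
  (forall t, a <= t -> f t (RtoC 0) = RtoC 0) /\
  (exists alpha : C, forall t, a <= t ->
     C_derive (f t) (RtoC 0) = Cexp (Cmult alpha (RtoC t))) /\
  (forall t s, a <= t -> t <= s ->
     forall z, unit_disc z -> exists w, unit_disc w /\ f s w = f t z).

Definition null_set (E : R -> Prop) : Prop :=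
  forall eps : posreal, exists l r : nat -> R,
    (forall k, l k <= r k) /\
    (forall x, E x -> exists k, l k < x < r k) /\
    ex_series (fun k => r k - l k) /\
    Series (fun k => r k - l k) <= eps.

Definition almost_every (P : R -> Prop) : Prop := null_set (fun t => ~ P t).

(* The time derivative is the two-sided one, which only makes sense at interior
   points of [a, oo); the endpoint is a null set. *)
Definition loewner_pde (a : R) (p : C -> C) (f : R -> C -> C) : Prop :=
  almost_every (fun t => a < t ->
    forall z, unit_disc z ->
      @is_derive R_AbsRing C_R_NormedModule (fun s => f s z) t
        (Cmult (Cmult z (p z)) (C_derive (f t) z))).

Definition is_taylor (f : C -> C) (c : nat -> C) : Prop :=
  @locally C_UniformSpace (RtoC 0)
    (fun z => @is_pseries C_AbsRing C_NormedModule c z (f z)).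

(* The unique [c] with [is_taylor f c], when [f] is analytic at 0. *)
Definition taylor_coef (f : C -> C) : nat -> C :=
  epsilon (inhabits (fun _ => RtoC 0)) (is_taylor f).

(* [A m n] is the entry in row [m] and column [n]. *)
Definition zmatrix := Z -> Z -> C.

(* The integers m, m + 1, ..., n; empty when n < m. *)
Definition zrange (m n : Z) : list Z :=
  map (fun i => (m + Z.of_nat i)%Z) (seq 0 (Z.to_nat (n - m + 1))).

(* Product of upper triangular matrices: the terms A^m_k B^k_n with k < m or
   k > n vanish, so that the sum over all integers k is the sum over
   m <= k <= n. *)
Definition zmmul (A B : zmatrix) : zmatrix := fun m n =>
  fold_right Cplus (RtoC 0) (map (fun k => Cmult (A m k) (B k n)) (zrange m n)).

Definition zmid : zmatrix := fun m n => if Z.eqb m n then RtoC 1 else RtoC 0.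

Definition zmscal (c : C) (A : zmatrix) : zmatrix := fun m n => Cmult c (A m n).

Fixpoint zmpow (A : zmatrix) (k : nat) : zmatrix :=
  match k with
  | O => zmid
  | S k' => zmmul A (zmpow A k')
  end.

Definition zmexp (A : zmatrix) : zmatrix := fun m n =>
  CSeries (fun k => Cdiv (zmpow A k m n) (RtoC (INR (fact k)))).

(* The list of rows of the matrix of entries A^i_j, m <= i, j <= n. *)
Definition principal_block (m n : Z) (A : zmatrix) : list (list C) :=
  map (fun i => map (A i) (zrange m n)) (zrange m n).

(* For n < 0 the expansion is a Laurent expansion with a pole at 0, hence the
   punctured neighbourhood; the index of summation is k = n + j. *)
Definition is_power_matrix (f : C -> C) (A : zmatrix) : Prop :=
  (forall n k : Z, (k < n)%Z -> A n k = RtoC 0) /\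
  forall n : Z, @locally' C_UniformSpace (RtoC 0) (fun z =>
    @is_series C_AbsRing C_NormedModule
      (fun j : nat => Cmult (A n (n + Z.of_nat j)%Z) (Cpowz z (n + Z.of_nat j)))
      (Cpowz (f z) n)).

(* The unique [A] with [is_power_matrix f A], when [f] is analytic at 0 with
   f(0) = 0 and f'(0) <> 0. *)
Definition power_matrix (f : C -> C) : zmatrix :=
  epsilon (inhabits (fun _ _ => RtoC 0)) (is_power_matrix f).

(* The matrix <h>, with entries m h_{n-m+1} where h_j = 0 for j <= 0. *)
Definition bracket (h : C -> C) : zmatrix := fun m n =>
  if Z.leb m n
  then Cmult (RtoC (IZR m)) (taylor_coef h (Z.to_nat (n - m + 1)))
  else RtoC 0.

(* Main.v *)
(** Write [f_t(z)^n = z^n U_t(z)] with [U_t = (f_t(z)/z)^n]; the row [n] of [[f_t]]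
    consists of the Taylor coefficients of [U_t].  Since [f_t = f_s o phi] with
    [phi] a self-map of the disc fixing [0] and [phi'(0) = exp (- alpha (s - t))],
    Schwarz's lemma and Caratheodory's inequality for [1 - phi(z)/z] give
    [|phi(z) - z| <= K (s - t)], so that these coefficients are Lipschitz in [t].
    At almost every [t] the difference quotients of [U_t] are bounded holomorphic
    functions converging pointwise, hence coefficientwise, and the Loewner equation
    becomes [d/dt [f_t] = [f_t] <zp>].  Finally [[f_s] exp ((t - s) <zp>)] is
    Lipschitz in [s] with zero derivative almost everywhere, hence constant on [[a, t]].

    Holomorphy only means complex differentiability here, so Taylor expansions are
    derived from Goursat's theorem: in logarithmic coordinates it says that the mean
    of a holomorphic function over [|z| = r] does not depend on [r]. *)

Require Import Defs.
From Stdlib Require Import Reals ZArith List Lra Lia.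
From Stdlib Require Import Classical ClassicalEpsilon FunctionalExtensionality.
From Coquelicot Require Import Coquelicot.
Open Scope R_scope.

(** * Limits and differentiation *)

(** An equation valid for almost every [t] does not single out its solution among continuous
    functions, since a zero derivative almost everywhere does not force constancy. This is what the
    Lipschitz bounds in [t] are for. They are taken on one circle [|z| = r], with [r] so small that
    [|f_t(z)|] is also bounded below there, uniformly in [t]; negative powers of [f_t(z) / z]
    require this.

    Coefficients occur as means over circles, as sequences picked by [epsilon] from a convergence
    property, and as limits of difference quotients in [t]. Jets compare them: expansions with
    remainder [O(|z|^n)] for [z <> 0]. A sequence that serves at every order is unique, and products
    and [z d/dz] act on jets by formulas. The value at [0] does not enter a jet, so [f(z) / z] needs
    no redefinition there.

    The factor [m] in [<h>] comes from [z d/dz]: Loewner's equation becomes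
    [dU/dt = (z U' + n U) p], and [z U' + n U] has the coefficients [(n + j) u_j]. The entry of
    [<zp>] in row [n + j], column [n + k] is [(n + j) p_(k-j)], so each row obeys a triangular
    linear system. *)

Definition ctends {T : Type} (F : (T -> Prop) -> Prop) (f : T -> C) (l : C) : Prop :=
  forall eps : R, 0 < eps -> F (fun x => Cmod (f x - l)%C < eps).

Lemma Cmod_minus_sym (x y : C) : Cmod (x - y)%C = Cmod (y - x)%C.
Proof. rewrite <- Cmod_opp. f_equal. ring. Qed.

Lemma Cmod_triangle_minus (x y : C) : Cmod (x - y)%C <= Cmod x + Cmod y.
Proof. rewrite <- (Cmod_opp y). apply Cmod_triangle. Qed.

Lemma Cmod_triangle_rev (x y : C) : Cmod x - Cmod y <= Cmod (x - y)%C.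
Proof.
  pose proof (Cmod_triangle (x - y)%C y) as H.
  replace (x - y + y)%C with x in H by ring. lra.
Qed.

Lemma Cmod_triangle_minus3 (x y z : C) : Cmod (x - z)%C <= Cmod (x - y)%C + Cmod (y - z)%C.
Proof. replace (x - z)%C with ((x - y) + (y - z))%C by ring. apply Cmod_triangle. Qed.

Lemma Cmod_eq_zero_eps (x : C) : (forall eps, 0 < eps -> Cmod x <= eps) -> x = RtoC 0.
Proof.
  intros H. apply Cmod_eq_0. apply Rle_antisym; [|apply Cmod_ge_0].
  apply le_epsilon. intros e He. rewrite Rplus_0_l. auto.
Qed.

Lemma Cminus_eq_0 (x y : C) : (x - y)%C = RtoC 0 -> x = y.
Proof. intros H. replace x with ((x - y) + y)%C by ring. rewrite H. ring. Qed.

Lemma Cminus_neq_0 (x y : C) : x <> y -> (x - y)%C <> RtoC 0.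
Proof. intros H1 H2. apply H1, Cminus_eq_0, H2. Qed.

Lemma Cminus_0_r (x : C) : (x - RtoC 0)%C = x.
Proof. ring. Qed.

Lemma Cmod_minus_diag (x : C) : Cmod (x - x)%C = 0.
Proof. unfold Cminus. now rewrite Cplus_opp_r, Cmod_0. Qed.

Lemma ctends_ext {T} (F : (T -> Prop) -> Prop) {FF : Filter F} (f g : T -> C) l :
  F (fun x => f x = g x) -> ctends F f l -> ctends F g l.
Proof.
  intros H Hf eps He.
  generalize (filter_and _ _ H (Hf eps He)). apply filter_imp.
  intros x [-> h]. exact h.
Qed.

Lemma ctends_eq {T} (F : (T -> Prop) -> Prop) (f : T -> C) l m :
  ctends F f l -> l = m -> ctends F f m.
Proof. now intros H <-. Qed.

Lemma ctends_const {T} (F : (T -> Prop) -> Prop) {FF : Filter F} (c : C) :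
  ctends F (fun _ => c) c.
Proof.
  intros eps He. apply filter_forall. intros x.
  now rewrite Cmod_minus_diag.
Qed.

Lemma ctends_plus {T} (F : (T -> Prop) -> Prop) {FF : Filter F} f g (l m : C) :
  ctends F f l -> ctends F g m -> ctends F (fun x => f x + g x)%C (l + m)%C.
Proof.
  intros Hf Hg eps He.
  assert (He2 : 0 < eps / 2) by lra.
  generalize (filter_and _ _ (Hf _ He2) (Hg _ He2)).
  apply filter_imp. intros x [h1 h2].
  replace (f x + g x - (l + m))%C with ((f x - l) + (g x - m))%C by ring.
  eapply Rle_lt_trans; [apply Cmod_triangle|lra].
Qed.

Lemma ctends_bounded {T} (F : (T -> Prop) -> Prop) {FF : Filter F} f (l : C) :
  ctends F f l -> F (fun x => Cmod (f x) <= Cmod l + 1).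
Proof.
  intros Hf. generalize (Hf 1 Rlt_0_1). apply filter_imp. intros x h.
  pose proof (Cmod_triangle_rev (f x) l). lra.
Qed.

Lemma ctends_mult {T} (F : (T -> Prop) -> Prop) {FF : Filter F} f g (l m : C) :
  ctends F f l -> ctends F g m -> ctends F (fun x => f x * g x)%C (l * m)%C.
Proof.
  intros Hf Hg eps He.
  set (K := Cmod l + Cmod m + 1).
  pose proof (Cmod_ge_0 l) as Hl. pose proof (Cmod_ge_0 m) as Hm.
  assert (HK : 0 < K) by (unfold K; lra).
  assert (He' : 0 < eps / (2 * K)) by (apply Rdiv_lt_0_compat; lra).
  generalize (filter_and _ _ (ctends_bounded F g m Hg)
    (filter_and _ _ (Hf _ He') (Hg _ He'))).
  apply filter_imp. intros x [h0 [h1 h2]].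
  replace (f x * g x - l * m)%C with ((f x - l) * g x + l * (g x - m))%C by ring.
  eapply Rle_lt_trans; [apply Cmod_triangle|]. rewrite !Cmod_mult.
  pose proof (Cmod_ge_0 (f x - l)%C). pose proof (Cmod_ge_0 (g x - m)%C).
  assert (Cmod (f x - l)%C * Cmod (g x) <= Cmod (f x - l)%C * K).
  { apply Rmult_le_compat_l; auto. unfold K. lra. }
  assert (Cmod l * Cmod (g x - m)%C <= K * Cmod (g x - m)%C).
  { apply Rmult_le_compat_r; auto. unfold K. lra. }
  assert (eps / (2 * K) * K = eps / 2) by (field; lra).
  assert (Cmod (f x - l)%C * K < eps / (2 * K) * K) by (apply Rmult_lt_compat_r; auto).
  assert (K * Cmod (g x - m)%C < K * (eps / (2 * K))) by (apply Rmult_lt_compat_l; auto).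
  lra.
Qed.

Lemma ctends_scal {T} (F : (T -> Prop) -> Prop) {FF : Filter F} c f (l : C) :
  ctends F f l -> ctends F (fun x => c * f x)%C (c * l)%C.
Proof. intros H. apply ctends_mult; auto. now apply ctends_const. Qed.

Lemma ctends_minus {T} (F : (T -> Prop) -> Prop) {FF : Filter F} f g (l m : C) :
  ctends F f l -> ctends F g m -> ctends F (fun x => f x - g x)%C (l - m)%C.
Proof.
  intros Hf Hg. replace (l - m)%C with (l + (RtoC (-1)) * m)%C by ring.
  apply (ctends_ext F (fun x => f x + (RtoC (-1)) * g x)%C).
  - apply filter_forall. intros x. ring.
  - apply ctends_plus; auto. now apply ctends_scal.
Qed.

Lemma ctends_inv {T} (F : (T -> Prop) -> Prop) {FF : Filter F} f (l : C) :
  l <> RtoC 0 -> ctends F f l -> ctends F (fun x => / f x)%C (/ l)%C.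
Proof.
  intros Hl Hf eps He.
  assert (Hl' : 0 < Cmod l) by (now apply Cmod_gt_0).
  assert (He' : 0 < eps * (Cmod l * Cmod l / 2)).
  { apply Rmult_lt_0_compat; auto. apply Rdiv_lt_0_compat; [|lra].
    now apply Rmult_lt_0_compat. }
  assert (Hl2 : 0 < Cmod l / 2) by lra.
  generalize (filter_and _ _ (Hf _ Hl2) (Hf _ He')).
  apply filter_imp. intros x [h1 h2].
  assert (Hx : Cmod l / 2 < Cmod (f x)).
  { rewrite Cmod_minus_sym in h1. pose proof (Cmod_triangle_rev l (f x)). lra. }
  assert (Hx0 : f x <> RtoC 0) by (apply Cmod_gt_0; lra).
  replace (/ f x - / l)%C with ((l - f x) / (f x * l))%C by (field; auto).
  rewrite Cmod_div by (now apply Cmult_neq_0).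
  rewrite Cmod_mult, Cmod_minus_sym.
  apply (Rmult_lt_reg_r (Cmod (f x) * Cmod l)); [nra|].
  unfold Rdiv. rewrite Rmult_assoc, Rinv_l by nra. rewrite Rmult_1_r.
  eapply Rlt_le_trans; [exact h2|].
  apply Rmult_le_compat_l; nra.
Qed.

Lemma ctends_unique {T} (F : (T -> Prop) -> Prop) {FF : ProperFilter F} f (l m : C) :
  ctends F f l -> ctends F f m -> l = m.
Proof.
  intros Hl Hm. apply Cminus_eq_0, Cmod_eq_zero_eps. intros eps He.
  assert (He2 : 0 < eps / 2) by lra.
  destruct (filter_ex _ (filter_and _ _ (Hl _ He2) (Hm _ He2)))
    as [x [h1 h2]].
  rewrite Cmod_minus_sym in h1.
  pose proof (Cmod_triangle_minus3 l (f x) m). lra.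
Qed.

Lemma ctends_le {T} (F : (T -> Prop) -> Prop) {FF : ProperFilter F} f (l : C) M :
  F (fun x => Cmod (f x) <= M) -> ctends F f l -> Cmod l <= M.
Proof.
  intros HM Hl. apply le_epsilon. intros eps He.
  destruct (filter_ex _ (filter_and _ _ HM (Hl eps He))) as [x [h1 h2]].
  rewrite Cmod_minus_sym in h2.
  pose proof (Cmod_triangle_rev l (f x)). lra.
Qed.

Definition cnear (z : C) (P : C -> Prop) : Prop :=
  exists d, 0 < d /\ forall w, Cmod (w - z)%C < d -> P w.

Definition cnear' (z : C) (P : C -> Prop) : Prop :=
  exists d, 0 < d /\ forall w, w <> z -> Cmod (w - z)%C < d -> P w.

#[export] Instance cnear_filter z : ProperFilter (cnear z).
Proof.
  constructor.
  - intros P (d & Hd & H). exists z. apply H.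
    now rewrite Cmod_minus_diag.
  - constructor.
    + exists 1. split; auto. lra.
    + intros P Q (d & Hd & H) (e & He & K). exists (Rmin d e).
      split; [now apply Rmin_glb_lt|]. intros w Hw. split.
      * apply H. eapply Rlt_le_trans; [exact Hw|apply Rmin_l].
      * apply K. eapply Rlt_le_trans; [exact Hw|apply Rmin_r].
    + intros P Q HPQ (d & Hd & H). exists d. auto.
Qed.

#[export] Instance cnear'_filter z : ProperFilter (cnear' z).
Proof.
  constructor.
  - intros P (d & Hd & H). exists (z + RtoC (d/2))%C. apply H.
    + intros E. assert (E' : RtoC (d/2) = RtoC 0).
      { replace (RtoC (d/2)) with ((z + RtoC (d/2)) - z)%C by ring. rewrite E. ring. }
      apply RtoC_inj in E'. lra.
    + replace (z + RtoC (d/2) - z)%C with (RtoC (d/2)) by ring.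
      rewrite Cmod_R, Rabs_pos_eq; lra.
  - constructor.
    + exists 1. split; auto. lra.
    + intros P Q (d & Hd & H) (e & He & K). exists (Rmin d e).
      split; [now apply Rmin_glb_lt|]. intros w Hw' Hw. split.
      * apply H; auto. eapply Rlt_le_trans; [exact Hw|apply Rmin_l].
      * apply K; auto. eapply Rlt_le_trans; [exact Hw|apply Rmin_r].
    + intros P Q HPQ (d & Hd & H). exists d. auto.
Qed.

Lemma cnear_cnear' z P : cnear z P -> cnear' z P.
Proof. intros (d & Hd & H). exists d. auto. Qed.

Definition ccont (f : C -> C) (z : C) : Prop := ctends (cnear z) f (f z).

Lemma ctends_comp {T} (F : (T -> Prop) -> Prop) {FF : Filter F} (g : T -> C) (f : C -> C) (w : C) :
  ctends F g w -> ccont f w -> ctends F (fun x => f (g x)) (f w).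
Proof.
  intros Hg Hf eps He. destruct (Hf eps He) as (d & Hd & H).
  generalize (Hg d Hd). apply filter_imp. auto.
Qed.

Lemma ctends_cnear_cnear' f z l : ctends (cnear z) f l -> ctends (cnear' z) f l.
Proof. intros H eps He. apply cnear_cnear'. auto. Qed.

Lemma ccont_of_cnear' f z : ctends (cnear' z) f (f z) -> ccont f z.
Proof.
  intros H eps He. destruct (H eps He) as (d & Hd & K). exists d. split; auto.
  intros w Hw. destruct (classic (w = z)) as [->|n]; auto.
  now rewrite Cmod_minus_diag.
Qed.

(* A common setting for complex and for real differentiation: [u] is the
   increment of the variable along the filter [F]. *)
Record increment {T} (F : (T -> Prop) -> Prop) (u : T -> C) : Prop := {
  increment_filter : Filter F;
  increment_tends : ctends F u (RtoC 0);
  increment_nz : F (fun x => u x <> RtoC 0) }.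

(** The base value [f0] is a separate argument: the elements of [T] only index the filter, and none
    of them has to be the point of differentiation. *)
Definition gder {T} (F : (T -> Prop) -> Prop) (u f : T -> C) (f0 l : C) : Prop :=
  ctends F (fun x => (f x - f0) / u x)%C l.

Lemma gder_tends {T} (F : (T -> Prop) -> Prop) u f f0 l :
  increment F u -> gder F u f f0 l -> ctends F f f0.
Proof.
  intros [FF Ht Hn] Hd.
  apply (ctends_ext F (fun x => f0 + (f x - f0) / u x * u x)%C).
  - revert Hn. apply filter_imp. intros x h. now field.
  - apply (ctends_eq F _ (f0 + l * RtoC 0)%C); [|ring].
    apply ctends_plus; [auto|now apply ctends_const|].
    now apply ctends_mult.
Qed.

Lemma gder_const {T} (F : (T -> Prop) -> Prop) u c :
  increment F u -> gder F u (fun _ => c) c (RtoC 0).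
Proof.
  intros [FF Ht Hn]. apply (ctends_ext F (fun x => RtoC 0)).
  - revert Hn. apply filter_imp. intros x h. now field.
  - now apply ctends_const.
Qed.

Lemma gder_plus {T} (F : (T -> Prop) -> Prop) u f g f0 g0 l m :
  increment F u -> gder F u f f0 l -> gder F u g g0 m ->
  gder F u (fun x => f x + g x)%C (f0 + g0)%C (l + m)%C.
Proof.
  intros [FF Ht Hn] Hf Hg.
  apply (ctends_ext F (fun x => (f x - f0) / u x + (g x - g0) / u x)%C).
  - revert Hn. apply filter_imp. intros x h. now field.
  - now apply ctends_plus.
Qed.

Lemma gder_mult {T} (F : (T -> Prop) -> Prop) u f g f0 g0 l m :
  increment F u -> gder F u f f0 l -> gder F u g g0 m ->
  gder F u (fun x => f x * g x)%C (f0 * g0)%C (l * g0 + f0 * m)%C.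
Proof.
  intros Hu Hf Hg. pose proof (gder_tends F u g g0 m Hu Hg) as Hgt. destruct Hu as [FF Ht Hn].
  apply (ctends_ext F (fun x => (f x - f0) / u x * g x + f0 * ((g x - g0) / u x))%C).
  - revert Hn. apply filter_imp. intros x h. now field.
  - apply ctends_plus; auto.
    + now apply ctends_mult.
    + now apply ctends_scal.
Qed.

Lemma gder_ext {T} (F : (T -> Prop) -> Prop) {FF : Filter F} u f g f0 l :
  F (fun x => f x = g x) -> gder F u f f0 l -> gder F u g f0 l.
Proof.
  intros H. apply ctends_ext; auto. revert H. apply filter_imp. now intros x ->.
Qed.

Definition cder (f : C -> C) (z l : C) : Prop :=
  gder (cnear' z) (fun w => w - z)%C f (f z) l.

Lemma cnear'_increment z : increment (cnear' z) (fun w => w - z)%C.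
Proof.
  split.
  - apply _.
  - intros eps He. exists eps. split; auto. intros w _ Hw.
    now replace (w - z - RtoC 0)%C with (w - z)%C by ring.
  - exists 1. split; [lra|]. intros w h _. now apply Cminus_neq_0.
Qed.

(* Caratheodory's form of differentiability, which makes the chain rule
   insensitive to [g x = g0]. *)
Lemma cder_factor f z l : cder f z l ->
  exists q, ccont q z /\ q z = l /\ forall w, (f w - f z = q w * (w - z))%C.
Proof.
  intros H.
  exists (fun w => if excluded_middle_informative (w = z) then l else ((f w - f z) / (w - z))%C).
  split; [|split].
  - apply ccont_of_cnear'. destruct (excluded_middle_informative (z = z)) as [_|n]; [|now destruct n].
    eapply ctends_ext; [apply _| |exact H]. exists 1. split; [lra|]. intros w hw _.
    now destruct (excluded_middle_informative (w = z)).
  - now destruct (excluded_middle_informative (z = z)) as [_|n].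
  - intros w. destruct (excluded_middle_informative (w = z)) as [->|n].
    + ring.
    + field. now apply Cminus_neq_0.
Qed.

(** A mixed chain rule: the inner function may vary along any filter, in particular with real time,
    while the outer one is complex differentiable. It yields the time derivative of [(f_t(z) / z)^n]
    as well as [cder_comp]. *)
Lemma gder_comp {T} (F : (T -> Prop) -> Prop) u g g0 l f m :
  increment F u -> gder F u g g0 l -> cder f g0 m ->
  gder F u (fun x => f (g x)) (f g0) (m * l)%C.
Proof.
  intros Hu Hg Hf. pose proof (gder_tends F u g g0 l Hu Hg) as Hgt. destruct Hu as [FF Ht Hn].
  destruct (cder_factor f g0 m Hf) as (q & Hq & Hq0 & Hqf).
  apply (ctends_ext F (fun x => q (g x) * ((g x - g0) / u x))%C).
  - revert Hn. apply filter_imp. intros x h. rewrite Hqf. now field.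
  - apply ctends_mult; auto. rewrite <- Hq0. now apply ctends_comp.
Qed.

Lemma cder_ccont f z l : cder f z l -> ccont f z.
Proof. intros H. apply ccont_of_cnear'. eapply gder_tends; [apply cnear'_increment|exact H]. Qed.

Lemma cder_unique f z l m : cder f z l -> cder f z m -> l = m.
Proof. apply ctends_unique, _. Qed.

Lemma cder_eq f z l m : cder f z l -> l = m -> cder f z m.
Proof. now intros H <-. Qed.

Lemma cder_ext f g z l : cnear z (fun w => f w = g w) -> cder f z l -> cder g z l.
Proof.
  intros (d & Hd & H) Hf. unfold cder. rewrite <- (H z).
  2:{ now rewrite Cmod_minus_diag. }
  eapply gder_ext; [apply _| |exact Hf]. apply cnear_cnear'. now exists d.
Qed.

Lemma cder_const c z : cder (fun _ => c) z (RtoC 0).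
Proof. apply gder_const, cnear'_increment. Qed.

Lemma cder_id z : cder (fun w => w) z (RtoC 1).
Proof.
  apply (ctends_ext _ (fun _ => RtoC 1)); [|apply ctends_const, _].
  exists 1. split; [lra|]. intros w h _. field. now apply Cminus_neq_0.
Qed.

Lemma cder_plus f g z l m : cder f z l -> cder g z m -> cder (fun w => f w + g w)%C z (l + m)%C.
Proof. apply gder_plus, cnear'_increment. Qed.

Lemma cder_mult f g z l m : cder f z l -> cder g z m ->
  cder (fun w => f w * g w)%C z (l * g z + f z * m)%C.
Proof. apply gder_mult, cnear'_increment. Qed.

Lemma cder_scal c f z l : cder f z l -> cder (fun w => c * f w)%C z (c * l)%C.
Proof.
  intros H. eapply cder_eq; [apply cder_mult; [apply cder_const|exact H]|]. cbv beta; ring.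
Qed.

Lemma cder_minus f g z l m : cder f z l -> cder g z m -> cder (fun w => f w - g w)%C z (l - m)%C.
Proof.
  intros Hf Hg. apply (cder_ext (fun w => f w + RtoC (-1) * g w)%C).
  - apply filter_forall. intros w. cbv beta; ring.
  - eapply cder_eq; [apply cder_plus; [exact Hf|apply cder_scal, Hg]|]. cbv beta; ring.
Qed.

Lemma cder_comp f g z l m : cder g z l -> cder f (g z) m -> cder (fun w => f (g w)) z (m * l)%C.
Proof. apply gder_comp, cnear'_increment. Qed.

Lemma ccont_neq0 f z : ccont f z -> f z <> RtoC 0 -> cnear z (fun w => f w <> RtoC 0).
Proof.
  intros Hf Hz. generalize (Hf (Cmod (f z)) (proj1 (Cmod_gt_0 _) Hz)).
  apply filter_imp. intros w Hw E. rewrite E in Hw.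
  replace (RtoC 0 - f z)%C with (- f z)%C in Hw by ring. rewrite Cmod_opp in Hw. lra.
Qed.

Lemma cder_Cinv z : z <> RtoC 0 -> cder Cinv z (- / (z * z))%C.
Proof.
  intros Hz.
  assert (Hc : ccont (fun w => w) z) by (eapply cder_ccont, cder_id).
  apply (ctends_ext _ (fun w => RtoC (-1) * / z * / w)%C).
  - destruct (ccont_neq0 _ z Hc Hz) as (d & Hd & H). exists d. split; auto.
    intros w h1 h2. specialize (H w h2). simpl in H. field. repeat split; auto.
    now apply Cminus_neq_0.
  - replace (- / (z * z))%C with (RtoC (-1) * / z * / z)%C by (field; auto).
    apply ctends_scal; [apply _|]. apply ctends_inv; auto; [apply _|].
    now apply ctends_cnear_cnear'.
Qed.

Lemma cder_inv f z l : cder f z l -> f z <> RtoC 0 ->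
  cder (fun w => / f w)%C z (- l / (f z * f z))%C.
Proof.
  intros Hf Hz. eapply cder_eq.
  - apply (cder_comp Cinv f); [exact Hf|apply cder_Cinv, Hz].
  - cbv beta. now field.
Qed.

Lemma cder_div f g z l m : cder f z l -> cder g z m -> g z <> RtoC 0 ->
  cder (fun w => f w / g w)%C z (l / g z - f z * m / (g z * g z))%C.
Proof.
  intros Hf Hg Hz. eapply cder_eq.
  - apply (cder_mult f (fun w => / g w)%C); [exact Hf|eapply cder_inv; [exact Hg|exact Hz]].
  - cbv beta. now field.
Qed.

Definition cdiff (f : C -> C) (z : C) : Prop := exists l, cder f z l.

Lemma cdiff_const c z : cdiff (fun _ => c) z.
Proof. eexists. apply cder_const. Qed.
Lemma cdiff_id z : cdiff (fun w => w) z.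
Proof. eexists. apply cder_id. Qed.
Lemma cdiff_plus f g z : cdiff f z -> cdiff g z -> cdiff (fun w => f w + g w)%C z.
Proof. intros [l Hl] [m Hm]. eexists. eapply cder_plus; eassumption. Qed.
Lemma cdiff_minus f g z : cdiff f z -> cdiff g z -> cdiff (fun w => f w - g w)%C z.
Proof. intros [l Hl] [m Hm]. eexists. eapply cder_minus; eassumption. Qed.
Lemma cdiff_mult f g z : cdiff f z -> cdiff g z -> cdiff (fun w => f w * g w)%C z.
Proof. intros [l Hl] [m Hm]. eexists. eapply cder_mult; eassumption. Qed.
Lemma cdiff_div f g z : cdiff f z -> cdiff g z -> g z <> RtoC 0 -> cdiff (fun w => f w / g w)%C z.
Proof. intros [l Hl] [m Hm] Hz. eexists. eapply cder_div; eassumption. Qed.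
Lemma cdiff_comp f g z : cdiff g z -> cdiff f (g z) -> cdiff (fun w => f (g w)) z.
Proof. intros [l Hl] [m Hm]. eexists. eapply cder_comp; eassumption. Qed.
Lemma cdiff_ext f g z : cnear z (fun w => f w = g w) -> cdiff f z -> cdiff g z.
Proof. intros H [l Hl]. exists l. now apply (cder_ext f). Qed.
Lemma cdiff_pow n f z : cdiff f z -> cdiff (fun w => f w ^ n)%C z.
Proof.
  intros H. induction n as [|n IH]; simpl.
  - apply cdiff_const.
  - now apply cdiff_mult.
Qed.
Lemma cdiff_ccont f z : cdiff f z -> ccont f z.
Proof. intros [l H]. eapply cder_ccont, H. Qed.

(** * Integrals of complex-valued functions *)

Definition pcont (g : R -> C) (s : R) : Prop := ctends (@locally R_UniformSpace s) g (g s).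

Definition icont (g : R -> C) : Prop := forall s, 0 <= s <= 1 -> pcont g s.

Definition CInt (g : R -> C) : C :=
  (RInt (fun s => Re (g s)) 0 1, RInt (fun s => Im (g s)) 0 1).

Lemma im_le_Cmod (c : C) : Rabs (Im c) <= Cmod c.
Proof. eapply Rle_trans; [apply Rmax_r|apply Rmax_Cmod]. Qed.

Lemma Cmod_le_Re_Im (c : C) : Cmod c <= Rabs (Re c) + Rabs (Im c).
Proof.
  replace c with (RtoC (Re c) + Ci * RtoC (Im c))%C at 1.
  - eapply Rle_trans; [apply Cmod_triangle|].
    rewrite Cmod_mult, Cmod_Ci, !Cmod_R. lra.
  - destruct c as [x y]. unfold Cplus, Cmult, Ci, RtoC, Re, Im; simpl. f_equal; ring.
Qed.

Lemma pcont_RtoC (h : R -> R) s : continuous h s -> pcont (fun x => RtoC (h x)) s.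
Proof.
  intros H eps He. unfold continuous in H.
  rewrite filterlim_locally in H. generalize (H (mkposreal eps He)).
  apply filter_imp. intros x Hx. rewrite <- RtoC_minus, Cmod_R. exact Hx.
Qed.

Lemma pcont_Re g s : pcont g s -> continuous (fun x => Re (g x)) s.
Proof.
  intros H. apply filterlim_locally. intros eps. generalize (H eps (cond_pos eps)).
  apply filter_imp. intros x Hx. eapply Rle_lt_trans; [|exact Hx].
  eapply Rle_trans; [|apply re_le_Cmod]. apply Req_le. unfold minus, plus, opp; simpl.
  reflexivity.
Qed.

Lemma pcont_Im g s : pcont g s -> continuous (fun x => Im (g x)) s.
Proof.
  intros H. apply filterlim_locally. intros eps. generalize (H eps (cond_pos eps)).
  apply filter_imp. intros x Hx. eapply Rle_lt_trans; [|exact Hx].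
  eapply Rle_trans; [|apply im_le_Cmod]. apply Req_le. reflexivity.
Qed.

Lemma pcont_const c s : pcont (fun _ => c) s.
Proof. apply ctends_const, _. Qed.
Lemma pcont_plus f g s : pcont f s -> pcont g s -> pcont (fun x => f x + g x)%C s.
Proof. intros. apply ctends_plus; auto; apply _. Qed.
Lemma pcont_minus f g s : pcont f s -> pcont g s -> pcont (fun x => f x - g x)%C s.
Proof. intros. apply ctends_minus; auto; apply _. Qed.
Lemma pcont_mult f g s : pcont f s -> pcont g s -> pcont (fun x => f x * g x)%C s.
Proof. intros. apply ctends_mult; auto; apply _. Qed.
Lemma pcont_comp (f : C -> C) g s : pcont g s -> ccont f (g s) -> pcont (fun x => f (g x)) s.
Proof. intros. apply ctends_comp; auto; apply _. Qed.
Lemma pcont_Cmod g s : pcont g s -> continuous (fun x => Cmod (g x)) s.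
Proof.
  intros H. apply filterlim_locally. intros eps. generalize (H eps (cond_pos eps)).
  apply filter_imp. intros x Hx. apply Rabs_lt_between'.
  pose proof (Cmod_triangle_rev (g x) (g s)).
  pose proof (Cmod_triangle_rev (g s) (g x)). rewrite Cmod_minus_sym in H1. split; lra.
Qed.

Lemma ex_RInt_icont_Re g : icont g -> ex_RInt (fun s => Re (g s)) 0 1.
Proof.
  intros H. apply (ex_RInt_continuous (V := R_CompleteNormedModule)). intros s Hs.
  rewrite Rmin_left, Rmax_right in Hs by lra. now apply pcont_Re, H.
Qed.

Lemma ex_RInt_icont_Im g : icont g -> ex_RInt (fun s => Im (g s)) 0 1.
Proof.
  intros H. apply (ex_RInt_continuous (V := R_CompleteNormedModule)). intros s Hs.
  rewrite Rmin_left, Rmax_right in Hs by lra. now apply pcont_Im, H.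
Qed.

Lemma CInt_ext f g : (forall s, 0 <= s <= 1 -> f s = g s) -> CInt f = CInt g.
Proof.
  intros H. unfold CInt. f_equal; apply RInt_ext; intros s Hs;
  rewrite Rmin_left, Rmax_right in Hs by lra; rewrite H; auto; lra.
Qed.

Lemma CInt_plus f g : icont f -> icont g -> CInt (fun s => f s + g s)%C = (CInt f + CInt g)%C.
Proof.
  intros Hf Hg. unfold CInt, Cplus; simpl. f_equal.
  - rewrite <- (RInt_plus (V := R_CompleteNormedModule)); auto using ex_RInt_icont_Re.
  - rewrite <- (RInt_plus (V := R_CompleteNormedModule)); auto using ex_RInt_icont_Im.
Qed.

Lemma CInt_scal c f : icont f -> CInt (fun s => c * f s)%C = (c * CInt f)%C.
Proof.
  intros Hf. unfold CInt, Cmult; simpl.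
  pose proof (ex_RInt_icont_Re f Hf) as H1. pose proof (ex_RInt_icont_Im f Hf) as H2.
  f_equal.
  - transitivity (minus (scal (fst c) (RInt (fun s => Re (f s)) 0 1)) (scal (snd c) (RInt (fun s => Im (f s)) 0 1))).
    2: reflexivity.
    rewrite <- !(RInt_scal (V := R_CompleteNormedModule)) by auto.
    rewrite <- (RInt_minus (V := R_CompleteNormedModule)); [reflexivity| |];
    now apply (ex_RInt_scal (V := R_CompleteNormedModule)).
  - transitivity (plus (scal (fst c) (RInt (fun s => Im (f s)) 0 1)) (scal (snd c) (RInt (fun s => Re (f s)) 0 1))).
    2: reflexivity.
    rewrite <- !(RInt_scal (V := R_CompleteNormedModule)) by auto.
    rewrite <- (RInt_plus (V := R_CompleteNormedModule)); [reflexivity| |];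
    now apply (ex_RInt_scal (V := R_CompleteNormedModule)).
Qed.

Lemma CInt_const c : CInt (fun _ => c) = c.
Proof.
  unfold CInt. rewrite !RInt_const. destruct c as [x y].
  unfold scal; simpl; unfold mult; simpl. f_equal; ring.
Qed.

Lemma icont_const c : icont (fun _ => c).
Proof. intros s _. apply pcont_const. Qed.
Lemma icont_minus f g : icont f -> icont g -> icont (fun x => f x - g x)%C.
Proof. intros H1 H2 s Hs. apply pcont_minus; auto. Qed.
Lemma icont_mult f g : icont f -> icont g -> icont (fun x => f x * g x)%C.
Proof. intros H1 H2 s Hs. apply pcont_mult; auto. Qed.
Lemma icont_RtoC (h : R -> R) : (forall s, continuous h s) -> icont (fun x => RtoC (h x)).
Proof. intros H s _. now apply pcont_RtoC. Qed.
Lemma icont_id : icont (fun x => RtoC x).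
Proof. apply (icont_RtoC (fun x => x)). intros s. apply continuous_id. Qed.

Lemma CInt_minus f g : icont f -> icont g -> CInt (fun s => f s - g s)%C = (CInt f - CInt g)%C.
Proof.
  intros Hf Hg. rewrite (CInt_ext _ (fun s => f s + RtoC (-1) * g s)%C).
  - rewrite CInt_plus, CInt_scal; auto.
    + ring.
    + apply icont_mult; auto. apply icont_const.
  - intros s _. ring.
Qed.

(* Rotating the integral onto the positive axis reduces the estimate to the
   real part of the integrand. *)
Lemma Cmod_CInt_le_RInt g (h : R -> R) : icont g ->
  (forall s, 0 <= s <= 1 -> Cmod (g s) <= h s) -> ex_RInt h 0 1 ->
  Cmod (CInt g) <= RInt h 0 1.
Proof.
  intros Hg Hh Hex.
  destruct (Req_dec (Cmod (CInt g)) 0) as [E|E].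
  - rewrite E. apply RInt_ge_0; [lra|auto|]. intros s Hs.
    eapply Rle_trans; [apply Cmod_ge_0|apply Hh]. lra.
  - assert (Hn : RtoC (Cmod (CInt g)) <> RtoC 0) by (intros K; apply E, RtoC_inj, K).
    set (c := (Cconj (CInt g) / RtoC (Cmod (CInt g)))%C).
    assert (Hp : 0 < Cmod (CInt g)) by (pose proof (Cmod_ge_0 (CInt g)); lra).
    assert (Hc : Cmod c = 1).
    { unfold c. rewrite Cmod_div, Cmod_conj, Cmod_R, Rabs_pos_eq; auto; [|lra]. field. lra. }
    assert (Hr : (c * CInt g)%C = RtoC (Cmod (CInt g))).
    { unfold c. transitivity ((CInt g * Cconj (CInt g)) / RtoC (Cmod (CInt g)))%C; [now field|].
      rewrite <- Cmod2_conj, RtoC_pow. simpl. now field. }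
    assert (Hcg : icont (fun s => c * g s)%C) by (apply icont_mult; [apply icont_const|auto]).
    rewrite <- CInt_scal in Hr by auto.
    apply (f_equal Re) in Hr. clearbody c.
    change (RInt (fun s => Re (c * g s)%C) 0 1 = Cmod (CInt g)) in Hr. rewrite <- Hr.
    apply RInt_le; auto; [lra|now apply (ex_RInt_icont_Re (fun s => c * g s)%C)|].
    intros s Hs. eapply Rle_trans; [apply Rle_abs|].
    eapply Rle_trans; [apply re_le_Cmod|]. rewrite Cmod_mult, Hc, Rmult_1_l.
    apply Hh. lra.
Qed.

Lemma Cmod_CInt_le g M : icont g -> (forall s, 0 <= s <= 1 -> Cmod (g s) <= M) ->
  Cmod (CInt g) <= M.
Proof.
  intros Hg HM. eapply Rle_trans; [apply (Cmod_CInt_le_RInt g (fun _ => M)); auto|].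
  - apply ex_RInt_const.
  - rewrite RInt_const. unfold scal; simpl; unfold mult; simpl. lra.
Qed.

Lemma RInt_half (h : R -> R) c : (forall s, c <= s <= c + / 2 -> continuous h s) ->
  ex_RInt h c (c + / 2) /\ RInt h c (c + / 2) = / 2 * RInt (fun s => h (c + s / 2)) 0 1.
Proof.
  intros Hh.
  assert (E : ex_RInt h c (c + / 2)).
  { apply (ex_RInt_continuous (V := R_CompleteNormedModule)). intros s Hs.
    rewrite Rmin_left, Rmax_right in Hs by lra. now apply Hh. }
  split; auto.
  pose proof (RInt_comp_lin (V := R_CompleteNormedModule) h (/2) c 0 1) as K.
  replace (/ 2 * 0 + c) with c in K by lra. replace (/ 2 * 1 + c) with (c + / 2) in K by lra.
  rewrite <- K by auto. rewrite (RInt_scal (V := R_CompleteNormedModule)).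
  - unfold scal; simpl; unfold mult; simpl. f_equal. apply RInt_ext. intros s _. f_equal. lra.
  - apply (ex_RInt_continuous (V := R_CompleteNormedModule)). intros s Hs.
    rewrite Rmin_left, Rmax_right in Hs by lra. apply (continuous_comp (fun s => / 2 * s + c) h).
    + apply (ex_derive_continuous (V := R_NormedModule)). auto_derive. auto.
    + apply Hh. lra.
Qed.

Lemma RInt_halves (h : R -> R) : (forall s, 0 <= s <= 1 -> continuous h s) ->
  RInt h 0 1 = / 2 * (RInt (fun s => h (s / 2)) 0 1 + RInt (fun s => h ((1 + s) / 2)) 0 1).
Proof.
  intros Hh.
  destruct (RInt_half h 0) as [E1 K1]; [intros s Hs; apply Hh; lra|].
  destruct (RInt_half h (/ 2)) as [E2 K2]; [intros s Hs; apply Hh; lra|].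
  rewrite Rplus_0_l in *. replace (/ 2 + / 2) with 1 in * by lra.
  rewrite <- (RInt_Chasles (V := R_CompleteNormedModule) h 0 (/ 2) 1) by auto.
  rewrite K1, K2. unfold plus; simpl. rewrite Rmult_plus_distr_l.
  f_equal; f_equal; apply RInt_ext; intros s _; f_equal; lra.
Qed.

Lemma CInt_halves g : icont g ->
  CInt g = (/ RtoC 2 * (CInt (fun s => g (s / 2)%R) + CInt (fun s => g ((1 + s) / 2)%R)))%C.
Proof.
  intros Hg. unfold CInt at 1.
  rewrite (RInt_halves (fun s => Re (g s))), (RInt_halves (fun s => Im (g s))).
  - rewrite <- RtoC_inv by lra. unfold CInt, Cplus, Cmult, RtoC; simpl. f_equal; ring.
  - intros s Hs. now apply pcont_Im, Hg.
  - intros s Hs. now apply pcont_Re, Hg.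
Qed.

Lemma CInt_id : CInt RtoC = (/ RtoC 2)%C.
Proof.
  rewrite <- RtoC_inv by lra. unfold CInt, RtoC; simpl. rewrite RInt_const.
  replace (RInt (fun s => s) 0 1) with (/2).
  - f_equal. unfold scal; simpl; unfold mult; simpl. ring.
  - symmetry. apply is_RInt_unique.
    replace (/2) with (minus ((fun s => s * s / 2) 1) ((fun s => s * s / 2) 0))
      by (unfold minus, plus, opp; simpl; lra).
    apply (is_RInt_derive (V := R_CompleteNormedModule) (fun s => s * s / 2) (fun s => s)).
    + intros x _. auto_derive; auto. lra.
    + intros x _. apply continuous_id.
Qed.

(** * Goursat's theorem *)

(** The contour integral along the segment from [z] to [z + u]. Giving the displacement instead of
    the end point makes bisection a halving of [u]. *)
Definition seg (F : C -> C) (z u : C) : C := (u * CInt (fun s => F (z + RtoC s * u)))%C.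

(** The contour integral over the boundary of the parallelogram with corners [z], [z + u],
    [z + u + v], [z + v]; the last two sides are run backwards, hence the minus signs. *)
Definition pgram (F : C -> C) (z u v : C) : C :=
  (seg F z u + seg F (z + u) v - seg F (z + v) u - seg F z v)%C.

Lemma icont_seg F z u : (forall s, 0 <= s <= 1 -> ccont F (z + RtoC s * u)%C) ->
  icont (fun s => F (z + RtoC s * u)%C).
Proof.
  intros H s Hs. apply (pcont_comp F (fun s => z + RtoC s * u)%C); auto.
  apply pcont_plus; [apply pcont_const|]. apply pcont_mult; [now apply icont_id|apply pcont_const].
Qed.

Lemma seg_halves F z u : (forall s, 0 <= s <= 1 -> ccont F (z + RtoC s * u)%C) ->
  seg F z u = (seg F z (u / RtoC 2) + seg F (z + u / RtoC 2) (u / RtoC 2))%C.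
Proof.
  intros H. unfold seg. rewrite CInt_halves by (now apply icont_seg).
  rewrite (CInt_ext (fun s => F (z + RtoC (s / 2)%R * u)%C) (fun s => F (z + RtoC s * (u / RtoC 2))%C)).
  - rewrite (CInt_ext (fun s => F (z + RtoC ((1 + s) / 2)%R * u)%C)
      (fun s => F (z + u / RtoC 2 + RtoC s * (u / RtoC 2))%C)).
    + field.
    + intros s _. f_equal. rewrite RtoC_div, RtoC_plus by lra. field.
  - intros s _. f_equal. rewrite RtoC_div by lra. field.
Qed.

Lemma seg_plus F G z u :
  (forall s, 0 <= s <= 1 -> ccont F (z + RtoC s * u)%C) ->
  (forall s, 0 <= s <= 1 -> ccont G (z + RtoC s * u)%C) ->
  seg (fun w => F w + G w)%C z u = (seg F z u + seg G z u)%C.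
Proof.
  intros HF HG. unfold seg. rewrite CInt_plus by (now apply icont_seg). ring.
Qed.

(** The mean of an affine function over a segment is its value at the midpoint [z + u / 2]. *)
Lemma seg_affine A B z u :
  seg (fun w => A + B * w)%C z u = (u * (A + B * z + B * u / RtoC 2))%C.
Proof.
  unfold seg. f_equal.
  rewrite (CInt_ext _ (fun s => (A + B * z) + (B * u) * RtoC s)%C).
  - rewrite CInt_plus, CInt_const, CInt_scal, CInt_id.
    + field.
    + apply icont_id.
    + apply icont_const.
    + apply icont_mult; [apply icont_const|apply icont_id].
  - intros s _. ring.
Qed.

Lemma pgram_affine A B z u v : pgram (fun w => A + B * w)%C z u v = RtoC 0.
Proof. unfold pgram. rewrite !seg_affine. field. Qed.

Lemma Cmod_seg_le F z u M :
  (forall s, 0 <= s <= 1 -> ccont F (z + RtoC s * u)%C) ->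
  (forall s, 0 <= s <= 1 -> Cmod (F (z + RtoC s * u)%C) <= M) ->
  Cmod (seg F z u) <= Cmod u * M.
Proof.
  intros H HM. unfold seg. rewrite Cmod_mult. apply Rmult_le_compat_l; [apply Cmod_ge_0|].
  apply Cmod_CInt_le; auto. now apply icont_seg.
Qed.

Definition on_pgram (P : C -> Prop) (z u v : C) : Prop :=
  forall s t, 0 <= s <= 1 -> 0 <= t <= 1 -> P (z + RtoC s * u + RtoC t * v)%C.

Lemma on_pgram_sides (P : C -> Prop) z u v : on_pgram P z u v ->
  (forall s, 0 <= s <= 1 -> P (z + RtoC s * u)%C) /\
  (forall s, 0 <= s <= 1 -> P (z + u + RtoC s * v)%C) /\
  (forall s, 0 <= s <= 1 -> P (z + v + RtoC s * u)%C) /\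
  (forall s, 0 <= s <= 1 -> P (z + RtoC s * v)%C).
Proof.
  intros H. repeat split; intros s Hs.
  - replace (z + RtoC s * u)%C with (z + RtoC s * u + RtoC 0 * v)%C by ring. apply H; lra.
  - replace (z + u + RtoC s * v)%C with (z + RtoC 1 * u + RtoC s * v)%C by ring. apply H; lra.
  - replace (z + v + RtoC s * u)%C with (z + RtoC s * u + RtoC 1 * v)%C by ring. apply H; lra.
  - replace (z + RtoC s * v)%C with (z + RtoC 0 * u + RtoC s * v)%C by ring. apply H; lra.
Qed.

Lemma pgram_plus F G z u v : on_pgram (ccont F) z u v -> on_pgram (ccont G) z u v ->
  pgram (fun w => F w + G w)%C z u v = (pgram F z u v + pgram G z u v)%C.
Proof.
  intros HF HG. destruct (on_pgram_sides _ _ _ _ HF) as (F1 & F2 & F3 & F4).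
  destruct (on_pgram_sides _ _ _ _ HG) as (G1 & G2 & G3 & G4).
  unfold pgram. rewrite !seg_plus by auto. ring.
Qed.

Lemma Cmod_pgram_le F z u v M : on_pgram (ccont F) z u v ->
  on_pgram (fun w => Cmod (F w) <= M) z u v ->
  Cmod (pgram F z u v) <= 2 * (Cmod u + Cmod v) * M.
Proof.
  intros HF HM. destruct (on_pgram_sides _ _ _ _ HF) as (F1 & F2 & F3 & F4).
  destruct (on_pgram_sides _ _ _ _ HM) as (M1 & M2 & M3 & M4).
  unfold pgram.
  pose proof (Cmod_seg_le F z u M F1 M1). pose proof (Cmod_seg_le F (z + u)%C v M F2 M2).
  pose proof (Cmod_seg_le F (z + v)%C u M F3 M3). pose proof (Cmod_seg_le F z v M F4 M4).
  eapply Rle_trans; [apply Cmod_triangle_minus|].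
  eapply Rle_trans; [apply Rplus_le_compat_r, Cmod_triangle_minus|].
  eapply Rle_trans; [apply Rplus_le_compat_r, Rplus_le_compat_r, Cmod_triangle|].
  lra.
Qed.

Lemma on_pgram_sub (P : C -> Prop) z u v a b h : on_pgram P z u v -> 0 <= h ->
  0 <= a -> a + h <= 1 -> 0 <= b -> b + h <= 1 ->
  on_pgram P (z + RtoC a * u + RtoC b * v)%C (RtoC h * u)%C (RtoC h * v)%C.
Proof.
  intros H Hh Ha1 Ha2 Hb1 Hb2 s t Hs Ht.
  replace (z + RtoC a * u + RtoC b * v + RtoC s * (RtoC h * u) + RtoC t * (RtoC h * v))%C
    with (z + RtoC (a + s * h) * u + RtoC (b + t * h) * v)%C
    by (rewrite !RtoC_plus, !RtoC_mult; ring).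
  apply H; nra.
Qed.

(** The sides interior to the parallelogram are run twice in opposite directions and cancel. *)
Lemma pgram_quarters F z u v : on_pgram (ccont F) z u v ->
  let Q i j := pgram F (z + RtoC i * u + RtoC j * v)%C (u / RtoC 2)%C (v / RtoC 2)%C in
  pgram F z u v = (Q 0%R 0%R + Q (/ 2)%R 0%R + Q 0%R (/ 2)%R + Q (/ 2)%R (/ 2)%R)%C.
Proof.
  intros H Q. destruct (on_pgram_sides _ _ _ _ H) as (F1 & F2 & F3 & F4).
  unfold Q, pgram. rewrite (seg_halves F z u), (seg_halves F (z + u)%C v),
    (seg_halves F (z + v)%C u), (seg_halves F z v), (RtoC_inv 2) by (auto; lra).
  replace (z + RtoC 0 * u + RtoC 0 * v)%C with z by ring.
  replace (z + / RtoC 2 * u + RtoC 0 * v)%C with (z + u / RtoC 2)%C by field.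
  replace (z + RtoC 0 * u + / RtoC 2 * v)%C with (z + v / RtoC 2)%C by field.
  replace (z + / RtoC 2 * u + / RtoC 2 * v)%C with (z + u / RtoC 2 + v / RtoC 2)%C by field.
  replace (z + v / RtoC 2 + u / RtoC 2)%C with (z + u / RtoC 2 + v / RtoC 2)%C by ring.
  replace (z + v / RtoC 2 + v / RtoC 2)%C with (z + v)%C by field.
  replace (z + u / RtoC 2 + u / RtoC 2)%C with (z + u)%C by field.
  replace (z + u / RtoC 2 + v / RtoC 2 + v / RtoC 2)%C with (z + v + u / RtoC 2)%C by field.
  replace (z + u / RtoC 2 + v / RtoC 2 + u / RtoC 2)%C with (z + u + v / RtoC 2)%C by field.
  ring.
Qed.

Lemma nested_intervals (a h : nat -> R) : (forall n, 0 <= h n) ->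
  (forall n, a n <= a (S n)) -> (forall n, a (S n) + h (S n) <= a n + h n) ->
  exists x, forall n, a n <= x <= a n + h n.
Proof.
  intros Hh Ha Hb.
  assert (Ha' : forall n m, a n <= a (n + m)%nat).
  { intros n m. induction m as [|m IH]; [rewrite Nat.add_0_r; lra|].
    rewrite Nat.add_succ_r. specialize (Ha (n + m)%nat). lra. }
  assert (Hb' : forall n m, a (n + m)%nat + h (n + m)%nat <= a n + h n).
  { intros n m. induction m as [|m IH]; [rewrite Nat.add_0_r; lra|].
    rewrite Nat.add_succ_r. specialize (Hb (n + m)%nat). lra. }
  assert (Hub : forall n m, a n <= a m + h m).
  { intros n m. destruct (Nat.le_ge_cases n m) as [L|L];
    pose proof (Nat.sub_add _ _ L) as E; rewrite Nat.add_comm in E; rewrite <- E.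
    - pose proof (Ha' n (m - n)%nat). pose proof (Hh (n + (m - n))%nat). lra.
    - pose proof (Hb' m (n - m)%nat). pose proof (Hh (m + (n - m))%nat). lra. }
  destruct (completeness (fun x => exists n, x = a n)) as [x [H1 H2]].
  - exists (a O + h O). intros y [n ->]. apply Hub.
  - now exists (a O), O.
  - exists x. intros n. split.
    + apply H1. now exists n.
    + apply H2. intros y [m ->]. apply Hub.
Qed.

Lemma pow_half_pos n : 0 < (/2) ^ n.
Proof. apply pow_lt. lra. Qed.

Lemma pow_half_small eps : 0 < eps -> exists n, (/2) ^ n < eps.
Proof.
  intros He. destruct (pow_lt_1_zero (/2)) with (y := eps) as [N HN]; auto.
  - rewrite Rabs_pos_eq; lra.
  - exists N. specialize (HN N (Nat.le_refl N)).
    rewrite Rabs_pos_eq in HN; auto. apply Rlt_le, pow_half_pos.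
Qed.

(** One of the four quarters always carries at least a quarter of the integral. Bisection takes
    place in the parameter square, where corners are pairs of reals and [nested_intervals] supplies
    the common point [(a, b)], even if [u] and [v] are linearly dependent. *)
Lemma pgram_bisection F z u v : on_pgram (ccont F) z u v ->
  exists a b, 0 <= a <= 1 /\ 0 <= b <= 1 /\ forall n, exists a' b',
    0 <= a' <= a /\ a <= a' + (/2) ^ n <= 1 /\ 0 <= b' <= b /\ b <= b' + (/2) ^ n <= 1 /\
    Cmod (pgram F z u v) <= 4 ^ n *
    Cmod (pgram F (z + RtoC a' * u + RtoC b' * v) (RtoC ((/2)^n) * u) (RtoC ((/2)^n) * v))%C.
Proof.
  intros HF.
  (* [Q n p] is the integral over the piece with corner parameters [p] and edges scaled by [2^-n];
     [V] says that the piece lies in the parameter square, [N] that [q] is an admissible successor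
     of [p]. *)
  set (Q := fun n (p : R * R) => pgram F (z + RtoC (fst p) * u + RtoC (snd p) * v)%C
    (RtoC ((/2)^n) * u)%C (RtoC ((/2)^n) * v)%C).
  set (V := fun n (p : R * R) => (0 <= fst p /\ fst p + (/2)^n <= 1) /\
    (0 <= snd p /\ snd p + (/2)^n <= 1)).
  set (N := fun n (p q : R * R) => (fst p <= fst q <= fst p + (/2)^(S n) /\
    snd p <= snd q <= snd p + (/2)^(S n)) /\ Cmod (Q n p) <= 4 * Cmod (Q (S n) q)).
  (* [V n p] stands under the existential so that a successor can be chosen for every pair,
     admissible or not. *)
  assert (Hstep : forall n p, exists q, V n p -> N n p q).
  { intros n p. destruct (classic (V n p)) as [[[h1 h2] [h3 h4]]|h]; [|now exists p].
    pose proof (pow_half_pos n) as Hn. pose proof (pow_half_pos (S n)) as Hn'.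
    assert (E2 : (/2)^n = (/2)^S n + (/2)^S n) by (simpl; lra).
    assert (HP : on_pgram (ccont F) (z + RtoC (fst p) * u + RtoC (snd p) * v)%C
      (RtoC ((/2)^n) * u)%C (RtoC ((/2)^n) * v)%C) by (apply on_pgram_sub; auto; lra).
    pose proof (pgram_quarters _ _ _ _ HP) as E.
    assert (EQ : forall i j, pgram F (z + RtoC (fst p) * u + RtoC (snd p) * v
        + RtoC i * (RtoC ((/2)^n) * u) + RtoC j * (RtoC ((/2)^n) * v))%C
      (RtoC ((/2)^n) * u / RtoC 2)%C (RtoC ((/2)^n) * v / RtoC 2)%C
      = Q (S n) (fst p + i * (/2)^n, snd p + j * (/2)^n)).
    { intros i j. unfold Q. cbn [fst snd]. simpl pow.
      rewrite !RtoC_plus, !RtoC_mult, (RtoC_inv 2) by lra. f_equal; field. }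
    cbv beta zeta in E. rewrite !EQ in E. replace (pgram _ _ _ _) with (Q n p) in E by reflexivity. clear EQ.
    rewrite !Rmult_0_l in E. change (/ 2 * (/ 2) ^ n) with ((/2)^S n) in E.
    (* Otherwise every quarter has modulus below a quarter of that of [Q n p], against the triangle
       inequality. *)
    apply NNPP. intros Hno.
    assert (Hlt : forall i j, (i = 0 \/ i = (/2)^S n) -> (j = 0 \/ j = (/2)^S n) ->
      4 * Cmod (Q (S n) (fst p + i, snd p + j)) < Cmod (Q n p)).
    { intros i j Hi Hj. apply Rnot_le_lt. intros K. apply Hno. exists (fst p + i, snd p + j).
      intros _. split; auto. cbn [fst snd]. destruct Hi as [-> | ->], Hj as [-> | ->]; lra. }
    pose proof (Hlt 0 0 (or_introl eq_refl) (or_introl eq_refl)).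
    pose proof (Hlt 0 _ (or_introl eq_refl) (or_intror eq_refl)).
    pose proof (Hlt _ 0 (or_intror eq_refl) (or_introl eq_refl)).
    pose proof (Hlt _ _ (or_intror eq_refl) (or_intror eq_refl)).
    assert (K : Cmod (Q n p) <= Cmod (Q (S n) (fst p + 0, snd p + 0))
      + Cmod (Q (S n) (fst p + (/2)^S n, snd p + 0))
      + Cmod (Q (S n) (fst p + 0, snd p + (/2)^S n))
      + Cmod (Q (S n) (fst p + (/2)^S n, snd p + (/2)^S n))).
    { rewrite E. eapply Rle_trans; [apply Cmod_triangle|]. apply Rplus_le_compat_r.
      eapply Rle_trans; [apply Cmod_triangle|]. apply Rplus_le_compat_r. apply Cmod_triangle. }
    lra. }
  set (next := fun n p => proj1_sig (constructive_indefinite_description _ (Hstep n p))).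
  assert (Hnext : forall n p, V n p -> N n p (next n p)).
  { intros n p. unfold next. apply proj2_sig. }
  set (sq := fix sq n := match n with O => (0, 0) | S m => next m (sq m) end).
  assert (HV : forall n, V n (sq n)).
  { intros n. induction n as [|n IH].
    - unfold V; simpl. lra.
    - simpl sq. destruct (Hnext n _ IH) as [[k1 k2] _]. destruct IH as [[h1 h2] [h3 h4]].
      assert (E2 : (/2)^n = (/2)^S n + (/2)^S n) by (simpl; lra).
      split; split; try lra. }
  assert (HN : forall n, N n (sq n) (sq (S n))) by (intros n; apply Hnext, HV).
  assert (E2 : forall n, (/2)^n = (/2)^S n + (/2)^S n) by (intros n; simpl; lra).
  destruct (nested_intervals (fun n => fst (sq n)) (fun n => (/2)^n)) as [a Ha].
  { intros n. apply Rlt_le, pow_half_pos. }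
  { intros n. destruct (HN n) as [[k1 k2] _]. lra. }
  { intros n. destruct (HN n) as [[k1 k2] _]. rewrite (E2 n). lra. }
  destruct (nested_intervals (fun n => snd (sq n)) (fun n => (/2)^n)) as [b Hb].
  { intros n. apply Rlt_le, pow_half_pos. }
  { intros n. destruct (HN n) as [[k1 k2] _]. lra. }
  { intros n. destruct (HN n) as [[k1 k2] _]. rewrite (E2 n). lra. }
  assert (H4 : forall n, Cmod (pgram F z u v) <= 4 ^ n * Cmod (Q n (sq n))).
  { intros n. induction n as [|n IH].
    - right. rewrite pow_O, Rmult_1_l. f_equal. unfold Q; simpl. f_equal; ring.
    - eapply Rle_trans; [exact IH|]. rewrite <- tech_pow_Rmult, (Rmult_comm 4), Rmult_assoc.
      apply Rmult_le_compat_l; [apply pow_le; lra|]. apply HN. }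
  exists a, b. split; [|split].
  - specialize (Ha O). simpl in Ha. lra.
  - specialize (Hb O). simpl in Hb. lra.
  - intros n. exists (fst (sq n)), (snd (sq n)). specialize (Ha n). specialize (Hb n).
    simpl in Ha, Hb. destruct (HV n) as [[h1 h2] [h3 h4]].
    repeat split; try lra. apply H4.
Qed.

(** At the limit point [w] of the bisection [F] is affine up to an error [r] that is small compared
    with [|x - w|]. The affine part integrates to zero, while the perimeter and the error both scale
    like [2^-n], which compensates the factor [4^n]. *)
Theorem goursat F z u v : on_pgram (cdiff F) z u v -> pgram F z u v = RtoC 0.
Proof.
  intros HF.
  assert (HFc : on_pgram (ccont F) z u v) by (intros s t Hs Ht; apply cdiff_ccont; auto).
  destruct (pgram_bisection F z u v HFc) as (a & b & Ha & Hb & H).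
  set (w := (z + RtoC a * u + RtoC b * v)%C).
  destruct (HF a b Ha Hb) as [l Hl]. fold w in Hl.
  destruct (cder_factor F w l Hl) as (q & Hq & Hq0 & HqF).
  set (L := Cmod u + Cmod v).
  assert (HL : 0 <= L) by (unfold L; pose proof (Cmod_ge_0 u); pose proof (Cmod_ge_0 v); lra).
  apply Cmod_eq_zero_eps. intros eps He.
  (* The estimate ends with [2 * L * L * e]; [L + 1] replaces [L] because both edges may be zero. *)
  set (e := eps / (2 * (L + 1) * (L + 1))).
  assert (He' : 0 < e) by (apply Rdiv_lt_0_compat; nra).
  destruct (Hq e He') as (d & Hd & Hqd).
  destruct (pow_half_small (d / (L + 1))) as [n Hn]; [apply Rdiv_lt_0_compat; lra|].
  destruct (H n) as (a' & b' & Ha' & Ha2 & Hb' & Hb2 & K).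
  pose proof (pow_half_pos n) as Hp. set (h := (/2)^n) in *.
  eapply Rle_trans; [exact K|].
  set (z' := (z + RtoC a' * u + RtoC b' * v)%C) in *.
  assert (HP : on_pgram (ccont F) z' (RtoC h * u)%C (RtoC h * v)%C).
  { apply on_pgram_sub; auto; lra. }
  set (A := (F w - l * w)%C).
  set (r := fun x => ((q x - l) * (x - w))%C).
  assert (HA : on_pgram (ccont (fun x => A + l * x)%C) z' (RtoC h * u)%C (RtoC h * v)%C).
  { intros s t _ _. apply cdiff_ccont, cdiff_plus; [apply cdiff_const|].
    apply cdiff_mult; [apply cdiff_const|apply cdiff_id]. }
  assert (Hr : on_pgram (ccont r) z' (RtoC h * u)%C (RtoC h * v)%C).
  { intros s t Hs Ht. specialize (HP s t Hs Ht). specialize (HA s t Hs Ht).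
    intros e0 He0. generalize (ctends_minus _ _ _ _ _ HP HA e0 He0).
    apply filter_imp. intros x Hx. unfold r.
    replace ((q x - l) * (x - w) - (q (z' + RtoC s * (RtoC h * u) + RtoC t * (RtoC h * v)) - l) *
      (z' + RtoC s * (RtoC h * u) + RtoC t * (RtoC h * v) - w))%C with
     (F x - (A + l * x) -
        (F (z' + RtoC s * (RtoC h * u) + RtoC t * (RtoC h * v)) -
         (A + l * (z' + RtoC s * (RtoC h * u) + RtoC t * (RtoC h * v)))))%C; auto.
    set (y := (z' + RtoC s * (RtoC h * u) + RtoC t * (RtoC h * v))%C).
    transitivity ((F x - F w) - (F y - F w) - l * (x - y))%C; [ring|].
    rewrite !HqF. ring. }
  assert (E : F = (fun x => (A + l * x) + r x)%C).
  { apply functional_extensionality. intros x. unfold A, r.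
    transitivity ((F x - F w) + F w)%C; [ring|]. rewrite HqF. ring. }
  rewrite E, pgram_plus, pgram_affine, Cplus_0_l by auto.
  assert (HM : on_pgram (fun x => Cmod (r x) <= e * (h * L)) z' (RtoC h * u)%C (RtoC h * v)%C).
  { intros s t Hs Ht.
    assert (Hd' : Cmod (z' + RtoC s * (RtoC h * u) + RtoC t * (RtoC h * v) - w)%C <= h * L).
    { replace (z' + RtoC s * (RtoC h * u) + RtoC t * (RtoC h * v) - w)%C with
        (RtoC (a' + s * h - a) * u + RtoC (b' + t * h - b) * v)%C
        by (unfold z', w; rewrite !RtoC_minus, !RtoC_plus, !RtoC_mult; ring).
      eapply Rle_trans; [apply Cmod_triangle|]. rewrite !Cmod_mult, !Cmod_R. unfold L.
      rewrite Rmult_plus_distr_l.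
      apply Rplus_le_compat; apply Rmult_le_compat_r; try apply Cmod_ge_0; apply Rabs_le; nra. }
    unfold r. rewrite Cmod_mult. apply Rmult_le_compat; try apply Cmod_ge_0; auto.
    apply Rlt_le. rewrite <- Hq0. apply Hqd.
    eapply Rle_lt_trans; [exact Hd'|].
    apply (Rmult_lt_compat_r (L + 1)) in Hn; [|lra].
    unfold Rdiv in Hn. rewrite Rmult_assoc, Rinv_l, Rmult_1_r in Hn by lra. nra. }
  pose proof (Cmod_pgram_le r z' _ _ _ Hr HM) as B.
  rewrite !Cmod_mult, !Cmod_R, !(Rabs_pos_eq h) in B by lra.
  rewrite <- Rmult_plus_distr_l in B. fold L in B.
  assert (E4 : 4 ^ n * h * h = 1).
  { unfold h. rewrite <- !Rpow_mult_distr. replace (4 * /2 * /2) with 1 by lra. apply pow1. }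
  eapply Rle_trans; [apply Rmult_le_compat_l; [apply pow_le; lra|exact B]|].
  replace (4 ^ n * (2 * (h * L) * (e * (h * L)))) with ((4 ^ n * h * h) * (2 * L * L * e)) by ring.
  rewrite E4, Rmult_1_l.
  replace eps with (2 * (L + 1) * (L + 1) * e) by (unfold e; field; lra).
  apply Rmult_le_compat_r; nra.
Qed.

(** * Means over circles *)

Lemma derivable_pt_lim_0 g l eps : derivable_pt_lim g 0 l -> 0 < eps ->
  exists d, 0 < d /\ forall x, Rabs x < d -> Rabs (g x - g 0 - l * x) <= eps * Rabs x.
Proof.
  intros H He. destruct (H eps He) as [d Hd]. exists d. split; [apply cond_pos|].
  intros x Hx. destruct (Req_dec x 0) as [->|n].
  - replace (g 0 - g 0 - l * 0) with 0 by ring. rewrite Rabs_R0. lra.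
  - specialize (Hd x n Hx). rewrite Rplus_0_l in Hd.
    replace (g x - g 0 - l * x) with (((g x - g 0) / x - l) * x) by (field; auto).
    rewrite Rabs_mult. apply Rmult_le_compat_r; [apply Rabs_pos|lra].
Qed.

Lemma Cexp_0 : Cexp (RtoC 0) = RtoC 1.
Proof. unfold Cexp, RtoC; simpl. rewrite exp_0, cos_0, sin_0. f_equal; ring. Qed.

Lemma Cexp_plus x y : Cexp (x + y)%C = (Cexp x * Cexp y)%C.
Proof.
  unfold Cexp. rewrite re_plus, im_plus, exp_plus, cos_plus, sin_plus.
  unfold Cmult; simpl. f_equal; ring.
Qed.

Lemma Cmod_Cexp z : Cmod (Cexp z) = exp (Re z).
Proof.
  unfold Cmod, Cexp; simpl. pose proof (exp_pos (Re z)). pose proof (sin2_cos2 (Im z)) as E.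
  unfold Rsqr in E.
  match goal with |- sqrt ?e = _ => replace e with (exp (Re z) * exp (Re z)) end.
  - apply sqrt_square. lra.
  - transitivity (exp (Re z) * exp (Re z) *
      (sin (Im z) * sin (Im z) + cos (Im z) * cos (Im z))); [rewrite E|]; ring.
Qed.

Lemma Cexp_neq_0 z : Cexp z <> RtoC 0.
Proof. apply Cmod_gt_0. rewrite Cmod_Cexp. apply exp_pos. Qed.

Lemma Cexp_RtoC x : Cexp (RtoC x) = RtoC (exp x).
Proof. unfold Cexp, RtoC; simpl. rewrite cos_0, sin_0. f_equal; ring. Qed.

Lemma cder_Cexp_0 : cder Cexp (RtoC 0) (RtoC 1).
Proof.
  intros eps He.
  (* The errors estimated below add up to at most [8 * e * |h|], so [10 * e < eps] suffices;
     [e <= 1] forces [|h| < 1], which absorbs the quadratic terms. *)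
  set (e := Rmin (eps / 20) 1).
  assert (He0 : 0 < e) by (apply Rmin_glb_lt; lra).
  assert (He1 : e <= 1) by apply Rmin_r.
  assert (He2 : 10 * e < eps) by (unfold e; pose proof (Rmin_l (eps / 20) 1); lra).
  pose proof derivable_pt_lim_exp_0 as D1.
  pose proof (derivable_pt_lim_cos 0) as D2. rewrite sin_0, Ropp_0 in D2.
  pose proof (derivable_pt_lim_sin 0) as D3. rewrite cos_0 in D3.
  destruct (derivable_pt_lim_0 exp 1 e D1 He0) as (d1 & Hd1 & H1).
  destruct (derivable_pt_lim_0 cos 0 e D2 He0) as (d2 & Hd2 & H2).
  destruct (derivable_pt_lim_0 sin 1 e D3 He0) as (d3 & Hd3 & H3).
  exists (Rmin (Rmin d1 d2) (Rmin d3 e)). split.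
  { apply Rmin_glb_lt; now apply Rmin_glb_lt. }
  intros h Hh Hlt. rewrite Cexp_0.
  replace (h - RtoC 0)%C with h in * by ring.
  assert (Hpos : 0 < Cmod h) by (now apply Cmod_gt_0).
  replace ((Cexp h - RtoC 1) / h - RtoC 1)%C with ((Cexp h - RtoC 1 - h) / h)%C by (field; auto).
  rewrite Cmod_div by auto.
  pose proof (re_le_Cmod h) as Hx. pose proof (im_le_Cmod h) as Hy.
  assert (L1 : Cmod h < d1) by (eapply Rlt_le_trans; [exact Hlt|]; eapply Rle_trans; apply Rmin_l).
  assert (L2 : Cmod h < d2) by (eapply Rlt_le_trans; [exact Hlt|]; eapply Rle_trans; [apply Rmin_l|apply Rmin_r]).
  assert (L3 : Cmod h < d3) by (eapply Rlt_le_trans; [exact Hlt|]; eapply Rle_trans; [apply Rmin_r|apply Rmin_l]).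
  assert (L4 : Cmod h < e) by (eapply Rlt_le_trans; [exact Hlt|]; eapply Rle_trans; [apply Rmin_r|apply Rmin_r]).
  apply (Rle_lt_trans _ (10 * e)); auto.
  apply (Rmult_le_reg_r (Cmod h)); auto. unfold Rdiv. rewrite Rmult_assoc, Rinv_l, Rmult_1_r by lra.
  set (m := Cmod h) in *.
  eapply Rle_trans; [apply Cmod_le_Re_Im|].
  set (x := Re h) in *. set (y := Im h) in *.
  specialize (H1 x (Rle_lt_trans _ _ _ Hx L1)). specialize (H2 y (Rle_lt_trans _ _ _ Hy L2)).
  specialize (H3 y (Rle_lt_trans _ _ _ Hy L3)).
  rewrite exp_0 in H1. rewrite cos_0 in H2. rewrite sin_0 in H3.
  change (Re (Cexp h - RtoC 1 - h)%C) with (exp x * cos y - 1 - x).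
  assert (EI : Im (Cexp h - RtoC 1 - h)%C = exp x * sin y - y).
  { unfold y, x, Im, Re. simpl. unfold Im, Re. ring. }
  rewrite EI.
  assert (Hc : Rabs (cos y) <= 1) by (apply Rabs_le, COS_bound).
  set (E := exp x - 1 - 1 * x) in *. set (D := cos y - 1 - 0 * y) in *. set (S := sin y - 0 - 1 * y) in *.
  replace (exp x * cos y - 1 - x) with (E * cos y + (1 + x) * D) by (unfold E, D; ring).
  replace (exp x * sin y - y) with ((E + x) * (S + y) + S) by (unfold E, S; ring).
  assert (B1 : Rabs E <= e * m) by (eapply Rle_trans; [exact H1|]; apply Rmult_le_compat_l; lra).
  assert (B2 : Rabs D <= e * m) by (eapply Rle_trans; [exact H2|]; apply Rmult_le_compat_l; lra).
  assert (B3 : Rabs S <= e * m) by (eapply Rle_trans; [exact H3|]; apply Rmult_le_compat_l; lra).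
  assert (M : e * m <= m) by nra.
  assert (X1 : Rabs (E * cos y) <= e * m).
  { rewrite Rabs_mult. pose proof (Rabs_pos E). pose proof (Rabs_pos (cos y)). nra. }
  assert (X2 : Rabs ((1 + x) * D) <= 2 * (e * m)).
  { rewrite Rabs_mult. apply Rmult_le_compat; try apply Rabs_pos; auto.
    eapply Rle_trans; [apply Rabs_triang|]. rewrite Rabs_R1. lra. }
  assert (X3 : Rabs ((E + x) * (S + y)) <= (2 * m) * (2 * m)).
  { rewrite Rabs_mult. apply Rmult_le_compat; try apply Rabs_pos;
    (eapply Rle_trans; [apply Rabs_triang|]); lra. }
  assert (X4 : 2 * m * (2 * m) <= 4 * (e * m)) by nra.
  pose proof (Rabs_triang (E * cos y) ((1 + x) * D)).
  pose proof (Rabs_triang ((E + x) * (S + y)) S).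
  assert (0 <= e * m) by nra.
  lra.
Qed.

Lemma cder_Cexp z : cder Cexp z (Cexp z).
Proof.
  apply (cder_ext (fun w => Cexp z * Cexp (w - z))%C).
  - apply filter_forall. intros w. rewrite <- Cexp_plus. f_equal. ring.
  - eapply cder_eq.
    + apply cder_scal. apply (cder_comp Cexp (fun w => w - z)%C).
      * apply cder_minus; [apply cder_id|apply cder_const].
      * replace (z - z)%C with (RtoC 0) by ring. apply cder_Cexp_0.
    + ring.
Qed.

Lemma exp_le_compat x y : x <= y -> exp x <= exp y.
Proof. intros [H | ->]; [apply Rlt_le, exp_increasing, H|lra]. Qed.

Definition ucirc (s : R) : C := Cexp (RtoC s * (RtoC (2 * PI) * Ci))%C.

Lemma Cmod_ucirc s : Cmod (ucirc s) = 1.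
Proof.
  unfold ucirc. rewrite Cmod_Cexp.
  replace (Re (RtoC s * (RtoC (2 * PI) * Ci))%C) with 0; [apply exp_0|].
  unfold RtoC, Ci; simpl. ring.
Qed.

Lemma Cmod_circle r s : 0 <= r -> Cmod (RtoC r * ucirc s)%C = r.
Proof. intros H. rewrite Cmod_mult, Cmod_ucirc, Cmod_R, Rabs_pos_eq; lra. Qed.

Lemma pcont_ucirc s : pcont ucirc s.
Proof.
  apply (pcont_comp Cexp (fun s => RtoC s * (RtoC (2 * PI) * Ci))%C).
  - apply pcont_mult; [|apply pcont_const]. apply (pcont_RtoC (fun x => x)), continuous_id.
  - eapply cder_ccont, cder_Cexp.
Qed.

Definition cmean (g : C -> C) (r : R) : C := CInt (fun s => g (RtoC r * ucirc s)%C).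

Lemma icont_circle g r : 0 <= r -> (forall z, Cmod z = r -> ccont g z) ->
  icont (fun s => g (RtoC r * ucirc s)%C).
Proof.
  intros Hr H s _. apply (pcont_comp g (fun s => RtoC r * ucirc s)%C).
  - apply pcont_mult; [apply pcont_const|apply pcont_ucirc].
  - apply H, Cmod_circle, Hr.
Qed.

(** The two radial sides of the rectangle cancel because [Cexp] has period [v]; the other two are
    [v] times the means over the circles. *)
Lemma cmean_const g r0 r1 : 0 < r0 -> r0 <= r1 ->
  (forall z, r0 <= Cmod z <= r1 -> cdiff g z) -> cmean g r0 = cmean g r1.
Proof.
  intros H0 H1 Hg.
  set (F := fun w => g (Cexp w)). set (z := RtoC (ln r0)). set (u := RtoC (ln r1 - ln r0)).
  set (v := (RtoC (2 * PI) * Ci)%C).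
  assert (Hl : ln r0 <= ln r1) by (destruct H1 as [H1| ->]; [apply Rlt_le, ln_increasing|]; lra).
  assert (G : pgram F z u v = RtoC 0).
  { apply goursat. intros s t Hs Ht.
    apply (cdiff_comp g Cexp); [eexists; apply cder_Cexp|]. apply Hg. rewrite Cmod_Cexp.
    replace (Re (z + RtoC s * u + RtoC t * v)%C) with (ln r0 + s * (ln r1 - ln r0))
      by (unfold z, u, v, Ci, RtoC; simpl; ring).
    split.
    - rewrite <- (exp_ln r0) at 1 by lra. apply exp_le_compat. nra.
    - rewrite <- (exp_ln r1) at 2 by lra. apply exp_le_compat. nra. }
  assert (Hper : forall w, Cexp (w + v)%C = Cexp w).
  { intros w. rewrite Cexp_plus. replace (Cexp v) with (RtoC 1); [ring|].
    unfold Cexp, v, Ci, RtoC; simpl.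
    replace (2 * PI * 0 - 0 * 1) with 0 by ring. replace (2 * PI * 1 + 0 * 0) with (2 * PI) by ring.
    rewrite exp_0, cos_2PI, sin_2PI. f_equal; ring. }
  assert (E : seg F (z + v)%C u = seg F z u).
  { unfold seg. f_equal. apply CInt_ext. intros s _. unfold F. f_equal. rewrite <- Hper.
    rewrite <- (Hper (z + RtoC s * u)%C). rewrite Hper. f_equal. ring. }
  unfold pgram in G. rewrite E in G.
  assert (G' : (v * (CInt (fun s => F (z + u + RtoC s * v)) - CInt (fun s => F (z + RtoC s * v))))%C = RtoC 0).
  { rewrite <- G. unfold seg. ring. }
  assert (Hv : v <> RtoC 0).
  { unfold v. apply Cmult_neq_0.
    - intros K. apply RtoC_inj in K. pose proof PI_RGT_0. lra.
    - intros K. apply (f_equal Im) in K. simpl in K. lra. }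
  assert (Hm : forall r, 0 < r -> forall s, F (RtoC (ln r) + RtoC s * v)%C = g (RtoC r * ucirc s)%C).
  { intros r Hr s. unfold F. f_equal. rewrite Cexp_plus, Cexp_RtoC, exp_ln by auto. reflexivity. }
  unfold cmean.
  rewrite (CInt_ext (fun s => g (RtoC r0 * ucirc s)%C) (fun s => F (z + RtoC s * v)%C))
    by (intros s _; now rewrite <- Hm).
  rewrite (CInt_ext (fun s => g (RtoC r1 * ucirc s)%C) (fun s => F (z + u + RtoC s * v)%C)).
  - symmetry. apply Cminus_eq_0.
    destruct (classic ((CInt (fun s => F (z + u + RtoC s * v)) - CInt (fun s => F (z + RtoC s * v)))%C = RtoC 0)) as [K|K]; auto.
    exfalso. now apply (Cmult_neq_0 _ _ Hv K).
  - intros s _. rewrite <- Hm by lra. f_equal. unfold z, u. rewrite RtoC_minus. ring.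
Qed.

Lemma cmean_scal c g r : 0 <= r -> (forall z, Cmod z = r -> ccont g z) ->
  cmean (fun z => c * g z)%C r = (c * cmean g r)%C.
Proof. intros Hr Hg. apply (CInt_scal c). now apply icont_circle. Qed.

Lemma Cmod_cmean_le g r M : 0 <= r -> (forall z, Cmod z = r -> ccont g z) ->
  (forall z, Cmod z = r -> Cmod (g z) <= M) -> Cmod (cmean g r) <= M.
Proof.
  intros Hr Hg HM. apply Cmod_CInt_le; [now apply icont_circle|].
  intros s _. apply HM, Cmod_circle, Hr.
Qed.

(** Makes [cmean g] continuous in the radius at [rho], by compactness of the parameter interval. *)
Lemma circle_tube g rho eps : 0 < rho -> (forall z, Cmod z = rho -> ccont g z) -> 0 < eps ->
  exists d, 0 < d /\ forall r s, 0 <= s <= 1 -> Rabs (r - rho) < d ->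
    Cmod (g (RtoC r * ucirc s) - g (RtoC rho * ucirc s))%C <= eps.
Proof.
  intros Hrho Hg He.
  assert (Hex : forall t, exists d : posreal, forall r s, Rabs (s - t) < d -> Rabs (r - rho) < d ->
    Cmod (g (RtoC r * ucirc s) - g (RtoC rho * ucirc t))%C < eps / 2).
  { intros t. destruct (Hg (RtoC rho * ucirc t)%C) with (eps := eps / 2) as (d & Hd & H);
      [apply Cmod_circle; lra|lra|].
    (* The change of radius and the change of angle may each move the point by [d / 2]. *)
    assert (Hd' : 0 < d / (2 * rho)) by (apply Rdiv_lt_0_compat; lra).
    destruct (pcont_ucirc t _ Hd') as [d1 Hd1].
    assert (Hm : 0 < Rmin d1 (d / 2)) by (apply Rmin_glb_lt; [apply cond_pos|lra]).
    exists (mkposreal _ Hm). simpl. intros r s Hs Hr. apply H.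
    assert (Hs1 : Cmod (ucirc s - ucirc t)%C < d / (2 * rho)).
    { apply Hd1. eapply Rlt_le_trans; [exact Hs|apply Rmin_l]. }
    assert (Hr1 : Rabs (r - rho) < d / 2) by (eapply Rlt_le_trans; [exact Hr|apply Rmin_r]).
    replace (RtoC r * ucirc s - RtoC rho * ucirc t)%C with
      (RtoC (r - rho) * ucirc s + RtoC rho * (ucirc s - ucirc t))%C by (rewrite RtoC_minus; ring).
    eapply Rle_lt_trans; [apply Cmod_triangle|].
    rewrite !Cmod_mult, !Cmod_R, Cmod_ucirc, (Rabs_pos_eq rho) by lra.
    apply (Rmult_lt_compat_l rho) in Hs1; auto.
    replace (rho * (d / (2 * rho))) with (d / 2) in Hs1 by (field; lra). lra. }
  set (delta := fun t => proj1_sig (constructive_indefinite_description _ (Hex t))).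
  assert (Hdelta : forall t r s, Rabs (s - t) < delta t -> Rabs (r - rho) < delta t ->
    Cmod (g (RtoC r * ucirc s) - g (RtoC rho * ucirc t))%C < eps / 2).
  { intros t. unfold delta. apply proj2_sig. }
  destruct (compactness_value_1d 0 1 delta) as [d Hd].
  exists d. split; [apply cond_pos|]. intros r s Hs Hr.
  apply NNPP. intros Hno. apply (Hd s Hs). intros (t & Ht & Hst & Hdt). apply Hno.
  eapply Rle_trans; [apply (Cmod_triangle_minus3 _ (g (RtoC rho * ucirc t)%C))|].
  assert (Cmod (g (RtoC r * ucirc s) - g (RtoC rho * ucirc t))%C < eps / 2) by (apply Hdelta; lra).
  assert (Cmod (g (RtoC rho * ucirc s) - g (RtoC rho * ucirc t))%C < eps / 2).
  { apply Hdelta; auto. replace (rho - rho) with 0 by ring. rewrite Rabs_R0. apply cond_pos. }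
  rewrite (Cmod_minus_sym (g (RtoC rho * ucirc t)%C)). lra.
Qed.

(** The mean is constant on either side of [rho] and continuous at [rho]. This admits difference
    quotients [(f w - f z) / (w - z)], which are only known to be continuous at [w = z]. *)
Lemma cmean_const_across g r0 rho r1 : 0 < r0 -> r0 < rho < r1 ->
  (forall z, r0 <= Cmod z <= r1 -> ccont g z) ->
  (forall z, r0 <= Cmod z <= r1 -> Cmod z <> rho -> cdiff g z) -> cmean g r0 = cmean g r1.
Proof.
  intros H0 Hr Hc Hd.
  assert (Hclose : forall eps, 0 < eps -> exists d, 0 < d /\ forall r, r0 <= r <= r1 ->
    Rabs (r - rho) < d -> Cmod (cmean g r - cmean g rho)%C <= eps).
  { intros eps He. destruct (circle_tube g rho eps) as (d & Hd0 & H); auto; try lra.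
    { intros z Hz. apply Hc. lra. }
    exists d. split; auto. intros r Hrr Hlt. unfold cmean. rewrite <- CInt_minus.
    - apply Cmod_CInt_le; auto. apply icont_minus; apply icont_circle; try lra; intros z Hz; apply Hc; lra.
    - apply icont_circle; try lra; intros z Hz; apply Hc; lra.
    - apply icont_circle; try lra; intros z Hz; apply Hc; lra. }
  apply Cminus_eq_0, Cmod_eq_zero_eps. intros eps He.
  destruct (Hclose (eps / 2)) as (d & Hd0 & H); [lra|].
  set (e := Rmin (d / 2) (Rmin (rho - r0) (r1 - rho))).
  assert (He0 : 0 < e) by (repeat apply Rmin_glb_lt; lra).
  assert (He1 : e <= d / 2) by apply Rmin_l.
  assert (He2 : e <= rho - r0) by (eapply Rle_trans; [apply Rmin_r|apply Rmin_l]).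
  assert (He3 : e <= r1 - rho) by (eapply Rle_trans; [apply Rmin_r|apply Rmin_r]).
  rewrite (cmean_const g r0 (rho - e)), <- (cmean_const g (rho + e) r1); try lra.
  - eapply Rle_trans; [apply (Cmod_triangle_minus3 _ (cmean g rho))|].
    rewrite (Cmod_minus_sym (cmean g rho)).
    pose proof (H (rho - e)) as A1. pose proof (H (rho + e)) as A2.
    replace (rho - e - rho) with (- e) in A1 by ring. replace (rho + e - rho) with e in A2 by ring.
    rewrite Rabs_Ropp in A1. rewrite Rabs_pos_eq in A1, A2 by lra.
    specialize (A1 ltac:(lra) ltac:(lra)). specialize (A2 ltac:(lra) ltac:(lra)). lra.
  - intros z Hz. apply Hd; lra.
  - intros z Hz. apply Hd; lra.
Qed.

(** * Taylor coefficients *)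

(** A holomorphic function with a removable singularity at [0] that is left in place: the value at
    [0] is arbitrary. *)
Definition hol0 (rho : R) (f : C -> C) : Prop :=
  (forall z, 0 < Cmod z < rho -> cdiff f z) /\
  exists B d, 0 < d /\ forall z, 0 < Cmod z < d -> Cmod (f z) <= B.

(** Cauchy's formula for the [k]th Taylor coefficient. The mean over the circle is integration
    against [dz / (2 pi i z)], hence the exponent [k] instead of [k + 1]. *)
Definition coef (f : C -> C) (r : R) (k : nat) : C := cmean (fun z => f z / z ^ k)%C r.

Fixpoint csum (u : nat -> C) (n : nat) : C :=
  match n with O => RtoC 0 | S m => (csum u m + u m)%C end.

Definition psum (c : nat -> C) (z : C) (n : nat) : C := csum (fun k => c k * z ^ k)%C n.

Definition circle_bound (f : C -> C) (r B : R) : Prop :=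
  forall s, 0 <= s <= 1 -> Cmod (f (RtoC r * ucirc s)%C) <= B.

Lemma circle_bound_exists f r : 0 <= r -> (forall z, Cmod z = r -> ccont f z) ->
  exists B, 0 <= B /\ circle_bound f r B.
Proof.
  intros Hr Hf.
  destruct (continuity_ab_maj (fun s => Cmod (f (RtoC r * ucirc s)%C)) 0 1) as [M [HM _]]; [lra| |].
  - intros c Hc. apply continuity_pt_filterlim.
    apply (pcont_Cmod (fun s => f (RtoC r * ucirc s)%C)). now apply icont_circle.
  - exists (Cmod (f (RtoC r * ucirc M)%C)). split; [apply Cmod_ge_0|]. intros s Hs. now apply HM.
Qed.

(** The mean does not change as the radius shrinks, and the bound [O(|z|)] near [0] makes it
    arbitrarily small. *)
Lemma cmean_zero g rho r : 0 < rho < r ->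
  (forall z, 0 < Cmod z <= r -> ccont g z) ->
  (forall z, 0 < Cmod z <= r -> Cmod z <> rho -> cdiff g z) ->
  (exists B d, 0 < d /\ forall z, 0 < Cmod z < d -> Cmod (g z) <= B * Cmod z) ->
  cmean g r = RtoC 0.
Proof.
  intros Hr Hc Hd (B & d & Hd0 & HB). apply Cmod_eq_zero_eps. intros eps He.
  set (e := Rmin (rho / 2) (Rmin (d / 2) (eps / (Rabs B + 1)))).
  pose proof (Rabs_pos B) as HB0.
  assert (He0 : 0 < e) by (repeat apply Rmin_glb_lt; try lra; apply Rdiv_lt_0_compat; lra).
  assert (He1 : e <= rho / 2) by apply Rmin_l.
  assert (He2 : e <= d / 2) by (eapply Rle_trans; [apply Rmin_r|apply Rmin_l]).
  assert (He3 : e <= eps / (Rabs B + 1)) by (eapply Rle_trans; [apply Rmin_r|apply Rmin_r]).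
  rewrite <- (cmean_const_across g e rho r); try lra.
  - apply Cmod_cmean_le; [lra| |].
    + intros z Hz. apply Hc. lra.
    + intros z Hz. eapply Rle_trans; [apply HB; lra|]. rewrite Hz.
      apply (Rmult_le_compat_r (Rabs B + 1)) in He3; [|lra].
      unfold Rdiv in He3. rewrite Rmult_assoc, Rinv_l, Rmult_1_r in He3 by lra.
      pose proof (Rle_abs B). nra.
  - intros z Hz. apply Hc; lra.
  - intros z Hz. apply Hd; lra.
Qed.

Lemma cdiff_zpow n z : cdiff (fun w => w ^ n)%C z.
Proof. apply cdiff_pow, cdiff_id. Qed.

Lemma cdiff_div_pow f k z : z <> RtoC 0 -> cdiff f z -> cdiff (fun w => f w / w ^ k)%C z.
Proof. intros Hz Hf. apply cdiff_div; auto; [apply cdiff_zpow|now apply Cpow_nz]. Qed.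

Lemma ccont_div_pow f k z : z <> RtoC 0 -> ccont f z -> ccont (fun w => f w / w ^ k)%C z.
Proof.
  intros Hz Hf. unfold ccont. apply ctends_mult; [apply _|auto|].
  apply ctends_inv; [apply _|now apply Cpow_nz|apply cdiff_ccont, cdiff_zpow].
Qed.

Lemma Cmod_pos_nz z : 0 < Cmod z -> z <> RtoC 0.
Proof. apply Cmod_gt_0. Qed.

Lemma icont_coef f r k : 0 < r -> (forall z, Cmod z = r -> ccont f z) ->
  icont (fun s => f (RtoC r * ucirc s) / (RtoC r * ucirc s) ^ k)%C.
Proof.
  intros Hr Hf. apply (icont_circle (fun z => f z / z ^ k)%C); [lra|].
  intros z Hz. apply ccont_div_pow; [apply Cmod_pos_nz; lra|auto].
Qed.

Lemma Cmod_coef_le f r B k : 0 < r -> (forall z, Cmod z = r -> ccont f z) ->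
  circle_bound f r B -> Cmod (coef f r k) <= B / r ^ k.
Proof.
  intros Hr Hf HB. apply Cmod_CInt_le; [now apply icont_coef|].
  intros s Hs. pose proof (Cmod_circle r s ltac:(lra)) as E.
  rewrite Cmod_div, Cmod_pow, E by (apply Cpow_nz, Cmod_pos_nz; lra).
  apply Rmult_le_compat_r; [|now apply HB].
  apply Rlt_le, Rinv_0_lt_compat, pow_lt, Hr.
Qed.

(** Homogeneity against invariance: passing from radius 1 to radius 2 divides the mean by [2 ^ S k]
    and yet leaves it unchanged. *)
Lemma cmean_inv_pow k r : 0 < r -> cmean (fun z => / z ^ S k)%C r = RtoC 0.
Proof.
  intros Hr.
  assert (Hcd : forall z, 0 < Cmod z -> cdiff (fun z => / z ^ S k)%C z).
  { intros z Hz. apply (cdiff_ext (fun w => RtoC 1 / w ^ S k)%C).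
    - apply filter_forall. intros w. unfold Cdiv. now rewrite Cmult_1_l.
    - apply cdiff_div_pow; [now apply Cmod_pos_nz|apply cdiff_const]. }
  assert (Hs : forall a, 0 < a -> cmean (fun z => / z ^ S k)%C a =
    (/ RtoC a ^ S k * cmean (fun z => / z ^ S k)%C 1)%C).
  { intros a Ha. rewrite <- cmean_scal; [|lra|].
    - unfold cmean. apply CInt_ext. intros s _. rewrite !Cpow_mult_l, <- !RtoC_pow, pow1, Cmult_1_l.
      field. split; [apply Cpow_nz, Cexp_neq_0|].
      intros K. apply RtoC_inj in K. revert K. apply pow_nonzero. lra.
    - intros z Hz. apply cdiff_ccont, Hcd. lra. }
  rewrite Hs by auto.
  assert (E : cmean (fun z => / z ^ S k)%C 1 = cmean (fun z => / z ^ S k)%C 2).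
  { apply cmean_const; try lra. intros z Hz. apply Hcd. lra. }
  rewrite (Hs 2) in E by lra. set (X := cmean (fun z => / z ^ S k)%C 1) in *.
  assert (HX : (X * (RtoC (2 ^ S k) - RtoC 1))%C = RtoC 0).
  { assert (H2 : RtoC (2 ^ S k) <> RtoC 0).
    { intros K. apply RtoC_inj in K. revert K. apply pow_nonzero. lra. }
    rewrite <- RtoC_pow in E. rewrite E at 1. transitivity (X - (/ RtoC (2 ^ S k) * X))%C; [now field|].
    rewrite <- E. ring. }
  destruct (classic (X = RtoC 0)) as [-> | n]; [ring|]. exfalso.
  revert HX. apply Cmult_neq_0; auto. rewrite <- RtoC_minus. intros K. apply RtoC_inj in K.
  pose proof (pow_R1_Rle 2 k ltac:(lra)). simpl in K. lra.
Qed.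

Lemma ctends_pow_0 x A : 0 <= x < 1 -> forall eps, 0 < eps -> exists N, forall n, (N <= n)%nat -> A * x ^ n < eps.
Proof.
  intros Hx eps He. pose proof (Rabs_pos A) as HA.
  destruct (pow_lt_1_zero x) with (y := eps / (Rabs A + 1)) as [N HN].
  - rewrite Rabs_pos_eq; lra.
  - apply Rdiv_lt_0_compat; lra.
  - exists N. intros n Hn. specialize (HN n Hn).
    rewrite Rabs_pos_eq in HN by (apply pow_le; lra).
    apply (Rmult_lt_compat_r (Rabs A + 1)) in HN; [|lra].
    unfold Rdiv in HN. rewrite Rmult_assoc, Rinv_l, Rmult_1_r in HN by lra.
    pose proof (Rle_abs A). pose proof (pow_le x n ltac:(lra)). nra.
Qed.

(** Here [q] is the difference quotient of [f] at [z]. Means of [q w * (w - z) / w ^ k = (f w - f z)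
    / w ^ k] give [coef f r (S k) = coef q r k - z * coef q r (S k)], which telescopes. The
    recursion starts because the mean of [w * q w] vanishes, which is Cauchy's theorem for [q]. *)
Lemma taylor_remainder rho f z r : hol0 rho f -> 0 < Cmod z < r -> r < rho ->
  exists q, (forall w, f w - f z = q w * (w - z))%C /\ (forall w, Cmod w = r -> ccont q w) /\
  forall N, (f z - psum (coef f r) z (S N) = z ^ S N * coef q r N)%C.
Proof.
  intros [Hf (B & d & Hd & HB)] Hz Hr.
  destruct (Hf z ltac:(lra)) as [l Hl].
  destruct (cder_factor f z l Hl) as (q & Hq & Hq0 & Hqf).
  assert (Hqd : forall w, 0 < Cmod w <= r -> w <> z -> cdiff q w).
  { intros w Hw Hwz. apply (cdiff_ext (fun x => (f x - f z) / (x - z))%C).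
    - destruct (ccont_neq0 (fun x => x - z)%C w) as (d' & Hd' & H').
      + apply cdiff_ccont, cdiff_minus; [apply cdiff_id|apply cdiff_const].
      + now apply Cminus_neq_0.
      + exists d'. split; auto. intros x Hx. rewrite Hqf. field. now apply H'.
    - apply cdiff_div; [apply cdiff_minus; [apply Hf; lra|apply cdiff_const]
        |apply cdiff_minus; [apply cdiff_id|apply cdiff_const]|now apply Cminus_neq_0]. }
  assert (Hqc : forall w, 0 < Cmod w <= r -> ccont q w).
  { intros w Hw. destruct (classic (w = z)) as [->|n]; auto. now apply cdiff_ccont, Hqd. }
  exists q. split; auto. split; [intros w Hw; apply Hqc; lra|].
  assert (H0 : cmean (fun w => w * q w)%C r = RtoC 0).
  { apply (cmean_zero _ (Cmod z)); auto.
    - intros w Hw. apply ctends_mult; [apply _|apply cdiff_ccont, cdiff_id|now apply Hqc].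
    - intros w Hw Hwz. apply cdiff_mult; [apply cdiff_id|apply Hqd; auto]. now intros ->.
    - exists ((B + Cmod (f z)) / (Cmod z / 2)), (Rmin d (Cmod z / 2)).
      split; [apply Rmin_glb_lt; lra|]. intros w [Hw1 Hw2].
      destruct (Rmin_Rgt_l _ _ _ Hw2) as [Hw3 Hw4].
      rewrite Cmod_mult, Rmult_comm. apply Rmult_le_compat_r; [lra|].
      assert (Hzw : Cmod z / 2 <= Cmod (w - z)%C).
      { rewrite Cmod_minus_sym. pose proof (Cmod_triangle_rev z w). lra. }
      apply (Rmult_le_reg_r (Cmod z / 2)); [lra|].
      unfold Rdiv at 2. rewrite Rmult_assoc, Rinv_l, Rmult_1_r by lra.
      apply (Rle_trans _ (Cmod (q w * (w - z))%C)).
      + rewrite Cmod_mult. apply Rmult_le_compat_l; [apply Cmod_ge_0|lra].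
      + rewrite <- Hqf. eapply Rle_trans; [apply Cmod_triangle_minus|].
        apply Rplus_le_compat_r, HB. lra. }
  assert (Hnz : forall s, (RtoC r * ucirc s <> RtoC 0)%C).
  { intros s. apply Cmod_pos_nz. rewrite Cmod_circle; lra. }
  assert (Hrec : forall k, (cmean (fun w => w * q w / w ^ k) r - z * coef q r k
      = coef f r k - f z * cmean (fun w => / w ^ k) r)%C).
  { intros k. unfold coef.
    assert (Hcq : forall w, Cmod w = r -> ccont q w) by (intros w Hw; apply Hqc; lra).
    assert (Hcf : forall w, Cmod w = r -> ccont f w).
    { intros w Hw. apply cdiff_ccont, Hf. lra. }
    rewrite <- (cmean_scal z), <- (cmean_scal (f z)); [|lra| |lra|].
    - assert (J1 : icont (fun s => (RtoC r * ucirc s) * q (RtoC r * ucirc s) / (RtoC r * ucirc s) ^ k)%C).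
      { apply (icont_coef (fun w => w * q w)%C); [lra|]. intros w Hw.
        apply ctends_mult; [apply _|apply cdiff_ccont, cdiff_id|exact (Hcq w Hw)]. }
      assert (J2 : icont (fun s => z * (q (RtoC r * ucirc s) / (RtoC r * ucirc s) ^ k))%C).
      { apply icont_mult; [apply icont_const|]. apply icont_coef; auto. lra. }
      assert (J3 : icont (fun s => f (RtoC r * ucirc s) / (RtoC r * ucirc s) ^ k)%C).
      { apply icont_coef; [lra|auto]. }
      assert (J4 : icont (fun s => f z * / (RtoC r * ucirc s) ^ k)%C).
      { apply (icont_circle (fun w => f z * / w ^ k)%C); [lra|]. intros w Hw.
        apply (ccont_div_pow (fun _ => f z)); [apply Cmod_pos_nz; lra|apply cdiff_ccont, cdiff_const]. }
      unfold cmean. rewrite <- (CInt_minus _ _ J1 J2), <- (CInt_minus _ _ J3 J4).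
      apply CInt_ext. intros s _. specialize (Hqf (RtoC r * ucirc s)%C).
      specialize (Hnz s). set (w := (RtoC r * ucirc s)%C) in *.
      assert (Hwk : (w ^ k <> RtoC 0)%C) by (now apply Cpow_nz).
      transitivity (q w * (w - z) / w ^ k)%C; [now field|]. rewrite <- Hqf. now field.
    - intros w Hw. apply (ctends_ext _ (fun x => RtoC 1 / x ^ k)%C).
      + apply filter_forall. intros x. unfold Cdiv. now rewrite Cmult_1_l.
      + eapply ctends_eq; [apply (ccont_div_pow (fun _ => RtoC 1));
          [apply Cmod_pos_nz; lra|apply cdiff_ccont, cdiff_const]|]. unfold Cdiv. now rewrite Cmult_1_l.
    - intros w Hw. apply ccont_div_pow; [apply Cmod_pos_nz; lra|auto]. }
  induction N as [|N IH].
  - specialize (Hrec O). unfold psum. simpl in *.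
    replace (cmean (fun w => w * q w / RtoC 1)%C r) with (RtoC 0) in Hrec.
    + replace (cmean (fun w => / RtoC 1)%C r) with (RtoC 1) in Hrec.
      * replace (z * RtoC 1 * coef q r 0)%C with (- (RtoC 0 - z * coef q r 0))%C by ring.
        rewrite Hrec. ring.
      * unfold cmean. rewrite CInt_const. field.
    + rewrite <- H0. apply CInt_ext. intros s _. field.
  - specialize (Hrec (S N)). rewrite cmean_inv_pow in Hrec by lra.
    replace (cmean (fun w => w * q w / w ^ S N)%C r) with (coef q r N) in Hrec.
    + unfold psum in *. change (csum ?u (S (S N))) with (csum u (S N) + u (S N))%C. cbv beta.
      replace (f z - (csum (fun k => coef f r k * z ^ k) (S N) + coef f r (S N) * z ^ S N))%C with
        ((f z - csum (fun k => coef f r k * z ^ k) (S N)) - coef f r (S N) * z ^ S N)%C by ring.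
      rewrite IH. replace (coef f r (S N)) with (coef q r N - z * coef q r (S N))%C by (rewrite Hrec; ring).
      rewrite (Cpow_S z (S N)). ring.
    + apply CInt_ext. intros s _. specialize (Hnz s). set (w := (RtoC r * ucirc s)%C) in *.
      rewrite Cpow_S. field. split; auto. now apply Cpow_nz.
Qed.

(** With [M] a bound for [q] on the circle, the remainder [z ^ S n * coef q r n] is at most
    [|z| * M * (|z| / r)^n]. *)
Lemma taylor_converges rho f z r : hol0 rho f -> 0 < Cmod z < r -> r < rho ->
  ctends eventually (psum (coef f r) z) (f z).
Proof.
  intros Hf Hz Hr eps He.
  destruct (taylor_remainder rho f z r Hf Hz Hr) as (q & _ & Hqc & Hq).
  destruct (circle_bound_exists q r) as (M & HM0 & HM); [lra|auto|].
  destruct (ctends_pow_0 (Cmod z / r) (Cmod z * M)) with (eps := eps) as [N HN]; auto.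
  { split; [apply Rdiv_le_0_compat; lra|]. apply Rlt_div_l; lra. }
  exists (S N). intros n Hn. destruct n as [|n]; [lia|].
  rewrite Cmod_minus_sym, Hq, Cmod_mult, Cmod_pow.
  pose proof (Cmod_coef_le q r M n ltac:(lra) Hqc HM) as K.
  eapply Rle_lt_trans; [apply Rmult_le_compat_l; [apply pow_le, Cmod_ge_0|exact K]|].
  specialize (HN n ltac:(lia)). eapply Rle_lt_trans; [|exact HN]. right.
  unfold Rdiv. rewrite Rpow_mult_distr, pow_inv. simpl. ring.
Qed.

(** A geometric tail. The coefficients are bounded only from index [N] on: [jet_series] controls no
    earlier ones, and [near_identity] treats the constant coefficient apart. *)
Lemma psum_tail c z r B N f : 0 < r -> Cmod z < r -> 0 <= B ->
  (forall k, (N <= k)%nat -> Cmod (c k) <= B / r ^ k) ->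
  ctends eventually (psum c z) f ->
  Cmod (f - psum c z N)%C <= B * (Cmod z / r) ^ N / (1 - Cmod z / r).
Proof.
  intros Hr Hz HB Hc Hf. pose proof (Cmod_ge_0 z) as Hz0. set (x := Cmod z / r).
  assert (Hx : 0 <= x < 1).
  { split; [apply Rdiv_le_0_compat; lra|]. apply Rlt_div_l; lra. }
  assert (Hj : forall j, Cmod (psum c z (N + j) - psum c z N)%C <= B * x ^ N * ((1 - x ^ j) / (1 - x))).
  { induction j as [|j IH].
    - rewrite Nat.add_0_r. replace (psum c z N - psum c z N)%C with (RtoC 0) by ring.
      rewrite Cmod_0. simpl. right. field. lra.
    - rewrite Nat.add_succ_r. unfold psum in *. simpl csum.
      match goal with |- Cmod (?a + ?b - ?d)%C <= _ => replace (a + b - d)%C with ((a - d) + b)%C by ring end.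
      eapply Rle_trans; [apply Cmod_triangle|].
      replace (B * x ^ N * ((1 - x ^ S j) / (1 - x))) with
        (B * x ^ N * ((1 - x ^ j) / (1 - x)) + B * x ^ (N + j)) by (rewrite pow_add; simpl; field; lra).
      apply Rplus_le_compat; auto. rewrite Cmod_mult, Cmod_pow.
      eapply Rle_trans; [apply Rmult_le_compat_r; [apply pow_le, Cmod_ge_0|apply Hc; lia]|].
      right. unfold x, Rdiv. rewrite Rpow_mult_distr, pow_inv. ring. }
  apply le_epsilon. intros eps He. destruct (Hf eps He) as [M HM].
  specialize (HM (N + M)%nat ltac:(lia)). specialize (Hj M).
  rewrite Cmod_minus_sym in HM.
  eapply Rle_trans; [apply (Cmod_triangle_minus3 _ (psum c z (N + M)))|].
  assert (B * x ^ N * ((1 - x ^ M) / (1 - x)) <= B * x ^ N / (1 - x)).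
  { unfold Rdiv. rewrite <- Rmult_assoc. apply Rmult_le_compat_r.
    - apply Rlt_le, Rinv_0_lt_compat. lra.
    - pose proof (pow_le x M ltac:(lra)) as K1. pose proof (pow_le x N ltac:(lra)) as K2.
      pose proof (Rmult_le_pos _ _ (Rmult_le_pos _ _ HB K2) K1). lra. }
  lra.
Qed.

Lemma taylor_tail rho f z r B N : hol0 rho f -> 0 < Cmod z < r -> r < rho -> circle_bound f r B ->
  Cmod (f z - psum (coef f r) z N)%C <= B * (Cmod z / r) ^ N / (1 - Cmod z / r).
Proof.
  intros Hf Hz Hr HB. apply psum_tail; try lra.
  - eapply Rle_trans; [apply Cmod_ge_0|apply (HB 0); lra].
  - intros k _. apply Cmod_coef_le; auto; [lra|]. intros w Hw. apply cdiff_ccont, Hf. lra.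
  - now apply (taylor_converges rho).
Qed.

Lemma taylor_tail_half rho f z r B N : hol0 rho f -> 0 < Cmod z <= r / 2 -> 0 < r < rho -> circle_bound f r B ->
  Cmod (f z - psum (coef f r) z N)%C <= 2 * B * (Cmod z / r) ^ N.
Proof.
  intros Hf Hz Hr HB. eapply Rle_trans; [apply (taylor_tail rho f z r B N); auto; lra|].
  assert (HB0 : 0 <= B) by (eapply Rle_trans; [apply Cmod_ge_0|apply (HB 0); lra]).
  assert (Hx : Cmod z / r <= / 2).
  { apply Rle_div_l; lra. }
  assert (Hx0 : 0 <= Cmod z / r) by (apply Rdiv_le_0_compat; lra).
  pose proof (pow_le (Cmod z / r) N Hx0).
  replace (2 * B * (Cmod z / r) ^ N) with (B * (Cmod z / r) ^ N * 2) by ring.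
  unfold Rdiv at 1. apply Rmult_le_compat_l; [nra|].
  rewrite <- (Rinv_inv 2). apply Rinv_le_contravar; lra.
Qed.

Lemma hol_bound rho f z r B : hol0 rho f -> 0 < Cmod z <= r / 2 -> 0 < r < rho -> circle_bound f r B ->
  Cmod (f z) <= 2 * B.
Proof.
  intros Hf Hz Hr HB. pose proof (taylor_tail_half rho f z r B 0 Hf Hz Hr HB) as H.
  simpl in H. replace (f z - psum (coef f r) z 0)%C with (f z) in H; [lra|].
  unfold psum; simpl. ring.
Qed.

Lemma cnear'_0 d (P : C -> Prop) : 0 < d -> (forall z, 0 < Cmod z < d -> P z) -> cnear' (RtoC 0) P.
Proof.
  intros Hd H. exists d. split; auto. intros w Hw Hl.
  rewrite Cminus_0_r in Hl. apply H. split; auto. now apply Cmod_gt_0.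
Qed.

Lemma ctends_linear_0 f l K d : 0 < d -> (forall z, 0 < Cmod z < d -> Cmod (f z - l)%C <= K * Cmod z) ->
  ctends (cnear' (RtoC 0)) f l.
Proof.
  intros Hd H eps He. pose proof (Rabs_pos K) as HK. pose proof (Rle_abs K).
  assert (He' : 0 < eps / (Rabs K + 1)) by (apply Rdiv_lt_0_compat; lra).
  apply (cnear'_0 (Rmin d (eps / (Rabs K + 1)))); [now apply Rmin_glb_lt|].
  intros z [Hz1 Hz2].
  destruct (Rmin_Rgt_l _ _ _ Hz2) as [Hz3 Hz4].
  eapply Rle_lt_trans; [apply H; lra|].
  apply (Rmult_lt_compat_r (Rabs K + 1)) in Hz4; [|lra].
  unfold Rdiv in Hz4. rewrite Rmult_assoc, Rinv_l, Rmult_1_r in Hz4 by lra. nra.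
Qed.

(** Riemann's removable singularity: the mean over a circle is the value that continuity imposes at
    [0]. *)
Lemma hol0_tends rho f r : hol0 rho f -> 0 < r < rho -> ctends (cnear' (RtoC 0)) f (coef f r 0).
Proof.
  intros Hf Hr. destruct (circle_bound_exists f r) as (B & HB0 & HB); [lra| |].
  { intros z Hz. apply cdiff_ccont, Hf. lra. }
  apply (ctends_linear_0 _ _ (2 * B / r) (r / 2)); [lra|]. intros z Hz.
  pose proof (taylor_tail_half rho f z r B 1 Hf ltac:(lra) Hr HB) as H.
  unfold psum in H; simpl in H.
  replace (f z - (RtoC 0 + coef f r 0 * RtoC 1))%C with (f z - coef f r 0)%C in H by ring.
  eapply Rle_trans; [exact H|]. right. field. lra.
Qed.

Lemma coef_0 rho f r : hol0 rho f -> 0 < r < rho -> ccont f (RtoC 0) -> coef f r 0 = f (RtoC 0).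
Proof.
  intros Hf Hr Hc. eapply ctends_unique; [apply _|now apply (hol0_tends rho)|].
  now apply ctends_cnear_cnear'.
Qed.

Lemma hol0_of_cdiff rho f : 0 < rho -> (forall z, Cmod z < rho -> cdiff f z) -> hol0 rho f.
Proof.
  intros Hr Hf. split; [intros z Hz; apply Hf; lra|].
  assert (H0 : ccont f (RtoC 0)) by (apply cdiff_ccont, Hf; rewrite Cmod_0; lra).
  destruct (ctends_bounded _ _ _ H0) as (d & Hd & H).
  exists (Cmod (f (RtoC 0)) + 1), d. split; auto. intros z Hz. apply H.
  rewrite Cminus_0_r. lra.
Qed.

(** * Jets at the origin *)

Lemma csum_ext u v n : (forall k, (k < n)%nat -> u k = v k) -> csum u n = csum v n.
Proof.
  intros H. induction n as [|n IH]; simpl; auto. rewrite IH, H; auto.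
Qed.

Lemma csum_plus u v n : csum (fun k => u k + v k)%C n = (csum u n + csum v n)%C.
Proof. induction n as [|n IH]; simpl; [ring|]. rewrite IH. ring. Qed.

Lemma csum_scal a u n : csum (fun k => a * u k)%C n = (a * csum u n)%C.
Proof. induction n as [|n IH]; simpl; [ring|]. rewrite IH. ring. Qed.

Lemma csum_head u n : csum u (S n) = (u O + csum (fun k => u (S k)) n)%C.
Proof.
  induction n as [|n IH]; [simpl; ring|].
  change (csum u (S (S n))) with (csum u (S n) + u (S n))%C. rewrite IH. simpl. ring.
Qed.

Lemma csum_zero u n : (forall k, (k < n)%nat -> u k = RtoC 0) -> csum u n = RtoC 0.
Proof.
  intros H. induction n as [|n IH]; simpl; auto. rewrite IH, H; auto. ring.
Qed.

Lemma psum_head c z n : psum c z (S n) = (c O + z * psum (fun k => c (S k)) z n)%C.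
Proof.
  unfold psum. rewrite csum_head, <- csum_scal. simpl. f_equal; [ring|].
  apply csum_ext. intros k _. ring.
Qed.

(** Only the terms of [c] below [n] matter, but [c] is an infinite sequence so that the same one can
    serve at every order. *)
Definition jet (f : C -> C) (c : nat -> C) (n : nat) : Prop :=
  exists K d, 0 < d /\ forall z, 0 < Cmod z < d -> Cmod (f z - psum c z n)%C <= K * Cmod z ^ n.

Definition shift (c : nat -> C) (k : nat) : C := match k with O => RtoC 0 | S k => c k end.

Lemma jet_ext f g c n : cnear' (RtoC 0) (fun z => f z = g z) -> jet f c n -> jet g c n.
Proof.
  intros (e & He & E) (K & d & Hd & H). exists K, (Rmin d e). split; [now apply Rmin_glb_lt|].
  intros z [Hz1 Hz2]. rewrite <- E.
  - apply H. split; auto. eapply Rlt_le_trans; [exact Hz2|apply Rmin_l].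
  - now apply Cmod_gt_0.
  - rewrite Cminus_0_r. eapply Rlt_le_trans; [exact Hz2|apply Rmin_r].
Qed.

Lemma jet_ext_coef f c e n : (forall k, c k = e k) -> jet f c n -> jet f e n.
Proof. intros H. apply functional_extensionality in H. now subst. Qed.

Lemma jet_pred f c n : jet f c (S n) -> jet f c n.
Proof.
  intros (K & d & Hd & H). exists (Rabs K + Cmod (c n)), (Rmin d 1).
  split; [apply Rmin_glb_lt; lra|]. intros z [Hz1 Hz2].
  destruct (Rmin_Rgt_l _ _ _ Hz2) as [Hz3 Hz4].
  replace (f z - psum c z n)%C with ((f z - psum c z (S n)) + c n * z ^ n)%C
    by (unfold psum; simpl; ring).
  eapply Rle_trans; [apply Cmod_triangle|]. rewrite Rmult_plus_distr_r, Cmod_mult, Cmod_pow.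
  apply Rplus_le_compat_r. eapply Rle_trans; [apply H; lra|].
  pose proof (pow_le (Cmod z) n ltac:(lra)). pose proof (Rle_abs K). pose proof (Rabs_pos K). simpl.
  apply (Rle_trans _ (Rabs K * (Cmod z * Cmod z ^ n))).
  - apply Rmult_le_compat_r; nra.
  - apply Rmult_le_compat_l; nra.
Qed.

Lemma jet_le f c n m : (n <= m)%nat -> jet f c m -> jet f c n.
Proof. intros H. induction H; auto. intros K. now apply IHle, jet_pred. Qed.

Lemma jet_plus f g c e n : jet f c n -> jet g e n ->
  jet (fun z => f z + g z)%C (fun k => c k + e k)%C n.
Proof.
  intros (K & d & Hd & H) (K' & d' & Hd' & H'). exists (K + K'), (Rmin d d').
  split; [now apply Rmin_glb_lt|]. intros z [Hz1 Hz2].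
  destruct (Rmin_Rgt_l _ _ _ Hz2) as [Hz3 Hz4].
  assert (E : psum (fun k => c k + e k)%C z n = (psum c z n + psum e z n)%C).
  { unfold psum. rewrite <- csum_plus. apply csum_ext. intros k _. ring. }
  rewrite E. replace (f z + g z - (psum c z n + psum e z n))%C with
    ((f z - psum c z n) + (g z - psum e z n))%C by ring.
  eapply Rle_trans; [apply Cmod_triangle|]. rewrite Rmult_plus_distr_r.
  apply Rplus_le_compat; [apply H|apply H']; lra.
Qed.

Lemma jet_scal a f c n : jet f c n -> jet (fun z => a * f z)%C (fun k => a * c k)%C n.
Proof.
  intros (K & d & Hd & H). exists (Cmod a * K), d. split; auto. intros z Hz.
  assert (E : psum (fun k => a * c k)%C z n = (a * psum c z n)%C).
  { unfold psum. rewrite <- csum_scal. apply csum_ext. intros k _. ring. }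
  rewrite E. replace (a * f z - a * psum c z n)%C with (a * (f z - psum c z n))%C by ring.
  rewrite Cmod_mult, Rmult_assoc. apply Rmult_le_compat_l; [apply Cmod_ge_0|auto].
Qed.

Lemma jet_mulz f c n : jet f c n -> jet (fun z => z * f z)%C (shift c) (S n).
Proof.
  intros (K & d & Hd & H). exists K, d. split; auto. intros z Hz.
  rewrite psum_head. replace (psum (fun k => shift c (S k)) z n) with (psum c z n) by reflexivity.
  cbn [shift]. replace (z * f z - (RtoC 0 + z * psum c z n))%C with (z * (f z - psum c z n))%C by ring.
  rewrite Cmod_mult. simpl. specialize (H z Hz). nra.
Qed.

Lemma jet_divz f c n : jet f c (S n) -> jet (fun z => (f z - c O) / z)%C (fun k => c (S k)) n.
Proof.
  intros (K & d & Hd & H). exists K, d. split; auto. intros z Hz. specialize (H z Hz).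
  assert (Hz0 : z <> RtoC 0) by (apply Cmod_gt_0; lra).
  rewrite psum_head in H.
  replace (f z - (c O + z * psum (fun k => c (S k)) z n))%C with
    (z * ((f z - c O) / z - psum (fun k => c (S k)) z n))%C in H by (now field).
  rewrite Cmod_mult in H. apply (Rmult_le_reg_l (Cmod z)); [lra|].
  eapply Rle_trans; [exact H|]. simpl. lra.
Qed.

Definition cconv (c e : nat -> C) (k : nat) : C := csum (fun j => c j * e (k - j)%nat)%C (S k).

Lemma cconv_head c e k : cconv c e k = (c O * e k + shift (cconv (fun j => c (S j)) e) k)%C.
Proof.
  unfold cconv. rewrite csum_head, Nat.sub_0_r. f_equal. now destruct k.
Qed.

(** Induction through [f * g = c O * g + z * ((f - c O) / z * g)]: the quotient loses one order, the
    factor [z] regains it, and no double sum has to be rearranged. *)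
Lemma jet_mult n f g c e : jet f c n -> jet g e n ->
  jet (fun z => f z * g z)%C (cconv c e) n.
Proof.
  revert f c. induction n as [|n IH]; intros f c Hf Hg.
  - destruct Hf as (K & d & Hd & H). destruct Hg as (K' & d' & Hd' & H').
    exists (K * K'), (Rmin d d'). split; [now apply Rmin_glb_lt|]. intros z [Hz1 Hz2].
    destruct (Rmin_Rgt_l _ _ _ Hz2) as [Hz3 Hz4].
    specialize (H z ltac:(lra)). specialize (H' z ltac:(lra)). unfold psum in *. simpl in *.
    replace (f z - RtoC 0)%C with (f z) in H by ring. replace (g z - RtoC 0)%C with (g z) in H' by ring.
    replace (f z * g z - RtoC 0)%C with (f z * g z)%C by ring. rewrite Cmod_mult.
    rewrite Rmult_1_r in *. apply Rmult_le_compat; auto; apply Cmod_ge_0.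
  - pose proof (IH _ _ (jet_divz _ _ _ Hf) (jet_pred _ _ _ Hg)) as H1.
    pose proof (jet_plus _ _ _ _ _ (jet_scal (c O) _ _ _ Hg) (jet_mulz _ _ _ H1)) as H2.
    eapply jet_ext_coef; [|eapply jet_ext; [|exact H2]].
    + intros k. symmetry. apply cconv_head.
    + apply (cnear'_0 1); [lra|]. intros z Hz. field. apply Cmod_gt_0. lra.
Qed.

Lemma Cmod_eq_zero_linear (x : C) K d : 0 < d ->
  (forall z, 0 < Cmod z < d -> Cmod x <= K * Cmod z) -> x = RtoC 0.
Proof.
  intros Hd H. apply (ctends_unique (cnear' (RtoC 0)) (fun _ => RtoC 0)); [|apply ctends_const, _].
  apply (ctends_linear_0 _ _ K d Hd). intros z Hz.
  replace (RtoC 0 - x)%C with (- x)%C by ring. rewrite Cmod_opp. auto.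
Qed.

(** At the first index [k] where the sequences differ, [|c k - e k| * |z|^k] would be
    [O(|z|^(k+1))]. *)
Lemma jet_unique f c e : (forall n, jet f c n) -> (forall n, jet f e n) -> forall k, c k = e k.
Proof.
  intros Hc He k. induction k as [k IH] using (well_founded_induction lt_wf).
  destruct (Hc (S k)) as (K & d & Hd & H). destruct (He (S k)) as (K' & d' & Hd' & H').
  apply Cminus_eq_0. apply (Cmod_eq_zero_linear _ (K + K') (Rmin d d')); [now apply Rmin_glb_lt|].
  intros z [Hz1 Hz2].
  destruct (Rmin_Rgt_l _ _ _ Hz2) as [Hz3 Hz4].
  specialize (H z ltac:(lra)). specialize (H' z ltac:(lra)).
  assert (E : psum c z k = psum e z k).
  { apply csum_ext. intros j Hj. now rewrite IH. }
  assert (E' : ((c k - e k) * z ^ k = (f z - psum e z (S k)) - (f z - psum c z (S k)))%C).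
  { unfold psum in *. simpl. rewrite E. ring. }
  pose proof (Cmod_triangle_minus (f z - psum e z (S k))%C (f z - psum c z (S k))%C) as T.
  rewrite <- E', Cmod_mult, Cmod_pow in T.
  pose proof (pow_lt (Cmod z) k Hz1) as Hp.
  apply (Rmult_le_reg_r (Cmod z ^ k)); auto. simpl in H, H'. lra.
Qed.

Lemma jet_hol0 rho f r n : hol0 rho f -> 0 < r < rho -> jet f (coef f r) n.
Proof.
  intros Hf Hr. destruct (circle_bound_exists f r) as (B & HB0 & HB); [lra| |].
  { intros z Hz. apply cdiff_ccont, Hf. lra. }
  exists (2 * B / r ^ n), (r / 2). split; [lra|]. intros z Hz.
  eapply Rle_trans; [apply (taylor_tail_half rho f z r B n); auto; lra|].
  right. unfold Rdiv. rewrite Rpow_mult_distr, pow_inv. ring.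
Qed.

(** Convergence at the single point [r = d / 2] bounds the terms [c k * r ^ k] from some index on,
    and the tail is then geometric for [|z| < r / 2]. *)
Lemma jet_series f c d : 0 < d ->
  (forall z, 0 < Cmod z < d -> ctends eventually (psum c z) (f z)) -> forall n, jet f c n.
Proof.
  intros Hd H n. set (r := d / 2).
  assert (Hr : Cmod (RtoC r) = r) by (rewrite Cmod_R, Rabs_pos_eq; unfold r; lra).
  (* With partial sums within [1/2] of the limit, each term from [N] on has modulus at most 1. *)
  destruct (H (RtoC r) ltac:(rewrite Hr; unfold r; lra) (/ 2) ltac:(lra)) as [N HN].
  assert (Hb : forall k, (N <= k)%nat -> Cmod (c k) <= 1 / r ^ k).
  { intros k Hk. pose proof (HN k Hk) as H1. pose proof (HN (S k) ltac:(lia)) as H2.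
    assert (Hrk : 0 < r ^ k) by (apply pow_lt; unfold r; lra).
    apply (Rmult_le_reg_r (r ^ k)); auto. unfold Rdiv. rewrite Rmult_assoc, Rinv_l, Rmult_1_l by lra.
    rewrite <- Hr at 1. rewrite <- Cmod_pow, <- Cmod_mult.
    replace (c k * RtoC r ^ k)%C with (psum c (RtoC r) (S k) - psum c (RtoC r) k)%C
      by (unfold psum; simpl; ring).
    eapply Rle_trans; [apply (Cmod_triangle_minus3 _ (f (RtoC r)))|].
    rewrite (Cmod_minus_sym (f (RtoC r))). lra. }
  (* The coefficient bound is available only from [N] on, so the jet is obtained at an order at
     least [N] and then truncated. *)
  apply (jet_le f c n (max n N)); [lia|].
  exists (2 / r ^ max n N), (r / 2). split; [unfold r; lra|]. intros z Hz.
  eapply Rle_trans; [apply (psum_tail c z r 1); try (unfold r in *; lra)|].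
  - intros k Hk. apply Hb. lia.
  - apply H. unfold r in Hz. lra.
  - assert (Hx : Cmod z / r <= / 2) by (apply Rle_div_l; unfold r in *; lra).
    assert (Hx0 : 0 <= Cmod z / r) by (apply Rdiv_le_0_compat; unfold r in *; lra).
    pose proof (pow_le (Cmod z / r) (max n N) Hx0).
    replace (2 / r ^ max n N * Cmod z ^ max n N) with (1 * (Cmod z / r) ^ max n N * 2)
      by (unfold Rdiv; rewrite Rpow_mult_distr, pow_inv; ring).
    unfold Rdiv at 1. apply Rmult_le_compat_l; [lra|].
    rewrite <- (Rinv_inv 2). apply Rinv_le_contravar; lra.
Qed.

(** * Cauchy estimates and limits of coefficients *)

Lemma cdiff_translate f z h : cdiff f (z + h)%C -> cdiff (fun x => f (z + x)%C) h.
Proof.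
  intros H. apply (cdiff_comp f (fun x => z + x)%C); auto.
  apply cdiff_plus; [apply cdiff_const|apply cdiff_id].
Qed.

(** The difference quotient at [z] has a removable singularity at [h = 0] and is at most
    [2 * M / (rho / 2)] on [|h| = rho / 2]; [hol_bound] costs another factor 2 on the disc of half
    that radius. *)
Lemma difference_quotient_bound f z rho M : 0 < rho ->
  (forall w, Cmod (w - z)%C < rho -> cdiff f w) ->
  (forall w, Cmod (w - z)%C < rho -> Cmod (f w) <= M) ->
  forall w, Cmod (w - z)%C <= rho / 4 -> Cmod (f w - f z)%C <= 8 * M / rho * Cmod (w - z)%C.
Proof.
  intros Hrho Hd HM.
  assert (Ez : forall h, (z + h - z)%C = h) by (intros h; ring).
  assert (HM0 : 0 <= M).
  { eapply Rle_trans; [apply Cmod_ge_0|apply (HM z)]. replace (z - z)%C with (RtoC 0) by ring.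
    rewrite Cmod_0. lra. }
  set (g := fun h => ((f (z + h) - f z) / h)%C).
  assert (Hg : hol0 rho g).
  { split.
    - intros h Hh. apply cdiff_div; [|apply cdiff_id|apply Cmod_pos_nz; lra].
      apply cdiff_minus; [|apply cdiff_const]. apply cdiff_translate, Hd. rewrite Ez. lra.
    - destruct (Hd z) as [l Hl].
      { rewrite Cmod_minus_diag. lra. }
      destruct (ctends_bounded _ _ _ Hl) as (d & Hd0 & H). exists (Cmod l + 1), d. split; auto.
      intros h Hh. specialize (H (z + h)%C). rewrite Ez in H. apply H; [|lra].
      intros E. assert (E' : h = RtoC 0) by (rewrite <- (Ez h), E; ring).
      rewrite E', Cmod_0 in Hh. lra. }
  assert (HB : circle_bound g (rho / 2) (4 * M / rho)).
  { intros s _. pose proof (Cmod_circle (rho / 2) s ltac:(lra)) as E.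
    set (h := (RtoC (rho / 2) * ucirc s)%C) in *. unfold g.
    rewrite Cmod_div, E by (apply Cmod_pos_nz; lra).
    apply Rle_div_l; [lra|]. replace (4 * M / rho * (rho / 2)) with (M + M) by (field; lra).
    eapply Rle_trans; [apply Cmod_triangle_minus|]. apply Rplus_le_compat; apply HM.
    - rewrite Ez. lra.
    - rewrite Cmod_minus_diag. lra. }
  intros w Hw. destruct (classic (w = z)) as [->|n].
  - replace (f z - f z)%C with (RtoC 0) by ring. replace (z - z)%C with (RtoC 0) by ring.
    rewrite Cmod_0. lra.
  - assert (Hwz : 0 < Cmod (w - z)%C) by (apply Cmod_gt_0; now apply Cminus_neq_0).
    pose proof (hol_bound rho g (w - z)%C (rho / 2) (4 * M / rho) Hg ltac:(lra) ltac:(lra) HB) as K.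
    unfold g in K. replace (z + (w - z))%C with w in K by ring.
    rewrite Cmod_div in K by (now apply Cminus_neq_0).
    apply (proj1 (Rle_div_l _ _ _ Hwz)) in K. eapply Rle_trans; [exact K|].
    right. field. lra.
Qed.

Lemma cder_bound f z rho M l : 0 < rho ->
  (forall w, Cmod (w - z)%C < rho -> cdiff f w) ->
  (forall w, Cmod (w - z)%C < rho -> Cmod (f w) <= M) ->
  cder f z l -> Cmod l <= 8 * M / rho.
Proof.
  intros Hrho Hd HM Hl. refine (ctends_le _ _ _ _ _ Hl).
  exists (rho / 4). split; [lra|]. intros w Hw1 Hw2.
  assert (Hwz : 0 < Cmod (w - z)%C) by (apply Cmod_gt_0; now apply Cminus_neq_0).
  rewrite Cmod_div by (now apply Cminus_neq_0). apply Rle_div_l; auto.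
  apply difference_quotient_bound; auto. lra.
Qed.

Lemma cder_zpow n z : z <> RtoC 0 -> cder (fun w => w ^ n)%C z (RtoC (INR n) * z ^ n / z)%C.
Proof.
  intros Hz. induction n as [|n IH].
  - simpl. eapply cder_eq; [apply cder_const|]. field. auto.
  - eapply cder_eq; [apply (cder_mult (fun w => w) (fun w => w ^ n)%C); [apply cder_id|exact IH]|].
    rewrite S_INR, RtoC_plus. simpl. field. auto.
Qed.

Lemma cder_psum c z n : z <> RtoC 0 ->
  cder (fun w => psum c w n) z (psum (fun k => RtoC (INR k) * c k)%C z n / z)%C.
Proof.
  intros Hz. unfold psum. induction n as [|n IH].
  - simpl. eapply cder_eq; [apply cder_const|]. field. auto.
  - simpl. eapply cder_eq; [apply cder_plus; [exact IH|apply cder_scal, cder_zpow, Hz]|].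
    field. auto.
Qed.

(** The remainder of [f] is holomorphic off [0] and [O(|w|^n)], so Cauchy's estimate on a disc of
    radius [|z| / 2] about [z] bounds [z] times its derivative by the same power. The operator
    [z d/dz] keeps the index and the order. *)
Lemma jet_deriv f f' c d n : 0 < d -> (forall z, 0 < Cmod z < d -> cder f z (f' z)) ->
  jet f c n -> jet (fun z => z * f' z)%C (fun k => RtoC (INR k) * c k)%C n.
Proof.
  intros Hd Hf (K & e & He & H).
  (* [16] is the [8] of [cder_bound] divided by the relative radius [1/2], and [|w| <= 3/2 * |z|] on
     the disc; the halved range for [z] keeps that disc inside both domains. *)
  exists (16 * (Rabs K * (3 / 2) ^ n)), (Rmin d e / 2).
  assert (Hm : 0 < Rmin d e) by (now apply Rmin_glb_lt).
  pose proof (Rmin_l d e). pose proof (Rmin_r d e).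
  split; [lra|]. intros z Hz.
  assert (Hz0 : z <> RtoC 0) by (apply Cmod_gt_0; lra).
  set (g := fun w => (f w - psum c w n)%C).
  assert (Hg : cder g z (f' z - psum (fun k => RtoC (INR k) * c k)%C z n / z)%C).
  { apply cder_minus; [apply Hf; lra|now apply cder_psum]. }
  assert (Hw : forall w, Cmod (w - z)%C < Cmod z / 2 -> 0 < Cmod w < Rmin d e /\ Cmod w <= 3 / 2 * Cmod z).
  { intros w Hw. pose proof (Cmod_triangle_rev w z).
    pose proof (Cmod_triangle_rev z w) as Hzw. rewrite Cmod_minus_sym in Hzw. lra. }
  replace (z * f' z - psum (fun k => RtoC (INR k) * c k) z n)%C with
    (z * (f' z - psum (fun k => RtoC (INR k) * c k) z n / z))%C by (now field).
  rewrite Cmod_mult.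
  eapply Rle_trans; [apply Rmult_le_compat_l; [lra|]; refine (cder_bound g z (Cmod z / 2)
    (Rabs K * (3 / 2 * Cmod z) ^ n) _ _ _ _ Hg); [lra| |]|].
  - intros w Hw'. destruct (Hw w Hw') as [W1 W2]. apply cdiff_minus.
    + exists (f' w). apply Hf. lra.
    + eexists. apply cder_psum. apply Cmod_gt_0. lra.
  - intros w Hw'. destruct (Hw w Hw') as [W1 W2]. unfold g.
    eapply Rle_trans; [apply H; lra|]. apply Rmult_le_compat; [| |apply Rle_abs|].
    + pose proof (Rle_trans _ _ _ (Cmod_ge_0 _) (H w ltac:(lra))) as P.
      pose proof (pow_lt (Cmod w) n ltac:(lra)). nra.
    + apply pow_le. lra.
    + apply pow_incr. lra.
  - right. rewrite Rpow_mult_distr. field. lra.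
Qed.

(** A Vitali theorem for coefficients, with no uniformity in [z] of the convergence. Once the lower
    coefficients converge, a single small [z] suffices: [coef (g x) r k * z ^ k] is [g x z] minus
    the lower terms, up to an error [O(|z|^(k+1))] uniform in [x]. The limit [G] is known only
    through its jets. *)
Lemma coef_tends {T} (F : (T -> Prop) -> Prop) {FF : ProperFilter F} (g : T -> C -> C) (G : C -> C)
  rho r B c : 0 < r < rho ->
  F (fun x => hol0 rho (g x) /\ circle_bound (g x) r B) ->
  (forall z, 0 < Cmod z < r -> ctends F (fun x => g x z) (G z)) ->
  (forall n, jet G c n) ->
  forall k, ctends F (fun x => coef (g x) r k) (c k).
Proof.
  intros Hr HF HG Hc k. induction k as [k IH] using (well_founded_induction lt_wf).
  intros eps He.
  destruct (Hc (S k)) as (K & d & Hd & HK).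
  assert (HB0 : 0 <= B).
  { destruct (filter_ex _ HF) as [x [_ Hx]]. eapply Rle_trans; [apply Cmod_ge_0|apply (Hx 0); lra]. }
  set (L := 2 * B / r ^ S k + Rabs K).
  assert (HL : 0 <= L).
  { pose proof (Rabs_pos K). assert (0 <= 2 * B / r ^ S k); [|unfold L; lra].
    apply Rdiv_le_0_compat; [lra|apply pow_lt; lra]. }
  (* [L] collects the constants of both remainders, which thus contribute at most [eps / 3 * y ^ k];
     the two differences that tend to zero at [z] take [eps / 6 * y ^ k] each. *)
  set (y := Rmin (Rmin (r / 2) (d / 2)) (eps / (3 * (L + 1)))).
  assert (Hy0 : 0 < y) by (repeat apply Rmin_glb_lt; try lra; apply Rdiv_lt_0_compat; lra).
  assert (Hy1 : y <= r / 2) by (eapply Rle_trans; apply Rmin_l).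
  assert (Hy2 : y <= d / 2) by (eapply Rle_trans; [apply Rmin_l|apply Rmin_r]).
  assert (Hy3 : y <= eps / (3 * (L + 1))) by apply Rmin_r.
  set (z := RtoC y).
  assert (Hz : Cmod z = y) by (unfold z; rewrite Cmod_R, Rabs_pos_eq; lra).
  assert (Hp : ctends F (fun x => psum (coef (g x) r) z k) (psum c z k)).
  { unfold psum. clear - FF IH.
    assert (Hj : forall j, (j <= k)%nat -> ctends F (fun x => csum (fun i => coef (g x) r i * z ^ i)%C j)
      (csum (fun i => c i * z ^ i)%C j)).
    { induction j as [|j IHj]; intros Hj; simpl.
      - apply ctends_const, _.
      - apply ctends_plus; [apply _|apply IHj; lia|].
        apply ctends_mult; [apply _|apply IH; lia|apply ctends_const, _]. }
    now apply Hj. }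
  assert (Hyk : 0 < y ^ k) by (now apply pow_lt).
  assert (He3 : 0 < eps / 3 * y ^ k) by (apply Rmult_lt_0_compat; lra).
  assert (He4 : 0 < eps / 6 * y ^ k) by (apply Rmult_lt_0_compat; lra).
  generalize (filter_and _ _ HF (filter_and _ _ (Hp _ He4) (HG z ltac:(lra) _ He4))).
  apply filter_imp. intros x [[Hx1 Hx2] [Hx3 Hx4]].
  pose proof (taylor_tail_half rho (g x) z r B (S k) Hx1 ltac:(lra) Hr Hx2) as T1.
  specialize (HK z ltac:(lra)).
  apply (Rmult_lt_reg_r (y ^ k)); auto.
  rewrite <- Hz at 1. rewrite <- Cmod_pow, <- Cmod_mult.
  replace ((coef (g x) r k - c k) * z ^ k)%C with
    ((G z - psum c z (S k)) - (g x z - psum (coef (g x) r) z (S k))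
      + ((g x z - G z) - (psum (coef (g x) r) z k - psum c z k)))%C
    by (unfold psum; simpl; ring).
  eapply Rle_lt_trans; [apply Cmod_triangle|].
  eapply Rle_lt_trans; [apply Rplus_le_compat; apply Cmod_triangle_minus|].
  assert (T2 : Cmod (G z - psum c z (S k))%C + Cmod (g x z - psum (coef (g x) r) z (S k))%C <= L * y * y ^ k).
  { rewrite Hz in *. unfold L. eapply Rle_trans; [apply Rplus_le_compat; [exact HK|exact T1]|].
    replace (2 * B * (y / r) ^ S k) with (2 * B / r ^ S k * y * y ^ k)
      by (unfold Rdiv; rewrite Rpow_mult_distr, pow_inv; simpl; ring).
    pose proof (Rle_abs K). simpl. pose proof (Rmult_le_pos _ _ (Rlt_le _ _ Hy0) (Rlt_le _ _ Hyk)). nra. }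
  assert (T3 : L * y * y ^ k <= eps / 3 * y ^ k).
  { apply Rmult_le_compat_r; [lra|].
    apply (Rmult_le_compat_r (3 * (L + 1))) in Hy3; [|lra].
    unfold Rdiv in Hy3. rewrite Rmult_assoc, Rinv_l, Rmult_1_r in Hy3 by lra. nra. }
  lra.
Qed.

(** * Univalent functions *)

Definition univalent_on_disc (f : C -> C) : Prop :=
  (forall z, Cmod z < 1 -> cdiff f z) /\
  (forall z w, Cmod z < 1 -> Cmod w < 1 -> f z = f w -> z = w).

Lemma circle_min_pos f r : 0 <= r -> (forall z, Cmod z = r -> ccont f z) ->
  (forall z, Cmod z = r -> f z <> RtoC 0) ->
  exists m, 0 < m /\ forall s, 0 <= s <= 1 -> m <= Cmod (f (RtoC r * ucirc s)%C).
Proof.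
  intros Hr Hf Hn.
  destruct (continuity_ab_min (fun s => Cmod (f (RtoC r * ucirc s)%C)) 0 1) as [m [Hm _]]; [lra| |].
  - intros c Hc. apply continuity_pt_filterlim.
    apply (pcont_Cmod (fun s => f (RtoC r * ucirc s)%C)). now apply icont_circle.
  - exists (Cmod (f (RtoC r * ucirc m)%C)). split; auto.
    apply Cmod_gt_0, Hn, Cmod_circle, Hr.
Qed.

(* If [v] close to [f w] had no preimage near [w], the mean value property of
   [1 / (f - v)] at [w] would fail. *)
Lemma univalent_open f w eps : univalent_on_disc f -> Cmod w < 1 -> 0 < eps ->
  exists d, 0 < d /\ forall v, Cmod (v - f w)%C < d ->
    exists x, Cmod x < 1 /\ Cmod (x - w)%C < eps /\ f x = v.
Proof.
  intros [Hf Hinj] Hw He. set (rho := Rmin eps (1 - Cmod w) / 2).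
  assert (Hrho : 0 < rho) by (unfold rho; apply Rdiv_lt_0_compat; [apply Rmin_glb_lt|]; lra).
  assert (Hr1 : 2 * rho <= eps) by (unfold rho; pose proof (Rmin_l eps (1 - Cmod w)); lra).
  assert (Hr2 : 2 * rho <= 1 - Cmod w) by (unfold rho; pose proof (Rmin_r eps (1 - Cmod w)); lra).
  assert (Hdisc : forall h, Cmod h < 2 * rho -> Cmod (w + h)%C < 1).
  { intros h Hh. pose proof (Cmod_triangle w h). lra. }
  set (F := fun h => (f (w + h) - f w)%C).
  assert (HF : forall h, Cmod h < 2 * rho -> cdiff F h).
  { intros h Hh. apply cdiff_minus; [apply cdiff_translate, Hf; auto|apply cdiff_const]. }
  destruct (circle_min_pos F rho) as (m & Hm & Hmin); [lra| | |].
  { intros z Hz. apply cdiff_ccont, HF. lra. }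
  { intros z Hz E. apply Cminus_eq_0 in E. apply Hinj in E; [|apply Hdisc; lra|auto].
    assert (E' : z = RtoC 0) by (replace z with ((w + z) - w)%C by ring; rewrite E; ring).
    rewrite E', Cmod_0 in Hz. lra. }
  (* The image of the circle stays at distance at least [m] from [f w]. If [|v - f w| < m / 2], then
     [1 / (f - v)] has modulus at most [2 / m] on the circle but more than [2 / m] at the centre. *)
  exists (m / 2). split; [lra|]. intros v Hv. apply NNPP. intros Hno.
  assert (Hne : forall h, Cmod h < 2 * rho -> (f (w + h) - v)%C <> RtoC 0).
  { intros h Hh E. apply Hno. exists (w + h)%C. repeat split; auto.
    - replace (w + h - w)%C with h by ring. lra.
    - now apply Cminus_eq_0. }
  set (g := fun h => (RtoC 1 / (f (w + h) - v))%C).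
  assert (Hg : forall h, Cmod h < 2 * rho -> cdiff g h).
  { intros h Hh. apply cdiff_div; [apply cdiff_const| |auto].
    apply cdiff_minus; [apply cdiff_translate, Hf; auto|apply cdiff_const]. }
  assert (Hg0 : hol0 (2 * rho) g) by (apply hol0_of_cdiff; auto; lra).
  assert (H0 : coef g rho 0 = g (RtoC 0)).
  { apply (coef_0 (2 * rho)); auto; [lra|]. apply cdiff_ccont, Hg. rewrite Cmod_0. lra. }
  assert (HB : circle_bound g rho (2 / m)).
  { intros s Hs. specialize (Hmin s Hs). pose proof (Cmod_circle rho s ltac:(lra)) as Es.
    set (h := (RtoC rho * ucirc s)%C) in *. unfold g. rewrite Cmod_div by (apply Hne; lra).
    rewrite Cmod_1.
    assert (K : m / 2 <= Cmod (f (w + h) - v)%C).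
    { pose proof (Cmod_triangle_minus3 (f (w + h)%C) v (f w)). unfold F in Hmin. lra. }
    replace (2 / m) with (1 / (m / 2)) by (field; lra).
    apply Rmult_le_compat_l; [lra|]. apply Rinv_le_contravar; lra. }
  assert (K : Cmod (g (RtoC 0)) <= 2 / m).
  { rewrite <- H0. eapply Rle_trans; [apply (Cmod_coef_le g rho (2 / m) 0); auto|].
    - intros z Hz. apply cdiff_ccont, Hg. lra.
    - simpl. right. field. lra. }
  specialize (Hne (RtoC 0) ltac:(rewrite Cmod_0; lra)).
  unfold g in K. rewrite Cmod_div, Cmod_1 in K by auto.
  replace (w + RtoC 0)%C with w in * by ring.
  rewrite Cmod_minus_sym in Hv.
  assert (Hp : 0 < Cmod (f w - v)%C) by (now apply Cmod_gt_0).
  apply (proj1 (Rle_div_l _ _ _ Hp)) in K.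
  assert (2 / m * Cmod (f w - v)%C < 2 / m * (m / 2)).
  { apply Rmult_lt_compat_l; auto. apply Rdiv_lt_0_compat; lra. }
  replace (2 / m * (m / 2)) with 1 in H by (field; lra). lra.
Qed.

(** Covers both the local inverse of [f], with [t] a translation, and the transition maps of a
    chain, with [t] another map of the chain. Univalence and openness of [f] give continuity of [g],
    from which differentiability follows. *)
Lemma cder_inverse f g t x l m : univalent_on_disc f ->
  cnear x (fun y => Cmod (g y) < 1 /\ f (g y) = t y) ->
  cder t x m -> cder f (g x) l -> l <> RtoC 0 -> cder g x (m / l)%C.
Proof.
  intros Hf Hg Ht Hl Hl0.
  assert (Hx : Cmod (g x) < 1 /\ f (g x) = t x).
  { destruct Hg as (d & Hd & H). apply H. now rewrite Cmod_minus_diag. }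
  destruct Hx as [Hx1 Hx2].
  assert (Hgc : ccont g x).
  { intros eps He. destruct (univalent_open f (g x) eps Hf Hx1 He) as (d & Hd & H).
    generalize (filter_and _ _ Hg (cder_ccont _ _ _ Ht d Hd)). apply filter_imp.
    intros y [[Hy1 Hy2] Hy3]. rewrite Hx2 in H. destruct (H (t y) Hy3) as (z & Hz1 & Hz2 & Hz3).
    rewrite <- Hy2 in Hz3. destruct Hf as [_ Hinj]. apply Hinj in Hz3; auto. now subst. }
  destruct (cder_factor f (g x) l Hl) as (q & Hq & Hq0 & Hqf).
  assert (Hqg : ctends (cnear x) (fun y => q (g y)) l).
  { rewrite <- Hq0. apply ctends_comp; auto. apply _. }
  assert (Hqn : cnear x (fun y => q (g y) <> RtoC 0)).
  { apply (ccont_neq0 (fun y => q (g y))); [|rewrite Hq0; auto]. unfold ccont. now rewrite Hq0. }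
  apply (ctends_ext _ (fun y => (t y - t x) / (y - x) * / q (g y))%C).
  - generalize (filter_and _ _ (increment_nz _ _ (cnear'_increment x))
      (cnear_cnear' _ _ (filter_and _ _ Hqn Hg))).
    apply filter_imp. intros y [Hy1 [Hy2 [Hy3 Hy4]]]. rewrite <- Hy4, <- Hx2, Hqf. now field.
  - apply ctends_mult; [apply _|exact Ht|]. apply ctends_inv; [apply _|auto|].
    now apply ctends_cnear_cnear'.
Qed.

Lemma psum_zero c z n : (forall k, (k < n)%nat -> c k = RtoC 0) -> psum c z n = RtoC 0.
Proof. intros H. apply csum_zero. intros k Hk. rewrite H by auto. ring. Qed.

Lemma coef_1 rho f r l : hol0 rho f -> 0 < r < rho -> cder f (RtoC 0) l -> coef f r 1 = l.
Proof.
  intros Hf Hr Hl. pose proof (coef_0 rho f r Hf Hr (cder_ccont _ _ _ Hl)) as H0.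
  apply (ctends_unique (cnear' (RtoC 0)) (fun z => (f z - coef f r 0) / z)%C).
  - destruct (jet_divz _ _ _ (jet_hol0 rho f r 2 Hf Hr)) as (K & d & Hd & H).
    apply (ctends_linear_0 _ _ K d Hd). intros z Hz. specialize (H z Hz).
    unfold psum in H. simpl in H. rewrite Rmult_1_r in H.
    now replace (RtoC 0 + coef f r 1 * RtoC 1)%C with (coef f r 1) in H by ring.
  - apply (ctends_ext _ (fun z => (f z - f (RtoC 0)) / (z - RtoC 0))%C); [|exact Hl].
    apply (cnear'_0 1); [lra|]. intros z Hz. rewrite H0.
    now rewrite Cminus_0_r.
Qed.

(** The leading term of [z * f' z] is [(k + 1) * coef f r (S k) * z ^ S k], and it dominates the
    remainder [O(|z|^(k+2))] near [0]. *)
Lemma deriv_neq_0_near rho f f' r k : hol0 rho f -> 0 < r < rho ->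
  (forall z, 0 < Cmod z < rho -> cder f z (f' z)) ->
  (forall j, (j < S k)%nat -> coef f r j = RtoC 0) -> coef f r (S k) <> RtoC 0 ->
  exists d, 0 < d /\ forall z, 0 < Cmod z < d -> f' z <> RtoC 0.
Proof.
  intros Hf Hr Hf' H0 Hk.
  destruct (jet_deriv f f' (coef f r) rho (S (S k))) as (K & d & Hd & H); auto; [lra| |].
  { now apply (jet_hol0 rho). }
  set (A := Cmod (RtoC (INR (S k)) * coef f r (S k))%C).
  assert (HA : 0 < A).
  { apply Cmod_gt_0, Cmult_neq_0; auto. intros E. apply RtoC_inj in E. revert E. now apply not_0_INR. }
  pose proof (Rabs_pos K) as HK.
  exists (Rmin d (A / (Rabs K + 1))).
  split; [apply Rmin_glb_lt; auto; apply Rdiv_lt_0_compat; lra|]. intros z [Hz1 Hz2] E.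
  destruct (Rmin_Rgt_l _ _ _ Hz2) as [Hz3 Hz4].
  specialize (H z (conj Hz1 Hz3)). rewrite E in H.
  unfold psum in H. change (csum ?u (S (S k))) with (csum u (S k) + u (S k))%C in H.
  rewrite csum_zero in H by (intros j Hj; rewrite (H0 j) by lia; ring). cbv beta in H.
  replace (z * RtoC 0 - (RtoC 0 + RtoC (INR (S k)) * coef f r (S k) * z ^ S k))%C with
    (- ((RtoC (INR (S k)) * coef f r (S k)) * z ^ S k))%C in H by ring.
  rewrite Cmod_opp, Cmod_mult, Cmod_pow in H. fold A in H.
  rewrite <- (tech_pow_Rmult (Cmod z) (S k)), <- Rmult_assoc in H.
  apply Rmult_le_reg_r in H; [|now apply pow_lt].
  apply (Rmult_lt_compat_r (Rabs K + 1)) in Hz4; [|lra].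
  unfold Rdiv in Hz4. rewrite Rmult_assoc, Rinv_l, Rmult_1_r in Hz4 by lra.
  pose proof (Rle_abs K). nra.
Qed.

Lemma cder_translate f w h l : cder f (w + h)%C l -> cder (fun x => f (w + x)%C) h l.
Proof.
  intros H. eapply cder_eq.
  - apply (cder_comp f (fun x => w + x)%C); [|exact H].
    apply cder_plus; [apply cder_const|apply cder_id].
  - ring.
Qed.

Lemma cder_choice (f : C -> C) : exists f', forall z, cdiff f z -> cder f z (f' z).
Proof.
  exists (fun z => match excluded_middle_informative (cdiff f z) with
    | left H => proj1_sig (constructive_indefinite_description _ H) | right _ => RtoC 0 end).
  intros z Hz. destruct (excluded_middle_informative (cdiff f z)) as [H|H]; [apply proj2_sig|easy].
Qed.

(* If [f'(w) = 0], the local inverse is continuous, and holomorphic off the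
   point [f w], hence Lipschitz there; this contradicts [f - f w = o(h)]. *)
Lemma univalent_cder_neq_0 f w l : univalent_on_disc f -> Cmod w < 1 -> cder f w l -> l <> RtoC 0.
Proof.
  intros Hu Hw Hl El. subst l. pose proof Hu as [Hf Hinj].
  set (rho := 1 - Cmod w). assert (Hrho : 0 < rho) by (unfold rho; lra).
  assert (Hdisc : forall h, Cmod h < rho -> Cmod (w + h)%C < 1).
  { intros h Hh. unfold rho in Hh. pose proof (Cmod_triangle w h). lra. }
  destruct (cder_choice f) as [f' Hf'].
  set (F := fun h => (f (w + h) - f w)%C).
  assert (HF0 : F (RtoC 0) = RtoC 0) by (unfold F; replace (w + RtoC 0)%C with w by ring; ring).
  assert (HF : forall h l, cder f (w + h)%C l -> cder F h l).
  { intros h l H. eapply cder_eq; [apply cder_minus; [apply cder_translate, H|apply cder_const]|]. ring. }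
  assert (HFd : forall h, Cmod h < rho -> cdiff F h).
  { intros h Hh. eexists. now apply HF, Hf', Hf, Hdisc. }
  assert (HFh : hol0 rho F) by (now apply hol0_of_cdiff).
  set (r := rho / 2). assert (Hr : 0 < r < rho) by (unfold r; lra).
  assert (Hc0 : coef F r 0 = RtoC 0).
  { rewrite (coef_0 rho); auto. apply cdiff_ccont, HFd. rewrite Cmod_0. lra. }
  assert (Hc1 : coef F r 1 = RtoC 0).
  { apply (coef_1 rho); auto. apply HF. now replace (w + RtoC 0)%C with w by ring. }
  (* If all coefficients vanished, [F] would vanish at [r / 2], and [f] would take the value [f w]
     twice. *)
  assert (Hex : exists k, coef F r k <> RtoC 0).
  { apply not_all_ex_not. intros H0.
    assert (E : F (RtoC (r / 2)) = RtoC 0).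
    { assert (Em : Cmod (RtoC (r / 2)) = r / 2) by (rewrite Cmod_R, Rabs_pos_eq; lra).
      apply (ctends_unique eventually (psum (coef F r) (RtoC (r / 2)))).
      - apply (taylor_converges rho); auto; lra.
      - apply (ctends_ext _ (fun _ => RtoC 0)); [|apply ctends_const, _].
        apply filter_forall. intros n. symmetry. now apply psum_zero. }
    apply Cminus_eq_0, Hinj in E; auto.
    - assert (E' : RtoC (r / 2) = RtoC 0).
      { replace (RtoC (r / 2)) with ((w + RtoC (r / 2)) - w)%C by ring. rewrite E. ring. }
      apply RtoC_inj in E'. lra.
    - apply Hdisc. rewrite Cmod_R, Rabs_pos_eq; lra. }
  destruct (dec_inh_nat_subset_has_unique_least_element (fun k => coef F r k <> RtoC 0))
    as (k & [Hk Hmin] & _); auto.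
  { intros n. apply classic. }
  destruct k as [|[|k]]; [easy|easy|].
  destruct (deriv_neq_0_near rho F (fun h => f' (w + h)%C) r (S k)) as (d & Hd & Hnz); auto.
  { intros z Hz. apply HF, Hf', Hf, Hdisc. lra. }
  { intros j Hj. apply NNPP. intros Hn. specialize (Hmin j Hn). lia. }
  destruct (univalent_open f w d Hu Hw Hd) as (del & Hdel & Hopen).
  (* [H] inverts [f] near [w], with [v] measured from [f w]; for [|v| >= del] its values are
     arbitrary. *)
  destruct (choice (fun v x => Cmod v < del -> Cmod x < 1 /\ Cmod (x - w)%C < d /\ f x = (v + f w)%C)) as [H HH].
  { intros v. destruct (Rlt_dec (Cmod v) del) as [L|L]; [|now exists v].
    destruct (Hopen (v + f w)%C) as (x & Hx); [now replace (v + f w - f w)%C with v by ring|].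
    now exists x. }
  assert (HHd : hol0 del (fun v => H v - w)%C).
  { split.
    - intros v Hv. apply cdiff_minus; [|apply cdiff_const].
      destruct (HH v (proj2 Hv)) as (K1 & K2 & K3).
      assert (Hne : H v <> w).
      { intros E. rewrite E in K3. assert (v = RtoC 0) by (replace v with ((v + f w) - f w)%C by ring; rewrite <- K3; ring).
        subst v. rewrite Cmod_0 in Hv. lra. }
      eexists. apply (cder_inverse f H (fun x => x + f w)%C v (f' (H v)) (RtoC 1 + RtoC 0)%C); auto.
      + exists (del - Cmod v). split; [lra|]. intros y Hy.
        pose proof (Cmod_triangle_rev y v). destruct (HH y) as (J1 & J2 & J3); [lra|]. auto.
      + apply cder_plus; [apply cder_id|apply cder_const].
      + specialize (Hnz (H v - w)%C). replace (w + (H v - w))%C with (H v) in Hnz by ring.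
        apply Hnz. split; auto. apply Cmod_gt_0. now apply Cminus_neq_0.
    - exists d, del. split; auto. intros v Hv. destruct (HH v (proj2 Hv)) as (K1 & K2 & K3). lra. }
  set (r' := del / 2). assert (Hr' : 0 < r' < del) by (unfold r'; lra).
  assert (Htend : ctends (cnear' (RtoC 0)) (fun v => H v - w)%C (RtoC 0)).
  { intros eps He. destruct (univalent_open f w eps Hu Hw He) as (e & He0 & Ho).
    apply (cnear'_0 (Rmin e del)); [now apply Rmin_glb_lt|]. intros v [Hv1 Hv2].
    destruct (Rmin_Rgt_l _ _ _ Hv2) as [Hv3 Hv4]. destruct (HH v Hv4) as (K1 & K2 & K3).
    destruct (Ho (v + f w)%C) as (x & X1 & X2 & X3); [now replace (v + f w - f w)%C with v by ring|].
    rewrite <- X3 in K3. apply Hinj in K3; auto. rewrite K3. now rewrite Cminus_0_r. }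
  assert (HHc : coef (fun v => H v - w)%C r' 0 = RtoC 0).
  { eapply ctends_unique; [apply _|now apply (hol0_tends del)|exact Htend]. }
  destruct (jet_hol0 del _ r' 1 HHd Hr') as (K & d1 & Hd1 & J).
  pose proof (Rabs_pos K) as HK. pose proof (Rle_abs K) as HK'.
  assert (Hl0 : cder F (RtoC 0) (RtoC 0)) by (apply HF; now replace (w + RtoC 0)%C with w by ring).
  (* The jet of order 1 of [H - w] gives [|H v - w| <= K * |v|], while a zero derivative of [F]
     gives [|v| < |H v - w| / (|K| + 1)]; a small [v] satisfying both is a contradiction. *)
  destruct (Hl0 (/ (Rabs K + 1))) as (d2 & Hd2 & J2); [apply Rinv_0_lt_compat; lra|].
  assert (Hnear : cnear' (RtoC 0) (fun v => 0 < Cmod v < Rmin d1 del)).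
  { apply (cnear'_0 (Rmin d1 del)); auto. now apply Rmin_glb_lt. }
  destruct (filter_ex _ (filter_and _ _ (Htend d2 Hd2) Hnear)) as (v & Hv & Hv1 & Hv2).
  destruct (Rmin_Rgt_l _ _ _ Hv2) as [Hv3 Hv4]. destruct (HH v Hv4) as (V1 & V2 & V3).
  specialize (J v (conj Hv1 Hv3)). unfold psum in J. simpl in J. rewrite HHc in J.
  replace (H v - w - (RtoC 0 + RtoC 0 * RtoC 1))%C with (H v - w)%C in J by ring.
  set (h := (H v - w)%C) in *.
  assert (EF : F h = v).
  { unfold F, h. replace (w + (H v - w))%C with (H v) by ring. rewrite V3. ring. }
  assert (Hh0 : h <> RtoC 0).
  { intros E. rewrite E, HF0 in EF. rewrite <- EF, Cmod_0 in Hv1. lra. }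
  specialize (J2 h Hh0 Hv). rewrite EF, HF0, !Cminus_0_r, Cmod_div in J2 by auto.
  apply Rlt_div_l in J2; [|now apply Cmod_gt_0].
  assert (/ (Rabs K + 1) * (Rabs K + 1) = 1) by (apply Rinv_l; lra).
  assert (0 < / (Rabs K + 1)) by (apply Rinv_0_lt_compat; lra).
  assert (/ (Rabs K + 1) * Cmod h <= / (Rabs K + 1) * ((Rabs K + 1) * Cmod v)).
  { apply Rmult_le_compat_l; [lra|]. nra. }
  rewrite <- Rmult_assoc in H2. nra.
Qed.

(** * Schwarz's lemma and Carathéodory's inequality *)

Lemma hol0_pow n rho f : hol0 rho f -> hol0 rho (fun z => f z ^ n)%C.
Proof.
  intros [Hf (B & d & Hd & HB)]. split.
  - intros z Hz. apply cdiff_pow; auto.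
  - exists (B ^ n), d. split; auto. intros z Hz. rewrite Cmod_pow. apply pow_incr.
    split; [apply Cmod_ge_0|auto].
Qed.

(* Apply the crude bound [B / (1 - |z|/r)] to the powers of [f]. *)
Lemma maximum_modulus rho f r B z : hol0 rho f -> 0 < Cmod z < r -> r < rho -> circle_bound f r B ->
  Cmod (f z) <= B.
Proof.
  intros Hf Hz Hr HB. apply Rnot_lt_le. intros Hlt.
  assert (HB0 : 0 <= B) by (eapply Rle_trans; [apply Cmod_ge_0|apply (HB 0); lra]).
  set (t := B / Cmod (f z)).
  assert (Ht : 0 <= t < 1).
  { split; [apply Rdiv_le_0_compat; lra|]. apply Rlt_div_l; lra. }
  assert (Hx : Cmod z / r < 1) by (apply Rlt_div_l; lra).
  (* The bound for [f ^ n] at [z] reads [1 - |z| / r <= t ^ n] with [t = B / |f z| < 1], which fails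
     for large [n]. *)
  destruct (ctends_pow_0 t 1) with (eps := 1 - Cmod z / r) as [n Hn]; auto; [lra|].
  specialize (Hn n (Nat.le_refl n)).
  assert (HBn : circle_bound (fun z => f z ^ n)%C r (B ^ n)).
  { intros s Hs. rewrite Cmod_pow. apply pow_incr. split; [apply Cmod_ge_0|now apply HB]. }
  pose proof (taylor_tail rho _ z r _ 0 (hol0_pow n rho f Hf) Hz Hr HBn) as K.
  unfold psum in K. simpl in K. replace (f z ^ n - RtoC 0)%C with (f z ^ n)%C in K by ring.
  rewrite Rmult_1_r, Cmod_pow in K. apply Rle_div_r in K; [|lra].
  assert (Hp : 0 < Cmod (f z) ^ n) by (apply pow_lt; lra).
  assert (E : B ^ n = t ^ n * Cmod (f z) ^ n).
  { rewrite <- Rpow_mult_distr. f_equal. unfold t. field. lra. }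
  rewrite E in K. nra.
Qed.

Lemma hol0_divz rho phi : 0 < rho -> (forall z, Cmod z < rho -> cdiff phi z) -> phi (RtoC 0) = RtoC 0 ->
  hol0 rho (fun z => phi z / z)%C.
Proof.
  intros Hr Hphi H0. split.
  - intros z Hz. apply cdiff_div; [apply Hphi; lra|apply cdiff_id|apply Cmod_pos_nz; lra].
  - destruct (Hphi (RtoC 0)) as [l Hl]; [rewrite Cmod_0; lra|].
    destruct (ctends_bounded _ _ _ Hl) as (d & Hd & H). exists (Cmod l + 1), d. split; auto.
    intros z Hz. assert (Hz0 : z <> RtoC 0) by (apply Cmod_pos_nz; lra).
    replace (phi z / z)%C with ((phi z - phi (RtoC 0)) / (z - RtoC 0))%C.
    + apply H; auto. rewrite Cminus_0_r. lra.
    + rewrite H0. rewrite Cminus_0_r. now field.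
Qed.

Lemma schwarz phi : (forall z, Cmod z < 1 -> cdiff phi z) -> (forall z, Cmod z < 1 -> Cmod (phi z) < 1) ->
  phi (RtoC 0) = RtoC 0 -> forall z, 0 < Cmod z < 1 -> Cmod (phi z / z)%C <= 1.
Proof.
  intros Hphi Hb H0 z Hz. pose proof (hol0_divz 1 phi Rlt_0_1 Hphi H0) as Hh.
  apply Rnot_lt_le. intros Hlt. set (m := Cmod (phi z / z)%C) in *.
  assert (Hm : / m < 1) by (rewrite <- Rinv_1; apply Rinv_lt_contravar; lra).
  (* A radius below 1 and beyond both [/ m] and [|z|]: on it [phi z / z] is at most [/ r], and the
     maximum principle gives [m <= / r < m]. *)
  set (r := (Rmax (/ m) (Cmod z) + 1) / 2).
  assert (Hr : / m < r /\ Cmod z < r < 1).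
  { pose proof (Rmax_l (/ m) (Cmod z)). pose proof (Rmax_r (/ m) (Cmod z)).
    pose proof (Rmax_lub_lt _ _ _ Hm (proj2 Hz)). unfold r. lra. }
  assert (K : m <= / r).
  { apply (maximum_modulus 1 (fun z => phi z / z)%C r); auto; try lra.
    intros s _. pose proof (Cmod_circle r s ltac:(lra)) as E. set (w := (RtoC r * ucirc s)%C) in *.
    rewrite Cmod_div, E by (apply Cmod_pos_nz; lra). unfold Rdiv.
    rewrite <- (Rmult_1_l (/ r)) at 2. apply Rmult_le_compat_r.
    - apply Rlt_le, Rinv_0_lt_compat. lra.
    - apply Rlt_le, Hb. lra. }
  assert (0 < r) by lra.
  apply (Rmult_le_compat_r r) in K; [|lra]. rewrite Rinv_l in K by lra.
  assert (m * / m < m * r) by (apply Rmult_lt_compat_l; lra). rewrite Rinv_r in H1 by lra. lra.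
Qed.

Lemma schwarz_le phi : (forall z, Cmod z < 1 -> cdiff phi z) -> (forall z, Cmod z < 1 -> Cmod (phi z) < 1) ->
  phi (RtoC 0) = RtoC 0 -> forall z, Cmod z < 1 -> Cmod (phi z) <= Cmod z.
Proof.
  intros Hphi Hb H0 z Hz. destruct (Req_dec (Cmod z) 0) as [E|E].
  - apply Cmod_eq_0 in E. subst. rewrite H0. lra.
  - pose proof (Cmod_ge_0 z).
    pose proof (schwarz phi Hphi Hb H0 z ltac:(lra)) as K.
    rewrite Cmod_div in K by (apply Cmod_pos_nz; lra). apply Rle_div_l in K; lra.
Qed.

Lemma CInt_conj g : icont g -> CInt (fun s => Cconj (g s)) = Cconj (CInt g).
Proof.
  intros Hg. unfold CInt, Cconj; simpl. f_equal.
  rewrite <- (RInt_opp (V := R_CompleteNormedModule)); [reflexivity|]. now apply ex_RInt_icont_Im.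
Qed.

Lemma icont_conj g : icont g -> icont (fun s => Cconj (g s)).
Proof.
  intros Hg s Hs eps He. generalize (Hg s Hs eps He). apply filter_imp. intros x Hx.
  replace (Cconj (g x) - Cconj (g s))%C with (Cconj (g x - g s)%C); [now rewrite Cmod_conj|].
  unfold Cconj, Cminus, Cplus, Copp; simpl. f_equal. ring.
Qed.

Lemma Cconj_circle r s : r <> 0 -> Cconj (RtoC r * ucirc s)%C = (RtoC (r * r) / (RtoC r * ucirc s))%C.
Proof.
  intros Hr. assert (Hr' : RtoC r <> RtoC 0) by (intros K; now apply Hr, RtoC_inj).
  assert (E : (ucirc s * Cconj (ucirc s))%C = RtoC 1).
  { rewrite <- Cmod2_conj, Cmod_ucirc, pow1. reflexivity. }
  assert (Hu : ucirc s <> RtoC 0) by apply Cexp_neq_0.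
  rewrite Cmult_conj. replace (Cconj (RtoC r)) with (RtoC r).
  - replace (Cconj (ucirc s)) with (/ ucirc s)%C.
    + rewrite RtoC_mult. now field.
    + transitivity (/ ucirc s * (ucirc s * Cconj (ucirc s)))%C; [rewrite E; ring|now field].
  - unfold Cconj, RtoC; simpl. now rewrite Ropp_0.
Qed.

Lemma Re_CInt g : Re (CInt g) = RInt (fun s => Re (g s)) 0 1.
Proof. reflexivity. Qed.

(* On [|z| = r] one has [conj z = r^2 / z], so the vanishing of the mean of
   [q z^k] lets one replace [q] by [q + conj q = 2 Re q] in the [k]th coefficient. *)
Lemma caratheodory rho q r k : hol0 rho q -> 0 < r < rho ->
  (forall z, 0 < Cmod z < rho -> 0 <= Re (q z)) ->
  Cmod (coef q r (S k)) <= 2 * Re (coef q r 0) / r ^ S k.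
Proof.
  intros Hq Hr Hpos. pose proof Hq as [Hqd (B & d & Hd & HB)].
  assert (Hnz : forall s, (RtoC r * ucirc s)%C <> RtoC 0).
  { intros s. apply Cmod_pos_nz. rewrite Cmod_circle; lra. }
  assert (Hrk : RtoC r <> RtoC 0) by (intros K; apply RtoC_inj in K; lra).
  assert (Z0 : cmean (fun z => q z * z ^ S k)%C r = RtoC 0).
  { assert (Hc : forall z, 0 < Cmod z <= r -> cdiff (fun z => q z * z ^ S k)%C z).
    { intros z Hz. apply cdiff_mult; [apply Hqd; lra|apply cdiff_zpow]. }
    apply (cmean_zero _ (r / 2)); [lra| | |].
    - intros z Hz. now apply cdiff_ccont, Hc.
    - intros z Hz _. now apply Hc.
    - exists B, (Rmin d 1). split; [apply Rmin_glb_lt; lra|]. intros z [Hz1 Hz2].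
      destruct (Rmin_Rgt_l _ _ _ Hz2) as [Hz3 Hz4].
      rewrite Cmod_mult, Cmod_pow. apply Rmult_le_compat; auto; try apply Cmod_ge_0.
      + apply pow_le. lra.
      + simpl. pose proof (pow_incr (Cmod z) 1 k ltac:(lra)). rewrite pow1 in H. nra. }
  assert (Hqc : forall z, Cmod z = r -> ccont q z) by (intros z Hz; apply cdiff_ccont, Hqd; lra).
  assert (J0 : icont (fun s => q (RtoC r * ucirc s)%C)) by (apply icont_circle; [lra|auto]).
  assert (J1 : icont (fun s => q (RtoC r * ucirc s) / (RtoC r * ucirc s) ^ S k)%C).
  { apply icont_coef; [lra|auto]. }
  assert (Hcirc : icont (fun s => RtoC r * ucirc s)%C).
  { intros s _. apply pcont_mult; [apply pcont_const|apply pcont_ucirc]. }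
  assert (J2 : icont (fun s => q (RtoC r * ucirc s) * (RtoC r * ucirc s) ^ S k)%C).
  { apply (icont_circle (fun z => q z * z ^ S k)%C); [lra|]. intros z Hz.
    apply cdiff_ccont, cdiff_mult; [apply Hqd; lra|apply cdiff_zpow]. }
  set (R2 := RtoC (r * r)).
  assert (HR2 : R2 <> RtoC 0).
  { unfold R2. rewrite RtoC_mult. now apply Cmult_neq_0. }
  assert (HR2k : (R2 ^ S k)%C <> RtoC 0) by (now apply Cpow_nz).
  (* On the circle this integrand equals [Cconj q / z ^ S k], so it may be added to the formula for
     the coefficient. *)
  assert (Z1 : CInt (fun s => / R2 ^ S k * Cconj (q (RtoC r * ucirc s) * (RtoC r * ucirc s) ^ S k))%C = RtoC 0).
  { rewrite CInt_scal by (now apply icont_conj). rewrite CInt_conj by auto.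
    unfold cmean in Z0. rewrite Z0. replace (Cconj (RtoC 0)) with (RtoC 0); [ring|].
    unfold Cconj, RtoC; simpl. now rewrite Ropp_0. }
  assert (E : coef q r (S k) = CInt (fun s => RtoC (2 * Re (q (RtoC r * ucirc s)%C)) / (RtoC r * ucirc s) ^ S k)%C).
  { rewrite <- (Cplus_0_r (coef q r (S k))), <- Z1. unfold coef, cmean. rewrite <- CInt_plus; auto.
    - apply CInt_ext. intros s _. specialize (Hnz s). rewrite Cmult_conj, Cpow_conj, Cconj_circle by lra.
      set (z := (RtoC r * ucirc s)%C) in *.
      assert (Hzk : (z ^ S k)%C <> RtoC 0) by (now apply Cpow_nz).
      fold R2. unfold Cdiv at 2. rewrite Cpow_mult_l, Cpow_inv by auto.
      rewrite RtoC_mult, re_alt. field. split; auto.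
    - apply icont_mult; [apply icont_const|]. now apply icont_conj. }
  assert (Hexq : ex_RInt (fun s => Re (q (RtoC r * ucirc s)%C)) 0 1) by (now apply (ex_RInt_icont_Re (fun s => q (RtoC r * ucirc s)%C))).
  rewrite E. eapply Rle_trans.
  - apply (Cmod_CInt_le_RInt _ (fun s => scal (2 / r ^ S k) (Re (q (RtoC r * ucirc s)%C)))).
    + apply (icont_mult (fun s => RtoC (2 * Re (q (RtoC r * ucirc s)%C)))).
      * intros s Hs. apply pcont_RtoC. apply (continuous_scal_r 2 (fun s => Re (q (RtoC r * ucirc s)%C))).
        apply (pcont_Re (fun s => q (RtoC r * ucirc s)%C)), J0, Hs.
      * apply (icont_circle (fun z => / z ^ S k)%C); [lra|]. intros z Hz.
        apply ctends_inv; [apply _|apply Cpow_nz, Cmod_pos_nz; lra|apply cdiff_ccont, cdiff_zpow].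
    + intros s _. pose proof (Cmod_circle r s ltac:(lra)) as Es.
      rewrite Cmod_div, Cmod_pow, Es, Cmod_R by (apply Cpow_nz; auto).
      rewrite Rabs_pos_eq; [|specialize (Hpos (RtoC r * ucirc s)%C ltac:(lra)); lra].
      right. unfold scal; simpl; unfold mult; simpl. field.
      split; [apply pow_nonzero; lra|lra].
    + now apply (ex_RInt_scal (V := R_CompleteNormedModule)).
  - rewrite (RInt_scal (V := R_CompleteNormedModule)) by auto.
    right. unfold coef, cmean. rewrite Re_CInt. unfold scal; simpl; unfold mult; simpl.
    rewrite (RInt_ext (fun s => fst (q (RtoC r * ucirc s) / RtoC 1)%C) (fun s => Re (q (RtoC r * ucirc s)%C))).
    + field. split; [apply pow_nonzero; lra|lra].
    + intros s _. unfold Re. f_equal. field.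
Qed.

(** Let [m = |1 - c|]. On the circle of radius [1/2], [q] has constant coefficient [1 - c], and by
    [caratheodory] the later ones are at most [2 * m * 2^k]. For [|z| <= 1/4] the tail from index 1
    is at most [2 * m]; with the constant term this makes [3 * m]. *)
Lemma near_identity phi c : (forall z, Cmod z < 1 -> cdiff phi z) -> (forall z, Cmod z < 1 -> Cmod (phi z) < 1) ->
  phi (RtoC 0) = RtoC 0 -> cder phi (RtoC 0) c ->
  forall z, Cmod z <= / 4 -> Cmod (phi z - z)%C <= 3 * Cmod (RtoC 1 - c)%C * Cmod z.
Proof.
  intros Hphi Hb H0 Hc z Hz. destruct (classic (z = RtoC 0)) as [->|n].
  { rewrite H0. replace (RtoC 0 - RtoC 0)%C with (RtoC 0) by ring. rewrite Cmod_0. lra. }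
  assert (Hz0 : 0 < Cmod z) by (now apply Cmod_gt_0).
  set (psi := fun z => (phi z / z)%C). set (q := fun z => (RtoC 1 - psi z)%C).
  pose proof (hol0_divz 1 phi Rlt_0_1 Hphi H0) as Hpsi. fold psi in Hpsi.
  assert (Hq : hol0 1 q).
  { destruct Hpsi as [P1 (B & d & Hd & HB)]. split.
    - intros w Hw. apply cdiff_minus; [apply cdiff_const|auto].
    - exists (1 + B), d. split; auto. intros w Hw. eapply Rle_trans; [apply Cmod_triangle_minus|].
      rewrite Cmod_1. apply Rplus_le_compat_l. auto. }
  assert (Hq0 : coef q (/ 2) 0 = (RtoC 1 - c)%C).
  { eapply ctends_unique; [apply _|apply (hol0_tends 1); auto; lra|].
    apply ctends_minus; [apply _|apply ctends_const, _|].
    apply (ctends_ext _ (fun z => (phi z - phi (RtoC 0)) / (z - RtoC 0))%C); [|exact Hc].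
    apply (cnear'_0 1); [lra|]. intros w Hw. unfold psi. rewrite H0.
    rewrite Cminus_0_r. field. apply Cmod_pos_nz; lra. }
  assert (Hpos : forall w, 0 < Cmod w < 1 -> 0 <= Re (q w)).
  { intros w Hw. pose proof (schwarz phi Hphi Hb H0 w Hw) as K. fold (psi w) in K.
    pose proof (re_le_Cmod (psi w)) as K2. pose proof (Rle_abs (Re (psi w))).
    change (Re (q w)) with (1 + - Re (psi w)). lra. }
  assert (Hre : Re (coef q (/ 2) 0) <= Cmod (RtoC 1 - c)%C).
  { rewrite Hq0. eapply Rle_trans; [apply Rle_abs|apply re_le_Cmod]. }
  set (m := Cmod (RtoC 1 - c)%C) in *. assert (Hm : 0 <= m) by apply Cmod_ge_0.
  assert (T : Cmod (q z - psum (coef q (/ 2)) z 1)%C <= 2 * m * (Cmod z / / 2) ^ 1 / (1 - Cmod z / / 2)).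
  { apply psum_tail; try lra.
    - intros k Hk. destruct k as [|k]; [lia|].
      eapply Rle_trans; [apply (caratheodory 1); auto; lra|].
      apply Rmult_le_compat_r; [|lra]. apply Rlt_le, Rinv_0_lt_compat, pow_lt. lra.
    - apply (taylor_converges 1); auto; lra. }
  assert (T2 : 2 * m * (Cmod z / / 2) ^ 1 / (1 - Cmod z / / 2) <= 2 * m).
  { replace (Cmod z / / 2) with (2 * Cmod z) by field. rewrite pow_1. apply Rle_div_l; [lra|]. nra. }
  assert (Hqz : Cmod (q z) <= 3 * m).
  { unfold psum in T. simpl in T. rewrite Hq0 in T.
    replace (q z - (RtoC 0 + (RtoC 1 - c) * RtoC 1))%C with (q z - (RtoC 1 - c))%C in T by ring.
    pose proof (Cmod_triangle_rev (q z) (RtoC 1 - c)%C). fold m in H. simpl in T2. lra. }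
  replace (phi z - z)%C with (- (q z * z))%C by (unfold q, psi; now field).
  rewrite Cmod_opp, Cmod_mult. apply Rmult_le_compat_r; lra.
Qed.

(** * Regularity of Loewner chains in time *)

Lemma is_derive_cder (f : C -> C) z l :
  @is_derive C_AbsRing C_NormedModule f z l -> cder f z l.
Proof.
  intros [_ H] eps He. specialize (H z (fun P HP => HP)).
  assert (He2 : 0 < eps / 2) by lra. destruct (H (mkposreal _ He2)) as [d Hd].
  exists d. split; [apply cond_pos|]. intros w Hw Hlt. specialize (Hd w Hlt). simpl in Hd.
  assert (Hd' : Cmod ((f w - f z) - (w - z) * l)%C <= eps / 2 * Cmod (w - z)%C) by exact Hd.
  assert (Hp : 0 < Cmod (w - z)%C) by (apply Cmod_gt_0; now apply Cminus_neq_0).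
  assert (Hn : (w - z)%C <> RtoC 0) by (now apply Cminus_neq_0).
  replace ((f w - f z) / (w - z) - l)%C with ((f w - f z - (w - z) * l) / (w - z))%C by (now field).
  rewrite Cmod_div by auto. apply (Rle_lt_trans _ (eps / 2)); [|lra].
  now apply Rle_div_l.
Qed.

Lemma holomorphic_cdiff f z : holomorphic_on_disc f -> Cmod z < 1 -> cdiff f z.
Proof. intros H Hz. destruct (H z Hz) as [l Hl]. exists l. now apply is_derive_cder. Qed.

Lemma holomorphic_C_derive f z : holomorphic_on_disc f -> Cmod z < 1 -> cder f z (C_derive f z).
Proof.
  intros H Hz. apply is_derive_cder. apply C_derive_correct; [exact (RtoC 0)|]. now apply H.
Qed.

Lemma univalent_univalent_on_disc f : univalent f -> univalent_on_disc f.
Proof.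
  intros [H1 H2]. split; [intros z Hz; now apply holomorphic_cdiff|exact H2].
Qed.

Lemma Cexp_opp z : Cexp (- z)%C = (/ Cexp z)%C.
Proof.
  pose proof (Cexp_neq_0 z) as Hz.
  assert (E : (Cexp (- z) * Cexp z)%C = RtoC 1).
  { rewrite <- Cexp_plus, <- Cexp_0. f_equal. ring. }
  transitivity (Cexp (- z) * Cexp z * / Cexp z)%C; [now field|]. rewrite E. ring.
Qed.

Lemma Cmod_Cexp_le z : Cmod (Cexp z) <= exp (Cmod z).
Proof.
  rewrite Cmod_Cexp. apply exp_le_compat.
  eapply Rle_trans; [apply Rle_abs|apply re_le_Cmod].
Qed.

Lemma Cexp_lipschitz_0 rho : 0 <= rho ->
  exists K, 0 <= K /\ forall z, Cmod z <= rho -> Cmod (RtoC 1 - Cexp z)%C <= K * Cmod z.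
Proof.
  (* Ensures [rho <= r / 4], the range in which [difference_quotient_bound] applies. *)
  intros Hrho. pose (r := 4 * rho + 1). pose proof (exp_pos r). assert (Hr : 0 < r) by (unfold r; lra).
  assert (Hm0 : forall w, (w - RtoC 0)%C = w) by (intros w; ring).
  exists (8 * exp r / r). split; [apply Rdiv_le_0_compat; lra|].
  intros z Hz. rewrite <- Cexp_0, Cmod_minus_sym.
  rewrite <- (Hm0 z) at 2. apply difference_quotient_bound; try rewrite Hm0; auto; try (unfold r; lra).
  - intros w _. eexists. apply cder_Cexp.
  - intros w Hw. rewrite Hm0 in Hw. eapply Rle_trans; [apply Cmod_Cexp_le|].
    apply exp_le_compat. lra.
Qed.

(** [phi] is the inverse of [f s] after [f t]: it exists by inclusion of the images, fixes [0] by
    injectivity of [f s], and is holomorphic by [cder_inverse]. Its derivative at [0] is the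
    quotient of [exp (alpha t)] by [exp (alpha s)]. *)
Lemma loewner_transition a f alpha t s : loewner_chain a f ->
  (forall t, a <= t -> C_derive (f t) (RtoC 0) = Cexp (alpha * RtoC t)%C) -> a <= t -> t <= s ->
  exists phi, (forall z, Cmod z < 1 -> cdiff phi z) /\
    (forall z, Cmod z < 1 -> Cmod (phi z) < 1 /\ f s (phi z) = f t z) /\ phi (RtoC 0) = RtoC 0 /\
    cder phi (RtoC 0) (Cexp (- (alpha * RtoC (s - t)))%C).
Proof.
  intros (Hu & H0 & _ & Hsub) Halpha Hat Hts.
  assert (Has : a <= s) by lra.
  pose proof (univalent_univalent_on_disc _ (Hu s Has)) as Us.
  pose proof (univalent_univalent_on_disc _ (Hu t Hat)) as Ut.
  assert (Z1 : Cmod (RtoC 0) < 1) by (rewrite Cmod_0; lra).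
  destruct (choice (fun z w => Cmod z < 1 -> Cmod w < 1 /\ f s w = f t z)) as [phi Hphi].
  { intros z. destruct (Rlt_dec (Cmod z) 1) as [L|L]; [|now exists z].
    destruct (Hsub t s Hat Hts z L) as (w & Hw). now exists w. }
  assert (Hphi0 : phi (RtoC 0) = RtoC 0).
  { destruct (Hphi _ Z1) as [K1 K2]. destruct Us as [_ Hinj]. apply Hinj; auto.
    now rewrite K2, !H0. }
  assert (Hder : forall z l m, Cmod z < 1 -> cder (f t) z l -> cder (f s) (phi z) m -> cder phi z (l / m)%C).
  { intros z l m Hz Hl Hm. apply (cder_inverse (f s) phi (f t)); auto.
    - exists (1 - Cmod z). split; [lra|]. intros y Hy. apply Hphi.
      pose proof (Cmod_triangle_rev y z). lra.
    - now apply (univalent_cder_neq_0 (f s) (phi z)), Hm; [|apply Hphi]. }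
  exists phi. split; [|split; [|split]]; auto.
  - intros z Hz. destruct Us as [Us _]. destruct Ut as [Ut _].
    destruct (Ut z Hz) as [l Hl]. destruct (Us (phi z)) as [m Hm]; [now apply Hphi|].
    eexists. eapply Hder; eauto.
  - eapply cder_eq; [eapply Hder; auto|].
    + apply holomorphic_C_derive; auto. apply Hu. auto.
    + rewrite Hphi0. apply holomorphic_C_derive; auto. apply Hu. auto.
    + rewrite !Halpha by auto. unfold Cdiv. rewrite <- Cexp_opp, <- Cexp_plus. f_equal.
      rewrite RtoC_minus. ring.
Qed.

(** By Schwarz's lemma the transition map keeps [|z| <= 1/2] invariant, so a bound for [f T] alone
    serves at all earlier times. *)
Lemma loewner_bounded a f T : loewner_chain a f -> a <= T ->
  exists M, 0 <= M /\ forall t z, a <= t <= T -> Cmod z <= / 2 -> Cmod (f t z) <= M.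
Proof.
  intros Hc HT. pose proof Hc as (Hu & H0 & [alpha Ha] & _).
  pose proof (univalent_univalent_on_disc _ (Hu T HT)) as [UT _].
  assert (Hh : hol0 1 (f T)) by (apply hol0_of_cdiff; auto; lra).
  destruct (circle_bound_exists (f T) (3 / 4)) as (B & HB0 & HB); [lra| |].
  { intros z Hz. apply cdiff_ccont, UT. lra. }
  exists B. split; auto. intros t z Ht Hz.
  destruct (loewner_transition a f alpha t T Hc Ha) as (phi & P1 & P2 & P3 & _); [lra|lra|].
  destruct (P2 z) as [Q1 Q2]; [lra|]. rewrite <- Q2.
  destruct (classic (phi z = RtoC 0)) as [E|E].
  - rewrite E, H0, Cmod_0; auto.
  - apply (maximum_modulus 1 (f T) (3 / 4)); auto; [|lra]. split; [now apply Cmod_gt_0|].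
    pose proof (schwarz_le phi P1 (fun z Hz => proj1 (P2 z Hz)) P3 z ltac:(lra)). lra.
Qed.

(** For [t <= s] the difference is [f s (phi z) - f s z]: the Lipschitz constant of [f s] in space
    is uniform in [s] by [loewner_bounded], and [near_identity] bounds [|phi z - z|] by a multiple
    of [s - t]. *)
Lemma loewner_lipschitz a f T : loewner_chain a f -> a <= T ->
  exists K, 0 <= K /\ forall t s z, a <= t <= T -> a <= s <= T -> Cmod z <= / 32 ->
    Cmod (f t z - f s z)%C <= K * Rabs (t - s).
Proof.
  intros Hc HT. pose proof Hc as (Hu & H0 & [alpha Ha] & _).
  destruct (loewner_bounded a f T Hc HT) as (M & HM0 & HM).
  destruct (Cexp_lipschitz_0 (Cmod alpha * (T - a))) as (K & HK0 & HK).
  { pose proof (Cmod_ge_0 alpha). nra. }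
  pose proof (Cmod_ge_0 alpha) as Hal.
  set (L := 8 * M / (3 / 8) * (K * Cmod alpha)).
  assert (HL : 0 <= L) by (unfold L; assert (0 <= K * Cmod alpha) by nra; nra).
  assert (Hmain : forall t s z, a <= t -> t <= s -> s <= T -> Cmod z <= / 32 ->
    Cmod (f t z - f s z)%C <= L * (s - t)).
  { intros t s z Hat Hts HsT Hz.
    destruct (loewner_transition a f alpha t s Hc Ha Hat Hts) as (phi & P1 & P2 & P3 & P4).
    assert (P2' : forall z, Cmod z < 1 -> Cmod (phi z) < 1) by (intros w Hw; now apply P2).
    destruct (P2 z) as [Q1 Q2]; [lra|]. rewrite <- Q2.
    pose proof (near_identity phi _ P1 P2' P3 P4 z ltac:(lra)) as N.
    pose proof (schwarz_le phi P1 P2' P3 z ltac:(lra)) as S.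
    pose proof (Cmod_triangle_minus (phi z) z) as D.
    pose proof (univalent_univalent_on_disc _ (Hu s ltac:(lra))) as [Us _].
    assert (Hin : forall w, Cmod (w - z)%C < 3 / 8 -> Cmod w <= / 2).
    { intros w Hw. pose proof (Cmod_triangle_rev w z). lra. }
    (* The disc of radius [3/8] about [z] lies in [|w| <= 1/2], since [1/32 + 3/8 < 1/2], and
       [|phi z - z| <= 2/32] is below a quarter of [3/8]. *)
    eapply Rle_trans; [apply (difference_quotient_bound (f s) z (3 / 8) M); try lra|].
    - intros w Hw. apply Us. specialize (Hin w Hw). lra.
    - intros w Hw. apply HM; auto. lra.
    - unfold L. rewrite Rmult_assoc. apply Rmult_le_compat_l; [nra|].
      eapply Rle_trans; [exact N|].
      assert (E : Cmod (- (alpha * RtoC (s - t)))%C = Cmod alpha * (s - t)).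
      { rewrite Cmod_opp, Cmod_mult, Cmod_R, Rabs_pos_eq; lra. }
      pose proof (HK (- (alpha * RtoC (s - t)))%C) as HK'. rewrite E in HK'.
      assert (E2 : Cmod alpha * (s - t) <= Cmod alpha * (T - a)) by (apply Rmult_le_compat_l; lra).
      specialize (HK' E2). set (m := Cmod (RtoC 1 - Cexp (- (alpha * RtoC (s - t))))%C) in *.
      pose proof (Cmod_ge_0 (RtoC 1 - Cexp (- (alpha * RtoC (s - t))))%C) as Hm. fold m in Hm.
      pose proof (Cmod_ge_0 z). nra. }
  exists L. split; auto. intros t s z Ht Hs Hz. destruct (Rle_dec t s) as [Hl|Hl].
  - rewrite Rabs_minus_sym, Rabs_pos_eq by lra. apply Hmain; lra.
  - rewrite Cmod_minus_sym, Rabs_pos_eq by lra. apply Hmain; lra.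
Qed.

(** On [[a, T]] the linear term [exp (alpha t) * z] has modulus at least [e * r], and the quadratic
    remainder is at most [2 * M * (2 * r)^2], which [r <= e / (16 * (M + 1))] keeps below
    [e * r / 2]. *)
Lemma loewner_lower_bound a f T : loewner_chain a f -> a <= T ->
  exists r m, 0 < r <= / 32 /\ 0 < m /\
    forall t z, a <= t <= T -> Cmod z = r -> m <= Cmod (f t z).
Proof.
  intros Hc HT. pose proof Hc as (Hu & H0 & [alpha Ha] & _).
  destruct (loewner_bounded a f T Hc HT) as (M & HM0 & HM).
  set (S := Cmod alpha * (Rabs a + Rabs T)). set (e := exp (- S)). pose proof (exp_pos (- S)) as He. fold e in He.
  assert (Hq : 0 < e / (16 * (M + 1))) by (apply Rdiv_lt_0_compat; lra).
  set (r := Rmin (/ 32) (e / (16 * (M + 1)))).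
  assert (Hr : 0 < r) by (apply Rmin_glb_lt; lra).
  assert (Hr1 : r <= / 32) by apply Rmin_l.
  assert (Hr2 : r <= e / (16 * (M + 1))) by apply Rmin_r.
  exists r, (e * r / 2). split; [lra|]. split; [nra|].
  intros t z Ht Hz.
  pose proof (Hu t ltac:(lra)) as Hut.
  pose proof (univalent_univalent_on_disc _ Hut) as [Ut _].
  assert (Hh : hol0 1 (f t)) by (apply hol0_of_cdiff; auto; lra).
  assert (HB : circle_bound (f t) (/ 2) M).
  { intros s _. apply HM; auto. rewrite Cmod_circle; lra. }
  pose proof (taylor_tail_half 1 (f t) z (/ 2) M 2 Hh ltac:(lra) ltac:(lra) HB) as K.
  assert (D0 : cder (f t) (RtoC 0) (Cexp (alpha * RtoC t)%C)).
  { rewrite <- Ha by lra. apply holomorphic_C_derive; [apply Hut|rewrite Cmod_0; lra]. }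
  unfold psum in K. simpl in K.
  rewrite (coef_0 1), H0, (coef_1 1 (f t) (/ 2) _ Hh ltac:(lra) D0) in K; auto; try lra.
  2:{ eapply cder_ccont, D0. }
  replace (RtoC 0 + RtoC 0 * RtoC 1 + Cexp (alpha * RtoC t) * (z * RtoC 1))%C with
    (Cexp (alpha * RtoC t) * z)%C in K by ring.
  rewrite Hz in K. replace (r / / 2) with (2 * r) in K by field.
  pose proof (Cmod_triangle_rev (Cexp (alpha * RtoC t) * z)%C (f t z)) as T1.
  rewrite Cmod_minus_sym, Cmod_mult, Hz in T1.
  assert (E : e <= Cmod (Cexp (alpha * RtoC t)%C)).
  { rewrite Cmod_Cexp. apply exp_le_compat.
    pose proof (re_le_Cmod (alpha * RtoC t)%C) as R1. rewrite Cmod_mult, Cmod_R in R1.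
    pose proof (Rabs_def2 (Re (alpha * RtoC t)%C) (Rabs (Re (alpha * RtoC t)%C) + 1) ltac:(lra)).
    assert (R2 : Rabs t <= Rabs a + Rabs T).
    { apply Rabs_le. pose proof (Rle_abs a). pose proof (Rle_abs T). pose proof (Rabs_pos a). pose proof (Rabs_pos T).
      pose proof (Rle_abs (- a)). pose proof (Rle_abs (- T)). rewrite Rabs_Ropp in *. lra. }
    assert (R3 : Cmod alpha * Rabs t <= S) by (apply Rmult_le_compat_l; auto; apply Cmod_ge_0).
    pose proof (Rle_abs (- Re (alpha * RtoC t)%C)) as R4. rewrite Rabs_Ropp in R4. lra. }
  apply Rle_div_r in Hr2; [|lra]. nra.
Qed.

(** * The differential equation for rows of the power matrix *)

Lemma Cpowz_nz z n : z <> RtoC 0 -> Cpowz z n <> RtoC 0.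
Proof.
  intros Hz. destruct n as [|q|q]; simpl.
  - intros K. apply RtoC_inj in K. lra.
  - now apply Cpow_nz.
  - apply Cmod_gt_0. rewrite Cmod_inv by (now apply Cpow_nz).
    apply Rinv_0_lt_compat, Cmod_gt_0. now apply Cpow_nz.
Qed.

Lemma Cpowz_succ z n : z <> RtoC 0 -> Cpowz z (Z.succ n) = (Cpowz z n * z)%C.
Proof.
  intros Hz. destruct n as [|q|q].
  - simpl. ring.
  - simpl. rewrite Pos2Nat.inj_add, Nat.add_comm. simpl. ring.
  - destruct (Pos.eq_dec q 1) as [->|Hq].
    + simpl. field. auto.
    + rewrite <- (Pos.succ_pred q Hq). generalize (Pos.pred q) as p. intros p.
      replace (Z.succ (Z.neg (Pos.succ p))) with (Z.neg p) by lia.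
      simpl. rewrite Pos2Nat.inj_succ. simpl. field. split; auto. now apply Cpow_nz.
Qed.

Lemma Cpowz_add_nat z n j : z <> RtoC 0 -> Cpowz z (n + Z.of_nat j) = (Cpowz z n * z ^ j)%C.
Proof.
  intros Hz. induction j as [|j IH].
  - rewrite Z.add_0_r. simpl. ring.
  - replace (n + Z.of_nat (S j))%Z with (Z.succ (n + Z.of_nat j)) by lia.
    rewrite Cpowz_succ, IH by auto. simpl. ring.
Qed.

Lemma Cpowz_mult x y n : x <> RtoC 0 -> y <> RtoC 0 -> Cpowz (x * y)%C n = (Cpowz x n * Cpowz y n)%C.
Proof.
  intros Hx Hy. destruct n as [|q|q]; simpl.
  - ring.
  - apply Cpow_mult_l.
  - rewrite Cpow_mult_l. field. split; now apply Cpow_nz.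
Qed.

Lemma cder_Cpowz n z : z <> RtoC 0 ->
  cder (fun w => Cpowz w n) z (RtoC (IZR n) * Cpowz z n / z)%C.
Proof.
  intros Hz. destruct n as [|q|q]; simpl.
  - eapply cder_eq; [apply cder_const|]. now field.
  - eapply cder_eq; [now apply cder_zpow|]. now rewrite INR_IPR.
  - eapply cder_eq; [apply cder_inv; [now apply cder_zpow|now apply Cpow_nz]|].
    rewrite INR_IPR. change (IZR (Z.neg q)) with (- IPR q). rewrite RtoC_opp. field.
    split; auto. now apply Cpow_nz.
Qed.

Lemma Cpow_lipschitz M n : 0 <= M -> exists L, 0 <= L /\ forall x y, Cmod x <= M -> Cmod y <= M ->
  Cmod (x ^ n - y ^ n)%C <= L * Cmod (x - y)%C.
Proof.
  intros HM. induction n as [|n (L & HL & IH)].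
  - exists 0. split; [lra|]. intros x y _ _. simpl. replace (RtoC 1 - RtoC 1)%C with (RtoC 0) by ring.
    rewrite Cmod_0. lra.
  - exists (M * L + M ^ n). split; [pose proof (pow_le M n HM); nra|]. intros x y Hx Hy. simpl.
    replace (x * x ^ n - y * y ^ n)%C with (x * (x ^ n - y ^ n) + (x - y) * y ^ n)%C by ring.
    eapply Rle_trans; [apply Cmod_triangle|]. rewrite !Cmod_mult, Cmod_pow, Rmult_plus_distr_r.
    pose proof (Cmod_ge_0 (x - y)%C). pose proof (Cmod_ge_0 x). pose proof (Cmod_ge_0 y).
    apply Rplus_le_compat.
    + rewrite Rmult_assoc. apply Rmult_le_compat; auto. apply Cmod_ge_0.
    + rewrite Rmult_comm. apply Rmult_le_compat_r; auto. now apply pow_incr.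
Qed.

Lemma Cpowz_lipschitz m M n : 0 < m -> 0 <= M ->
  exists L, 0 <= L /\ forall x y, m <= Cmod x <= M -> m <= Cmod y <= M ->
  Cmod (Cpowz x n - Cpowz y n)%C <= L * Cmod (x - y)%C.
Proof.
  intros Hm HM. destruct n as [|q|q]; simpl.
  - exists 0. split; [lra|]. intros x y _ _. replace (RtoC 1 - RtoC 1)%C with (RtoC 0) by ring.
    rewrite Cmod_0. lra.
  - destruct (Cpow_lipschitz M (Pos.to_nat q) HM) as (L & HL & H). exists L. split; auto.
    intros x y Hx Hy. now apply H.
  - destruct (Cpow_lipschitz M (Pos.to_nat q) HM) as (L & HL & H). set (k := Pos.to_nat q) in *.
    assert (Hmk : 0 < m ^ k) by (now apply pow_lt).
    exists (L / (m ^ k * m ^ k)). split; [apply Rdiv_le_0_compat; auto; nra|].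
    intros x y Hx Hy.
    assert (Hx0 : x <> RtoC 0) by (apply Cmod_gt_0; lra).
    assert (Hy0 : y <> RtoC 0) by (apply Cmod_gt_0; lra).
    assert (Hxk : (x ^ k)%C <> RtoC 0) by (now apply Cpow_nz).
    assert (Hyk : (y ^ k)%C <> RtoC 0) by (now apply Cpow_nz).
    replace (/ x ^ k - / y ^ k)%C with ((y ^ k - x ^ k) / (x ^ k * y ^ k))%C by (field; auto).
    rewrite Cmod_div, Cmod_mult, !Cmod_pow, Cmod_minus_sym by (now apply Cmult_neq_0).
    assert (Kx : m ^ k <= Cmod x ^ k) by (apply pow_incr; lra).
    assert (Ky : m ^ k <= Cmod y ^ k) by (apply pow_incr; lra).
    unfold Rdiv. rewrite (Rmult_assoc L), (Rmult_comm (/ _) (Cmod _)), <- Rmult_assoc.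
    apply Rmult_le_compat; [apply Cmod_ge_0| |now apply H|].
    + apply Rlt_le, Rinv_0_lt_compat. nra.
    + apply Rinv_le_contravar; nra.
Qed.

Lemma coef_minus f g r k : 0 < r -> (forall z, Cmod z = r -> ccont f z) ->
  (forall z, Cmod z = r -> ccont g z) ->
  coef (fun z => f z - g z)%C r k = (coef f r k - coef g r k)%C.
Proof.
  intros Hr Hf Hg. unfold coef, cmean. rewrite <- CInt_minus; try now apply icont_coef.
  apply CInt_ext. intros s _. unfold Cdiv. ring.
Qed.

Lemma coef_scal c f r k : 0 < r -> (forall z, Cmod z = r -> ccont f z) ->
  coef (fun z => c * f z)%C r k = (c * coef f r k)%C.
Proof.
  intros Hr Hf. unfold coef, cmean. rewrite <- CInt_scal; try now apply icont_coef.
  apply CInt_ext. intros s _. unfold Cdiv. ring.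
Qed.

(* [f(z)^n = z^n (f(z)/z)^n], where the second factor extends holomorphically to [0]. *)
Definition reduced_power (f : C -> C) (n : Z) (z : C) : C := Cpowz (f z / z)%C n.

(** Unlike in the classical class of schlicht functions, [f'(0) = 1] is not imposed; that
    [f'(0) <> 0] follows from univalence. *)
Definition schlicht_at_0 (f : C -> C) : Prop := univalent_on_disc f /\ f (RtoC 0) = RtoC 0.

Lemma schlicht_nz f z : schlicht_at_0 f -> 0 < Cmod z < 1 -> f z <> RtoC 0 /\ z <> RtoC 0 /\ (f z / z)%C <> RtoC 0.
Proof.
  intros [[Hf Hinj] H0] Hz.
  assert (Hz0 : z <> RtoC 0) by (apply Cmod_pos_nz; lra).
  assert (Hfz : f z <> RtoC 0).
  { rewrite <- H0. intros E. apply Hz0, Hinj; auto; [lra|]. rewrite Cmod_0. lra. }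
  repeat split; auto. unfold Cdiv. apply Cmult_neq_0; auto.
  apply Cmod_gt_0. rewrite Cmod_inv by auto. apply Rinv_0_lt_compat. lra.
Qed.

Lemma cder_reduced_power f n z l : schlicht_at_0 f -> 0 < Cmod z < 1 -> cder f z l ->
  cder (reduced_power f n) z
    (RtoC (IZR n) * reduced_power f n z * (l / f z - RtoC 1 / z))%C.
Proof.
  intros Hf Hz Hl. destruct (schlicht_nz f z Hf Hz) as (N1 & N2 & N3).
  eapply cder_eq.
  - apply (cder_comp (fun w => Cpowz w n) (fun w => f w / w)%C).
    + apply cder_div; [exact Hl|apply cder_id|auto].
    + now apply cder_Cpowz.
  - cbv beta. unfold reduced_power. field. auto.
Qed.

(** [f z / z] tends to [f'(0) <> 0], where [Cpowz] is continuous for negative exponents too; hence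
    boundedness near [0]. *)
Lemma hol0_reduced_power f n : schlicht_at_0 f -> hol0 1 (reduced_power f n).
Proof.
  intros Hf. pose proof Hf as [[Hd Hinj] H0]. split.
  - intros z Hz. destruct (Hd z) as [l Hl]; [lra|]. eexists. now apply (cder_reduced_power f n z l).
  - destruct (Hd (RtoC 0)) as [l Hl]; [rewrite Cmod_0; lra|].
    assert (Hl0 : l <> RtoC 0).
    { apply (univalent_cder_neq_0 f (RtoC 0)); auto; [split; auto|rewrite Cmod_0; lra]. }
    assert (Hq : ctends (cnear' (RtoC 0)) (reduced_power f n) (Cpowz l n)).
    { apply (ctends_comp _ (fun z => f z / z)%C (fun w => Cpowz w n)).
      - apply (ctends_ext _ (fun z => (f z - f (RtoC 0)) / (z - RtoC 0))%C); [|exact Hl].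
        apply (cnear'_0 1); [lra|]. intros w Hw. rewrite H0.
        rewrite Cminus_0_r. field. apply Cmod_pos_nz; lra.
      - eapply cder_ccont. now apply cder_Cpowz. }
    destruct (ctends_bounded _ _ _ Hq) as (d & Hd0 & H). eexists _, d. split; auto.
    intros z Hz. apply H; [apply Cmod_pos_nz; lra|]. rewrite Cminus_0_r. lra.
Qed.

Lemma loewner_schlicht a f t : loewner_chain a f -> a <= t -> schlicht_at_0 (f t).
Proof.
  intros (Hu & H0 & _) Ht. split; [|auto]. now apply univalent_univalent_on_disc, Hu.
Qed.

Lemma locally'_increment t : increment (@locally' R_UniformSpace t) (fun s => RtoC (s - t)).
Proof.
  split.
  - apply _.
  - intros eps He. exists (mkposreal eps He). intros s Hs _.
    replace (RtoC (s - t) - RtoC 0)%C with (RtoC (s - t)) by ring. rewrite Cmod_R. exact Hs.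
  - exists (mkposreal 1 Rlt_0_1). intros s _ Hs K. apply RtoC_inj in K. apply Hs. lra.
Qed.

Definition tder (g : R -> C) (t : R) (l : C) : Prop :=
  gder (@locally' R_UniformSpace t) (fun s => RtoC (s - t)) g (g t) l.

Lemma norm_C_R (v : C) : @norm R_AbsRing C_R_NormedModule v = Cmod v.
Proof.
  transitivity (sqrt (Rabs (fst v) ^ 2 + Rabs (snd v) ^ 2)); [reflexivity|].
  unfold Cmod. now rewrite !pow2_abs.
Qed.

Lemma is_derive_tder (g : R -> C) t l : @is_derive R_AbsRing C_R_NormedModule g t l -> tder g t l.
Proof.
  intros [_ H] eps He. specialize (H t (fun P HP => HP)).
  assert (He2 : 0 < eps / 2) by lra. destruct (H (mkposreal _ He2)) as [d Hd].
  exists d. intros s Hs Hst. specialize (Hd s Hs). cbv beta in Hd.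
  assert (Hn : RtoC (s - t) <> RtoC 0) by (intros K; apply RtoC_inj in K; apply Hst; lra).
  assert (Hp : 0 < Cmod (RtoC (s - t))) by (now apply Cmod_gt_0).
  rewrite norm_C_R in Hd.
  change (norm (minus s t)) with (Rabs (s - t)) in Hd. rewrite <- Cmod_R in Hd.
  match type of Hd with Cmod ?v <= _ =>
    assert (E : v = ((g s - g t) - RtoC (s - t) * l)%C) end.
  { destruct (g s) as [x1 y1], (g t) as [x2 y2], l as [x3 y3].
    unfold minus, plus, opp, scal; simpl. unfold prod_plus, prod_opp, prod_scal; simpl.
    unfold scal, plus, opp; simpl. unfold mult; simpl.
    unfold Cminus, Cplus, Copp, Cmult, RtoC; simpl. f_equal; ring. }
  rewrite E in Hd. replace ((g s - g t) / RtoC (s - t) - l)%C with ((g s - g t - RtoC (s - t) * l) / RtoC (s - t))%C by (now field).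
    rewrite Cmod_div by auto. apply (Rle_lt_trans _ (eps / 2)); [|lra].
    apply Rle_div_l; [exact Hp|exact Hd].
Qed.

#[export] Instance locally'_R_proper (t : R) : ProperFilter (@locally' R_UniformSpace t).
Proof.
  constructor; [|apply _]. intros P [d Hd]. pose proof (cond_pos d). exists (t + d / 2). apply Hd.
  - change (Rabs (t + d / 2 - t) < d). rewrite Rabs_pos_eq; lra.
  - lra.
Qed.

Lemma locally'_between a b t : a < t < b -> @locally' R_UniformSpace t (fun s => a <= s <= b).
Proof.
  intros Ht. assert (Hd : 0 < Rmin (t - a) (b - t)) by (apply Rmin_glb_lt; lra).
  exists (mkposreal _ Hd). intros s Hs _. apply Rabs_def2 in Hs. simpl in Hs.
  pose proof (Rmin_l (t - a) (b - t)). pose proof (Rmin_r (t - a) (b - t)).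
  unfold minus, plus, opp in Hs; simpl in Hs. lra.
Qed.

(** One radius serves all rows, all columns and all times up to [T]. Loewner's equation gives
    [d/dt (f/z) = p f'], hence [dU/dt = n (f/z)^(n-1) p f'], while [z U' + n U = n (f/z)^(n-1) f'];
    the Cauchy product with [p] expresses the result in coefficients. *)
Lemma loewner_rows a p f T : holomorphic_on_disc p -> loewner_chain a f -> a <= T ->
  exists r, 0 < r < 1 /\ forall n : Z,
    (forall k, exists L, 0 <= L /\ forall t s, a <= t <= T -> a <= s <= T ->
       Cmod (coef (reduced_power (f t) n) r k - coef (reduced_power (f s) n) r k)%C <= L * Rabs (t - s)) /\
    (forall t, a < t < T ->
      (forall z, unit_disc z -> @is_derive R_AbsRing C_R_NormedModule (fun s => f s z) t
        (z * p z * C_derive (f t) z)%C) ->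
      forall k, tder (fun s => coef (reduced_power (f s) n) r k) t
        (cconv (fun j => (RtoC (IZR n + INR j)) * coef (reduced_power (f t) n) r j) (coef p r) k)%C).
Proof.
  intros Hp Hc HT.
  destruct (loewner_lipschitz a f T Hc HT) as (K & HK0 & HK).
  destruct (loewner_lower_bound a f T Hc HT) as (r & m & Hr & Hm & Hlow).
  destruct (loewner_bounded a f T Hc HT) as (M & HM0 & HM).
  exists r. split; [lra|]. intros n.
  destruct (Cpowz_lipschitz (m / r) (M / r) n) as (L & HL0 & HL).
  { apply Rdiv_lt_0_compat; lra. }
  { apply Rdiv_le_0_compat; lra. }
  set (U := fun t => reduced_power (f t) n).
  assert (HU : forall t, a <= t -> hol0 1 (U t)).
  { intros t Ht. apply hol0_reduced_power. now apply (loewner_schlicht a). }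
  assert (HUc : forall t z, a <= t -> Cmod z = r -> ccont (U t) z).
  { intros t z Ht Hz. apply cdiff_ccont, HU; auto. lra. }
  assert (HUl : forall t s z, a <= t <= T -> a <= s <= T -> Cmod z = r ->
    Cmod (U t z - U s z)%C <= L * K / r * Rabs (t - s)).
  { intros t s z Ht Hs Hz. assert (Hz0 : z <> RtoC 0) by (apply Cmod_pos_nz; lra).
    assert (Hb : forall t, a <= t <= T -> m / r <= Cmod (f t z / z)%C <= M / r).
    { intros u Hu. rewrite Cmod_div, Hz by auto. split; apply Rmult_le_compat_r;
      try (apply Rlt_le, Rinv_0_lt_compat; lra); [now apply Hlow|apply HM; auto; lra]. }
    eapply Rle_trans; [apply HL; now apply Hb|].
    replace (f t z / z - f s z / z)%C with ((f t z - f s z) / z)%C by (now field).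
    rewrite Cmod_div, Hz by auto. unfold Rdiv. rewrite !Rmult_assoc. apply Rmult_le_compat_l; auto.
    replace (K * (/ r * Rabs (t - s))) with (K * Rabs (t - s) * / r) by ring.
    apply Rmult_le_compat_r; [apply Rlt_le, Rinv_0_lt_compat; lra|]. apply HK; auto. lra. }
  assert (HLKr : 0 <= L * K / r) by (apply Rdiv_le_0_compat; [nra|lra]).
  split.
  - intros k. exists (L * K / r / r ^ k).
    assert (Hrk : 0 < r ^ k) by (apply pow_lt; lra).
    split; [apply Rdiv_le_0_compat; auto|].
    intros t s Ht Hs. fold (U t) (U s). rewrite <- coef_minus; [|lra|intros; apply HUc; auto; lra|intros; apply HUc; auto; lra].
    eapply Rle_trans; [apply (Cmod_coef_le _ r (L * K / r * Rabs (t - s)))|].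
    + lra.
    + intros z Hz. apply ctends_minus; [apply _|apply HUc; auto; lra|apply HUc; auto; lra].
    + intros x _. apply HUl; auto. apply Cmod_circle. lra.
    + right. unfold Rdiv. ring.
  - intros t Ht Hpde k.
    destruct (cder_choice (U t)) as [U' HU'].
    assert (Hph : hol0 1 p).
    { apply hol0_of_cdiff; [lra|]. intros z Hz. now apply holomorphic_cdiff. }
    pose proof (loewner_schlicht a f t Hc ltac:(lra)) as Hsch.
    assert (Hft : holomorphic_on_disc (f t)) by (apply Hc; lra).
    (* The difference quotient of a coefficient is the coefficient of the difference quotient, once
       [s] is in [[a, T]]. *)
    apply (ctends_ext _ (fun s => coef (fun z => / RtoC (s - t) * (U s z - U t z))%C r k)).
    { generalize (filter_and _ _ (locally'_between a T t Ht) (increment_nz _ _ (locally'_increment t))).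
      apply filter_imp. intros s [Hs1 Hs2]. rewrite coef_scal, coef_minus; try lra.
      - unfold U. field. exact Hs2.
      - intros z Hz. apply HUc; auto. lra.
      - intros z Hz. apply HUc; auto. lra.
      - intros z Hz. apply ctends_minus; [apply _|apply HUc; auto; lra|apply HUc; auto; lra]. }
    (* On [|z| = r] the Lipschitz constant in time bounds the difference quotients uniformly in
       [s]. *)
    apply (coef_tends _ (fun s z => / RtoC (s - t) * (U s z - U t z))%C
      (fun z => (z * U' z + RtoC (IZR n) * U t z) * p z)%C 1 r (L * K / r)); [lra| | |].
    + generalize (filter_and _ _ (locally'_between a T t Ht) (increment_nz _ _ (locally'_increment t))).
      apply filter_imp. intros s [Hs1 Hs2]. split.
      * destruct (HU s ltac:(lra)) as [A1 (B1 & d1 & D1 & E1)].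
        destruct (HU t ltac:(lra)) as [A2 (B2 & d2 & D2 & E2)]. split.
        -- intros z Hz. apply cdiff_mult; [apply cdiff_const|]. apply cdiff_minus; auto.
        -- exists (Cmod (/ RtoC (s - t))%C * (B1 + B2)), (Rmin d1 d2).
           split; [now apply Rmin_glb_lt|]. intros z [Hz1 Hz2].
           destruct (Rmin_Rgt_l _ _ _ Hz2) as [Hz3 Hz4].
           rewrite Cmod_mult. apply Rmult_le_compat_l; [apply Cmod_ge_0|].
           eapply Rle_trans; [apply Cmod_triangle_minus|]. apply Rplus_le_compat; auto.
      * intros x _. rewrite Cmod_mult, Cmod_inv, Cmod_R by auto.
        assert (Hst : 0 < Rabs (s - t)).
        { apply Rabs_pos_lt. intros E. apply Hs2. now rewrite E. }
        apply (Rmult_le_reg_l (Rabs (s - t))); auto.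
        rewrite <- Rmult_assoc, Rinv_r, Rmult_1_l, Rmult_comm by lra.
        apply HUl; try lra. apply Cmod_circle. lra.
    + intros z Hz. assert (Hz1 : 0 < Cmod z < 1) by lra.
      destruct (schlicht_nz (f t) z Hsch Hz1) as (N1 & N2 & N3).
      pose proof (is_derive_tder _ _ _ (Hpde z (proj2 Hz1))) as D.
      assert (D2 : gder (@locally' R_UniformSpace t) (fun s => RtoC (s - t)) (fun s => f s z / z)%C
        (f t z / z)%C (p z * C_derive (f t) z)%C).
      { eapply ctends_eq; [apply (gder_mult _ _ (fun s => f s z) (fun _ => / z)%C);
          [apply locally'_increment|exact D|apply gder_const, locally'_increment]|]. now field. }
      pose proof (gder_comp _ _ _ _ _ (fun w => Cpowz w n) _ (locally'_increment t) D2 (cder_Cpowz n _ N3)) as D3.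
      eapply ctends_eq.
      { eapply ctends_ext; [apply _| |exact D3]. apply filter_forall. intros s. cbv beta.
        unfold U, reduced_power, Cdiv. now rewrite Cmult_comm. }
      rewrite (cder_unique (U t) z (U' z) _ (HU' z (proj1 (HU t ltac:(lra)) z Hz1))
        (cder_reduced_power (f t) n z _ Hsch Hz1 (holomorphic_C_derive _ z Hft (proj2 Hz1)))).
      unfold U, reduced_power. field. auto.
    + intros N. apply jet_mult; [|now apply (jet_hol0 1); [|lra]].
      assert (HUt : jet (U t) (coef (U t) r) N) by (apply (jet_hol0 1); [apply HU|]; lra).
      eapply jet_ext_coef; [|apply jet_plus; [apply (jet_deriv (U t) U' (coef (U t) r) 1 N); [lra| |exact HUt]
        |apply (jet_scal (RtoC (IZR n)) (U t) (coef (U t) r) N HUt)]].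
      * intros j. unfold U. cbv beta. rewrite RtoC_plus. ring.
      * intros z Hz. apply HU', HU; lra.
Qed.

(** * Lipschitz functions with almost everywhere vanishing derivative *)

(** The supremum of the points that [Q] links to [a] is itself linked to [a] and cannot lie below
    [b]. Transitivity stands in for summing over a tagged partition, so only intervals containing
    their tag [c] have to be treated. *)
Lemma local_to_global (Q : R -> R -> Prop) a b : a <= b ->
  (forall x y z, a <= x -> x <= y -> y <= z -> z <= b -> Q x y -> Q y z -> Q x z) ->
  (forall c, a <= c <= b -> exists d, 0 < d /\
    forall x y, a <= x -> x <= c -> c <= y -> y <= b -> c - x < d -> y - c < d -> Q x y) ->
  Q a b.
Proof.
  intros Hab Htr Hloc.
  destruct (completeness (fun x => a <= x <= b /\ Q a x)) as [c [Hc1 Hc2]].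
  - exists b. intros x Hx. lra.
  - exists a. split; [lra|]. destruct (Hloc a ltac:(lra)) as (d & Hd & H). apply H; lra.
  - assert (Hac : a <= c).
    { apply Hc1. split; [lra|]. destruct (Hloc a ltac:(lra)) as (d & Hd & H). apply H; lra. }
    assert (Hcb : c <= b) by (apply Hc2; intros x Hx; lra).
    destruct (Hloc c (conj Hac Hcb)) as (d & Hd & H).
    assert (Hx : exists x, (a <= x <= b /\ Q a x) /\ c - d < x).
    { apply NNPP. intros Hno. assert (c <= c - d); [|lra]. apply Hc2. intros x Hx.
      apply Rnot_lt_le. intros K. apply Hno. now exists x. }
    destruct Hx as (x & [Hx1 Hx2] & Hx3).
    assert (Hxc : x <= c) by (now apply Hc1).
    set (y := Rmin b (c + d / 2)).
    assert (Hy1 : y <= b) by apply Rmin_l. assert (Hy2 : y <= c + d / 2) by apply Rmin_r.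
    assert (Hy3 : c <= y) by (apply Rmin_glb; lra).
    assert (HQ : Q a y) by (apply (Htr a x y); try lra; auto; apply H; lra).
    assert (Hyc : y <= c) by (apply Hc1; split; [lra|auto]).
    destruct (Rle_lt_dec b (c + d / 2)) as [L|L].
    + assert (E : y = b) by (apply Rmin_left, L). now rewrite <- E.
    + assert (E : y = c + d / 2) by (apply Rmin_right; lra). lra.
Qed.

Lemma Series_ge_term u j : (forall k, 0 <= u k) -> ex_series u -> u j <= Series u.
Proof.
  intros Hu Hex. apply (Rle_trans _ (sum_n u j)).
  - destruct j as [|j]; [rewrite sum_O; lra|]. rewrite sum_Sn. unfold plus; simpl.
    assert (0 <= sum_n u j); [|lra]. rewrite sum_n_Reals. now apply cond_pos_sum.
  - apply (is_lim_seq_incr_compare (sum_n u)).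
    + exact (Series_correct _ Hex).
    + intros n. rewrite sum_Sn. unfold plus; simpl. specialize (Hu (S n)). lra.
Qed.

(** When [l k <= r k], the length of the part of [(l k, r k)] to the left of [x]. Summed over [k] it
    is nondecreasing in [x], grows in all by at most the length of the cover, and grows at least as
    fast as [x] inside each interval. *)
Definition covered (l r : nat -> R) (x : R) (k : nat) : R := Rmin (Rmax x (l k)) (r k) - l k.

Lemma covered_bounds l r x k : l k <= r k -> 0 <= covered l r x k <= r k - l k.
Proof.
  intros H. unfold covered. split.
  - assert (l k <= Rmin (Rmax x (l k)) (r k)); [|lra]. apply Rmin_glb; auto. apply Rmax_r.
  - pose proof (Rmin_r (Rmax x (l k)) (r k)). lra.
Qed.

Lemma covered_mono l r x y k : x <= y -> covered l r x k <= covered l r y k.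
Proof.
  intros H. unfold covered. assert (Rmin (Rmax x (l k)) (r k) <= Rmin (Rmax y (l k)) (r k)); [|lra].
  apply Rle_min_compat_r, Rle_max_compat_r, H.
Qed.

Lemma ex_series_covered l r x : (forall k, l k <= r k) -> ex_series (fun k => r k - l k) ->
  ex_series (covered l r x).
Proof.
  intros Hlr Hex. apply (ex_series_le (V := R_CompleteNormedModule) _ (fun k => r k - l k)); auto.
  intros k. pose proof (covered_bounds l r x k (Hlr k)).
  change (Rabs (covered l r x k) <= r k - l k). rewrite Rabs_pos_eq; lra.
Qed.

Lemma tder_0_bound g t eps : tder g t (RtoC 0) -> 0 < eps ->
  exists d, 0 < d /\ forall s, Rabs (s - t) < d -> Cmod (g s - g t)%C <= eps * Rabs (s - t).
Proof.
  intros H He. destruct (H eps He) as [d Hd]. exists d. split; [apply cond_pos|].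
  intros s Hs. destruct (Req_dec s t) as [->|n].
  - rewrite Cmod_minus_diag.
    pose proof (Rabs_pos (t - t)). nra.
  - specialize (Hd s Hs n). assert (Hn : RtoC (s - t) <> RtoC 0) by (intros K; apply RtoC_inj in K; lra).
    replace ((g s - g t) / RtoC (s - t) - RtoC 0)%C with ((g s - g t) / RtoC (s - t))%C in Hd by ring.
    rewrite Cmod_div, Cmod_R in Hd by auto. apply Rlt_le in Hd.
    apply Rle_div_l in Hd; auto. apply Rabs_pos_lt. lra.
Qed.

(* The bad set is covered by intervals of small total length; the growth of [g]
   is charged to that length at bad points and to [eps * length] at good points. *)
Lemma lipschitz_ae_const_interior g a T K : 0 <= K ->
  (forall t s, a <= t <= T -> a <= s <= T -> Cmod (g t - g s)%C <= K * Rabs (t - s)) ->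
  almost_every (fun t => a < t < T -> tder g t (RtoC 0)) ->
  forall b c, a < b -> b <= c -> c < T -> g b = g c.
Proof.
  intros HK Hlip Hae b c Hab Hbc HcT. symmetry.
  apply Cminus_eq_0, Cmod_eq_zero_eps. intros eps0 He0.
  (* The final bound is [eps * (c - b) + K * eps]; the [+ 1] keeps the denominator positive. *)
  set (eps := eps0 / (c - b + K + 1)).
  assert (He : 0 < eps) by (apply Rdiv_lt_0_compat; lra).
  destruct (Hae (mkposreal eps He)) as (l & r & Hlr & Hcov & Hex & Hlen). simpl in Hlen.
  set (lam := fun x => Series (covered l r x)).
  assert (Hexc : forall x, ex_series (covered l r x)) by (intros x; now apply ex_series_covered).
  assert (Hmono : forall x y, x <= y -> lam x <= lam y).
  { intros x y Hxy. apply Series_le; auto. intros k. split; [apply covered_bounds, Hlr|now apply covered_mono]. }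
  assert (Hmain : Cmod (g c - g b)%C <= eps * (c - b) + K * (lam c - lam b)).
  { apply (local_to_global (fun x y => Cmod (g y - g x)%C <= eps * (y - x) + K * (lam y - lam x)) b c); auto.
    - intros x y z _ _ _ _ H1 H2. eapply Rle_trans; [apply (Cmod_triangle_minus3 _ (g y))|]. lra.
    - intros t Ht. destruct (classic (a < t < T -> tder g t (RtoC 0))) as [Hg|Hb].
      + destruct (tder_0_bound g t eps (Hg ltac:(lra)) He) as (d & Hd & H). exists d. split; auto.
        intros x y Hx1 Hx2 Hy1 Hy2 Hx3 Hy3.
        pose proof (H x ltac:(rewrite Rabs_minus_sym, Rabs_pos_eq; lra)) as P1.
        pose proof (H y ltac:(rewrite Rabs_pos_eq; lra)) as P2.
        rewrite Rabs_minus_sym, Rabs_pos_eq in P1 by lra. rewrite Rabs_pos_eq in P2 by lra.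
        rewrite Cmod_minus_sym in P1.
        assert (K * (lam y - lam x) >= 0) by (pose proof (Hmono x y ltac:(lra)); nra).
        eapply Rle_trans; [apply (Cmod_triangle_minus3 _ (g t))|]. lra.
      + destruct (Hcov t Hb) as [j Hj]. exists (Rmin (t - l j) (r j - t)).
        split; [apply Rmin_glb_lt; lra|]. intros x y Hx1 Hx2 Hy1 Hy2 Hx3 Hy3.
        pose proof (Rmin_l (t - l j) (r j - t)). pose proof (Rmin_r (t - l j) (r j - t)).
        (* Both [x] and [y] lie in the [j]th interval of the cover, whose term alone grows by
           [y - x]. *)
        assert (P : y - x <= lam y - lam x).
        { unfold lam. rewrite <- Series_minus by auto.
          eapply Rle_trans; [|apply (Series_ge_term (fun k => covered l r y k - covered l r x k) j)].
          - unfold covered. rewrite (Rmax_left x), (Rmax_left y), (Rmin_left x), (Rmin_left y) by lra. lra.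
          - intros k. pose proof (covered_mono l r x y k ltac:(lra)). lra.
          - now apply (ex_series_minus (V := R_NormedModule)). }
        eapply Rle_trans; [apply Hlip; lra|]. rewrite Rabs_pos_eq by lra.
        assert (K * (y - x) <= K * (lam y - lam x)) by (apply Rmult_le_compat_l; lra).
        assert (0 <= eps * (y - x)) by nra. lra. }
  assert (Htot : lam c - lam b <= eps).
  { assert (0 <= lam b).
    { eapply Rle_trans; [|apply (Series_ge_term (covered l r b) 0)]; auto; [apply covered_bounds, Hlr|].
      intros k. apply covered_bounds, Hlr. }
    assert (lam c <= Series (fun k => r k - l k)).
    { apply Series_le; auto. intros k. apply covered_bounds, Hlr. }
    lra. }
  eapply Rle_trans; [exact Hmain|].
  replace eps0 with (eps * (c - b + K + 1)) by (unfold eps; field; lra).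
  assert (K * (lam c - lam b) <= K * eps) by (apply Rmult_le_compat_l; auto). lra.
Qed.

(** [lipschitz_ae_const_interior] compares points strictly above [a]; the Lipschitz bound between
    [a] and [a + d] closes the gap as [d] shrinks. *)
Lemma lipschitz_ae_const g a T K : 0 <= K ->
  (forall t s, a <= t <= T -> a <= s <= T -> Cmod (g t - g s)%C <= K * Rabs (t - s)) ->
  almost_every (fun t => a < t < T -> tder g t (RtoC 0)) ->
  forall c, a <= c < T -> g a = g c.
Proof.
  intros HK Hlip Hae c [[Hac| <-] HcT]; [|reflexivity]. apply Cminus_eq_0, Cmod_eq_zero_eps. intros eps He.
  set (d := Rmin (c - a) (eps / (K + 1))).
  assert (Hd : 0 < d) by (apply Rmin_glb_lt; [lra|apply Rdiv_lt_0_compat; lra]).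
  assert (Hd1 : d <= c - a) by apply Rmin_l.
  assert (Hd2 : d <= eps / (K + 1)) by apply Rmin_r.
  rewrite <- (lipschitz_ae_const_interior g a T K HK Hlip Hae (a + d) c); try lra.
  eapply Rle_trans; [apply Hlip; lra|]. rewrite Rabs_minus_sym, Rabs_pos_eq by lra.
  apply Rle_div_r in Hd2; [|lra]. replace (a + d - a) with d by ring. nra.
Qed.

Lemma null_set_subset (E F : R -> Prop) : (forall x, E x -> F x) -> null_set F -> null_set E.
Proof.
  intros H HF eps. destruct (HF eps) as (l & r & H1 & H2 & H3). exists l, r. split; [auto|]. split; auto.
Qed.

Lemma almost_every_impl (P Q : R -> Prop) : (forall x, P x -> Q x) -> almost_every P -> almost_every Q.
Proof. intros H. apply null_set_subset. intros x Hx Hp. apply Hx, H, Hp. Qed.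

(** * The matrix exponential *)

Lemma fold_right_seq_csum (F : nat -> C) s n :
  fold_right Cplus (RtoC 0) (map F (seq s n)) = csum (fun i => F (s + i)%nat) n.
Proof.
  revert s. induction n as [|n IH]; intros s; [reflexivity|].
  rewrite csum_head. simpl. rewrite IH, Nat.add_0_r. f_equal. apply csum_ext. intros k _.
  f_equal. lia.
Qed.

Lemma zmmul_csum A B m n : zmmul A B m n =
  csum (fun i => A m (m + Z.of_nat i)%Z * B (m + Z.of_nat i)%Z n)%C (Z.to_nat (n - m + 1)).
Proof.
  unfold zmmul, zrange. rewrite map_map. now rewrite fold_right_seq_csum.
Qed.

Lemma zmpow_scal c A k m n : zmpow (zmscal c A) k m n = (c ^ k * zmpow A k m n)%C.
Proof.
  revert m. induction k as [|k IH]; intros m; [simpl; ring|].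
  simpl zmpow. rewrite !zmmul_csum, <- csum_scal. apply csum_ext. intros i _.
  rewrite IH. unfold zmscal. simpl. ring.
Qed.

Lemma Cmod_csum_le u M n : (forall k, (k < n)%nat -> Cmod (u k) <= M) -> Cmod (csum u n) <= INR n * M.
Proof.
  intros H. induction n as [|n IH].
  - simpl. rewrite Cmod_0. lra.
  - rewrite S_INR. simpl. eapply Rle_trans; [apply Cmod_triangle|].
    specialize (IH (fun k Hk => H k (Nat.lt_lt_succ_r _ _ Hk))). specialize (H n (Nat.lt_succ_diag_r n)). lra.
Qed.

Lemma finite_bound (u : nat -> R) n : exists b, 0 <= b /\ forall k, (k < n)%nat -> u k <= b.
Proof.
  induction n as [|n (b & Hb & H)].
  - exists 0. split; [lra|]. intros k Hk. lia.
  - exists (Rmax b (u n)). split; [eapply Rle_trans; [exact Hb|apply Rmax_l]|].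
    intros k Hk. destruct (Nat.eq_dec k n) as [->|Hn]; [apply Rmax_r|].
    eapply Rle_trans; [apply H; lia|apply Rmax_l].
Qed.

(** With [N] indices in the block and entries bounded by [b], each factor costs at most [N * b]. The
    row [i] runs over the block because [zmpow] peels off its left factor. *)
Lemma zmpow_bound A m n : exists W, 0 <= W /\ forall k i, (m <= i <= n)%Z -> Cmod (zmpow A k i n) <= W ^ k.
Proof.
  set (N := Z.to_nat (n - m + 1)).
  assert (Hb : exists b, 0 <= b /\ forall i j, (m <= i <= n)%Z -> (m <= j <= n)%Z -> Cmod (A i j) <= b).
  { destruct (choice (fun (i : nat) b => 0 <= b /\ forall j, (j < N)%nat ->
      Cmod (A (m + Z.of_nat i)%Z (m + Z.of_nat j)%Z) <= b)) as [g Hg].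
    { intros i. apply finite_bound. }
    destruct (finite_bound g N) as (b & Hb & H). exists b. split; auto. intros i j Hi Hj.
    destruct (Hg (Z.to_nat (i - m))) as [_ G]. specialize (G (Z.to_nat (j - m)) ltac:(unfold N; lia)).
    specialize (H (Z.to_nat (i - m)) ltac:(unfold N; lia)).
    rewrite !Z2Nat.id in G by lia.
    replace (m + (i - m))%Z with i in G by lia. replace (m + (j - m))%Z with j in G by lia. lra. }
  destruct Hb as (b & Hb & H). exists (INR N * b). pose proof (pos_INR N) as HN.
  split; [nra|]. intros k. induction k as [|k IH]; intros i Hi.
  - simpl. unfold zmid. destruct (Z.eqb i n); [rewrite Cmod_1|rewrite Cmod_0]; lra.
  - simpl zmpow. rewrite zmmul_csum. assert (HW : 0 <= (INR N * b) ^ k) by (apply pow_le; nra).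
    eapply Rle_trans; [apply (Cmod_csum_le _ (b * (INR N * b) ^ k))|].
    + intros q Hq. rewrite Cmod_mult. apply Rmult_le_compat; try apply Cmod_ge_0.
      * apply H; lia.
      * apply IH. lia.
    + simpl. rewrite Rmult_assoc. apply Rmult_le_compat_r; [nra|].
      apply le_INR. unfold N. lia.
Qed.

Definition cex_series (u : nat -> C) : Prop :=
  ex_series (fun k => Re (u k)) /\ ex_series (fun k => Im (u k)).

Lemma cex_series_le u (v : nat -> R) : (forall k, Cmod (u k) <= v k) -> ex_series v -> cex_series u.
Proof.
  intros H Hv. split; apply (ex_series_le (V := R_CompleteNormedModule) _ v); auto; intros k;
  (eapply Rle_trans; [|apply H]); [apply re_le_Cmod|apply im_le_Cmod].
Qed.

Lemma CSeries_plus u v : cex_series u -> cex_series v ->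
  CSeries (fun k => u k + v k)%C = (CSeries u + CSeries v)%C /\ cex_series (fun k => u k + v k)%C.
Proof.
  intros [U1 U2] [V1 V2]. split.
  - unfold CSeries, Cplus; simpl. f_equal; rewrite <- Series_plus; auto.
  - split; now apply (ex_series_plus (V := R_NormedModule)).
Qed.

Lemma CSeries_scal c u : cex_series u ->
  CSeries (fun k => c * u k)%C = (c * CSeries u)%C /\ cex_series (fun k => c * u k)%C.
Proof.
  intros [U1 U2]. split.
  - unfold CSeries, Cmult; simpl. f_equal.
    + rewrite <- !Series_scal_l, <- Series_minus; [reflexivity| |];
      now apply (ex_series_scal (V := R_NormedModule)).
    + rewrite <- !Series_scal_l, <- Series_plus; [reflexivity| |];
      now apply (ex_series_scal (V := R_NormedModule)).
  - split.
    + apply (ex_series_minus (V := R_NormedModule)); now apply (ex_series_scal (V := R_NormedModule)).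
    + apply (ex_series_plus (V := R_NormedModule)); now apply (ex_series_scal (V := R_NormedModule)).
Qed.

Lemma CSeries_csum (u : nat -> nat -> C) n : (forall i, (i < n)%nat -> cex_series (u i)) ->
  CSeries (fun k => csum (fun i => u i k) n) = csum (fun i => CSeries (u i)) n /\
  cex_series (fun k => csum (fun i => u i k) n).
Proof.
  induction n as [|n IH]; intros H.
  - simpl. assert (E : is_series (fun _ : nat => 0) 0).
    { apply (filterlim_ext (fun _ => 0)); [|apply filterlim_const].
      intros k. induction k as [|k IH]; [now rewrite sum_O|].
      rewrite sum_Sn, <- IH. unfold plus; simpl. ring. }
    split.
    + unfold CSeries, RtoC; simpl. f_equal; now apply is_series_unique.
    + split; now exists 0.
  - destruct IH as [I1 I2]; [auto|]. simpl.
    destruct (CSeries_plus _ _ I2 (H n (Nat.lt_succ_diag_r n))) as [P1 P2].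
    split; auto. now rewrite P1, I1.
Qed.

Definition exp_term (A : zmatrix) (m n : Z) (t : R) (k : nat) : C :=
  (RtoC (t ^ k / INR (fact k)) * zmpow A k m n)%C.

Lemma zmexp_exp_term A m n t : zmexp (zmscal (RtoC t) A) m n = CSeries (exp_term A m n t).
Proof.
  unfold zmexp. f_equal. apply functional_extensionality. intros k. unfold exp_term.
  rewrite zmpow_scal, <- RtoC_pow, RtoC_div by apply INR_fact_neq_0. field.
  intros K. apply RtoC_inj in K. revert K. apply INR_fact_neq_0.
Qed.

Lemma ex_series_exp_bound W t : ex_series (fun k => Rabs t ^ k / INR (fact k) * W ^ k).
Proof.
  exists (exp (Rabs t * W)).
  apply (is_series_ext (V := R_NormedModule) (fun k => / INR (fact k) * (Rabs t * W) ^ k)).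
  - intros k. apply Rminus_diag_uniq. rewrite Rpow_mult_distr. unfold Rdiv. ring.
  - apply (proj1 (is_pseries_R _ _ _)), is_exp_Reals.
Qed.

Lemma cex_series_exp_term A m n t : cex_series (exp_term A m n t).
Proof.
  destruct (Z_le_gt_dec m n) as [Hmn|Hmn].
  - destruct (zmpow_bound A m n) as (W & HW & H).
    apply (cex_series_le _ (fun k => Rabs t ^ k / INR (fact k) * W ^ k)); [|apply ex_series_exp_bound].
    intros k. unfold exp_term. rewrite Cmod_mult, Cmod_R.
    assert (Hf : 0 < / INR (fact k)) by (apply Rinv_0_lt_compat, INR_fact_lt_0).
    unfold Rdiv. rewrite Rabs_mult, RPow_abs, (Rabs_pos_eq (/ _)) by lra.
    apply Rmult_le_compat_l; [|apply H; lia].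
    apply Rmult_le_pos; [apply Rabs_pos|lra].
  - apply (cex_series_le _ (fun k => Rabs t ^ k / INR (fact k) * 0 ^ k)); [|apply ex_series_exp_bound].
    intros k. unfold exp_term. replace (zmpow A k m n) with (RtoC 0).
    + rewrite Cmult_0_r, Cmod_0. rewrite <- (Rmult_0_r (Rabs t ^ k / INR (fact k))).
      apply Rmult_le_compat_l.
      * apply Rdiv_le_0_compat; [apply pow_le, Rabs_pos|apply INR_fact_lt_0].
      * apply pow_le. lra.
    + destruct k as [|k]; simpl.
      * unfold zmid. destruct (Z.eqb_spec m n); [lia|reflexivity].
      * rewrite zmmul_csum. replace (Z.to_nat (n - m + 1)) with 0%nat by lia. reflexivity.
Qed.

(** The terms stay bounded at [|t| + 1], a radius strictly beyond [|t|]. *)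
Lemma exp_coef_radius a W t : 0 <= W -> (forall k, Rabs (a k) <= W ^ k / INR (fact k)) ->
  Rbar_lt (Rabs t) (CV_radius a).
Proof.
  intros HW Ha. apply (Rbar_lt_le_trans _ (Rabs t + 1)); [simpl; lra|].
  apply (CV_radius_bounded a). pose proof (Rabs_pos t) as Ht. set (r := Rabs t + 1).
  exists (Series (fun k => Rabs r ^ k / INR (fact k) * W ^ k)). intros n.
  eapply Rle_trans; [|apply (Series_ge_term (fun k => Rabs r ^ k / INR (fact k) * W ^ k) n)].
  - rewrite Rabs_mult, <- RPow_abs.
    replace (Rabs r ^ n / INR (fact n) * W ^ n) with (W ^ n / INR (fact n) * Rabs r ^ n) by (unfold Rdiv; ring).
    apply Rmult_le_compat_r; [apply pow_le, Rabs_pos|apply Ha].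
  - intros k. apply Rmult_le_pos; [|now apply pow_le].
    apply Rdiv_le_0_compat; [apply pow_le, Rabs_pos|apply INR_fact_lt_0].
  - apply ex_series_exp_bound.
Qed.

(** Differentiating an exponential series shifts its sequence [b] by one. For [b k] the real or
    imaginary part of an entry of [A^k], this is the rule [d/dt exp(tA) = A exp(tA)]. *)
Lemma is_derive_exp_series (b : nat -> R) W t : 0 <= W -> (forall k, Rabs (b k) <= W ^ k) ->
  is_derive (fun t => Series (fun k => t ^ k / INR (fact k) * b k)) t
    (Series (fun k => t ^ k / INR (fact k) * b (S k))).
Proof.
  intros HW Hb. set (a := fun k => b k / INR (fact k)).
  assert (HR : Rbar_lt (Rabs t) (CV_radius a)).
  { apply (exp_coef_radius a W); auto. intros k. unfold a, Rdiv.
    pose proof (Rinv_0_lt_compat _ (INR_fact_lt_0 k)).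
    rewrite Rabs_mult, (Rabs_pos_eq (/ _)) by lra. apply Rmult_le_compat_r; [lra|apply Hb]. }
  pose proof (is_derive_PSeries a t HR) as D.
  replace (Series (fun k => t ^ k / INR (fact k) * b (S k))) with (PSeries (PS_derive a) t).
  - eapply is_derive_ext; [|exact D]. intros s. apply Series_ext. intros k. unfold a, Rdiv. ring.
  - apply Series_ext. intros k. unfold PS_derive, a.
    change (fact (S k)) with (S k * fact k)%nat. rewrite mult_INR. field.
    split; [apply INR_fact_neq_0|now apply not_0_INR].
Qed.

Lemma tder_pair (u v : R -> R) t l m : is_derive u t l -> is_derive v t m ->
  tder (fun s => (u s, v s)) t (l, m).
Proof.
  intros Hu Hv eps He.
  apply is_derive_Reals in Hu. apply is_derive_Reals in Hv.
  assert (He2 : 0 < eps / 2) by lra.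
  destruct (Hu _ He2) as [d1 H1]. destruct (Hv _ He2) as [d2 H2].
  assert (Hd : 0 < Rmin d1 d2) by (apply Rmin_glb_lt; apply cond_pos).
  exists (mkposreal _ Hd). intros s Hs Hst. change (Rabs (s - t) < Rmin d1 d2) in Hs.
  assert (Hn : s - t <> 0) by lra.
  specialize (H1 (s - t) Hn (Rlt_le_trans _ _ _ Hs (Rmin_l _ _))).
  specialize (H2 (s - t) Hn (Rlt_le_trans _ _ _ Hs (Rmin_r _ _))).
  assert (Es : forall x y : R, x + (y - x) = y) by (intros x y; ring). rewrite Es in H1, H2.
  eapply Rle_lt_trans; [apply Cmod_le_Re_Im|].
  replace (((u s, v s) - (u t, v t)) / RtoC (s - t) - (l, m))%C
    with ((u s - u t) / (s - t) - l, (v s - v t) / (s - t) - m).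
  - unfold Re, Im; cbn [fst snd]. lra.
  - assert (Hi : (/ RtoC (s - t))%C = RtoC (/ (s - t))) by (now rewrite RtoC_inv).
    unfold Cdiv. rewrite Hi. unfold Cminus, Cplus, Copp, Cmult, RtoC; simpl.
    f_equal; field; lra.
Qed.

Definition mexp (A : zmatrix) (t : R) : zmatrix := zmexp (zmscal (RtoC t) A).

Lemma mexp_lower A t m n : (n < m)%Z -> mexp A t m n = RtoC 0.
Proof.
  intros H. unfold mexp. rewrite zmexp_exp_term.
  assert (E : exp_term A m n t = fun _ => (RtoC 0 * RtoC 0)%C).
  { apply functional_extensionality. intros k. unfold exp_term. destruct k as [|k]; simpl.
    - unfold zmid. destruct (Z.eqb_spec m n); [lia|ring].
    - rewrite zmmul_csum. replace (Z.to_nat (n - m + 1)) with 0%nat by lia. simpl. ring. }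
  pose proof (cex_series_exp_term A m n t) as Hc.
  (* The vanishing series is evaluated as zero times itself. *)
  pose proof (CSeries_scal (RtoC 0) _ Hc) as [P _].
  transitivity (RtoC 0 * CSeries (exp_term A m n t))%C; [|ring]. rewrite <- P, E.
  unfold CSeries. f_equal; apply Series_ext; intros k; f_equal; ring.
Qed.

Lemma mexp_0 A m n : mexp A 0 m n = zmid m n.
Proof.
  unfold mexp. rewrite zmexp_exp_term.
  assert (H : forall b : nat -> R, Series (fun k => 0 ^ k / INR (fact k) * b k) = b O).
  { intros b. rewrite <- (PSeries_0 b) at 1. unfold PSeries. apply Series_ext. intros [|k]; simpl; [field|].
    unfold Rdiv. ring. }
  unfold CSeries, exp_term.
  rewrite (Series_ext _ (fun k => 0 ^ k / INR (fact k) * Re (zmpow A k m n))).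
  - rewrite (Series_ext (fun k => Im _) (fun k => 0 ^ k / INR (fact k) * Im (zmpow A k m n))).
    + rewrite !H. simpl. now destruct (zmid m n).
    + intros k. unfold Cmult, RtoC, Im, Re; simpl. ring.
  - intros k. unfold Cmult, RtoC, Im, Re; simpl. ring.
Qed.

(** Termwise differentiation replaces [zmpow A k] by [zmpow A (S k)]; splitting off one left factor
    turns the new series into a finite combination of the series for the exponential. *)
Lemma tder_mexp A m n t : (m <= n)%Z -> tder (fun s => mexp A s m n) t
  (csum (fun i => A m (m + Z.of_nat i)%Z * mexp A t (m + Z.of_nat i)%Z n)%C (Z.to_nat (n - m + 1))).
Proof.
  intros Hmn. destruct (zmpow_bound A m n) as (W & HW & HB).
  assert (E : (csum (fun i => A m (m + Z.of_nat i)%Z * mexp A t (m + Z.of_nat i)%Z n)%C (Z.to_nat (n - m + 1)))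
    = (Series (fun k => t ^ k / INR (fact k) * Re (zmpow A (S k) m n)),
       Series (fun k => t ^ k / INR (fact k) * Im (zmpow A (S k) m n)))).
  { rewrite (csum_ext _ (fun i => CSeries (fun k => A m (m + Z.of_nat i)%Z * exp_term A (m + Z.of_nat i)%Z n t k)%C)).
    - rewrite <- (proj1 (CSeries_csum (fun i k => A m (m + Z.of_nat i)%Z * exp_term A (m + Z.of_nat i)%Z n t k)%C _
        (fun i _ => proj2 (CSeries_scal _ _ (cex_series_exp_term A _ n t))))).
      assert (K : forall k, csum (fun i => A m (m + Z.of_nat i)%Z * exp_term A (m + Z.of_nat i)%Z n t k)%C (Z.to_nat (n - m + 1))
        = (RtoC (t ^ k / INR (fact k)) * zmpow A (S k) m n)%C).
      { intros k. simpl zmpow. rewrite zmmul_csum, <- csum_scal. apply csum_ext. intros i _.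
        unfold exp_term. ring. }
      unfold CSeries. f_equal; apply Series_ext; intros k; rewrite K;
      unfold Cmult, RtoC, Im, Re; simpl; ring.
    - intros i _. unfold mexp. rewrite zmexp_exp_term. symmetry. apply CSeries_scal, cex_series_exp_term. }
  rewrite E.
  replace (fun s => mexp A s m n) with (fun s => (Series (fun k => s ^ k / INR (fact k) * Re (zmpow A k m n)),
       Series (fun k => s ^ k / INR (fact k) * Im (zmpow A k m n)))).
  - apply tder_pair.
    + apply (is_derive_exp_series (fun k => Re (zmpow A k m n)) W); auto. intros k.
      eapply Rle_trans; [apply re_le_Cmod|apply (HB k m); lia].
    + apply (is_derive_exp_series (fun k => Im (zmpow A k m n)) W); auto. intros k.
      eapply Rle_trans; [apply im_le_Cmod|apply (HB k m); lia].
  - apply functional_extensionality. intros s. unfold mexp. rewrite zmexp_exp_term.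
    unfold CSeries. f_equal; apply Series_ext; intros k; unfold exp_term, Cmult, RtoC, Im, Re; simpl; ring.
Qed.

(** * Linear equations almost everywhere *)

Definition lipschitz_on (g : R -> C) (a b : R) : Prop :=
  exists K, 0 <= K /\ forall t s, a <= t <= b -> a <= s <= b -> Cmod (g t - g s)%C <= K * Rabs (t - s).

Lemma tder_eq g t l m : tder g t l -> l = m -> tder g t m.
Proof. now intros H <-. Qed.

Lemma tder_pcont g t l : tder g t l -> pcont g t.
Proof.
  intros H eps He. destruct (gder_tends _ _ _ _ _ (locally'_increment t) H eps He) as [d Hd].
  exists d. intros s Hs. destruct (Req_dec s t) as [->|n]; [|now apply Hd].
  now rewrite Cmod_minus_diag.
Qed.

Lemma pcont_bounded g a b : a <= b -> (forall t, a <= t <= b -> pcont g t) ->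
  exists M, 0 <= M /\ forall t, a <= t <= b -> Cmod (g t) <= M.
Proof.
  intros Hab H. destruct (continuity_ab_maj (fun t => Cmod (g t)) a b Hab) as [M [HM _]].
  - intros c Hc. apply continuity_pt_filterlim. now apply pcont_Cmod, H.
  - exists (Cmod (g M)). split; [apply Cmod_ge_0|auto].
Qed.

(** A mean value inequality for complex values, where the mean value theorem fails: slopes at each
    point are locally below [M + 1], and [local_to_global] adds the increments up. *)
Lemma tder_lipschitz g g' a b M : 0 <= M -> (forall t, a <= t <= b -> tder g t (g' t)) ->
  (forall t, a <= t <= b -> Cmod (g' t) <= M) -> lipschitz_on g a b.
Proof.
  intros HM Hg HM'. exists (M + 1). split; [lra|].
  assert (Hmain : forall t s, a <= t -> t <= s -> s <= b -> Cmod (g s - g t)%C <= (M + 1) * (s - t)).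
  { intros t s Hat Hts Hsb.
    apply (local_to_global (fun x y => Cmod (g y - g x)%C <= (M + 1) * (y - x)) t s); auto.
    - intros x y z _ _ _ _ H1 H2. eapply Rle_trans; [apply (Cmod_triangle_minus3 _ (g y))|]. lra.
    - intros c Hc. assert (Hc' : a <= c <= b) by lra.
      destruct (ctends_bounded _ _ _ (Hg c Hc')) as [d Hd].
      assert (Hb : forall s, Rabs (s - c) < d -> Cmod (g s - g c)%C <= (M + 1) * Rabs (s - c)).
      { intros x Hx. destruct (Req_dec x c) as [->|n].
        - rewrite Cmod_minus_diag. replace (c - c) with 0 by ring. rewrite Rabs_R0. lra.
        - specialize (Hd x Hx n). assert (Hn : RtoC (x - c) <> RtoC 0) by (intros K; apply RtoC_inj in K; lra).
          rewrite Cmod_div, Cmod_R in Hd by auto. pose proof (HM' c ltac:(lra)) as HM2.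
          apply Rle_div_l in Hd; [|apply Rabs_pos_lt; lra].
          pose proof (Rabs_pos (x - c)). nra. }
      exists d. split; [apply cond_pos|]. intros x y Hx1 Hx2 Hy1 Hy2 Hx3 Hy3.
      pose proof (Hb x ltac:(rewrite Rabs_minus_sym, Rabs_pos_eq; lra)) as P1.
      pose proof (Hb y ltac:(rewrite Rabs_pos_eq; lra)) as P2.
      rewrite Rabs_minus_sym, Rabs_pos_eq in P1 by lra. rewrite Rabs_pos_eq in P2 by lra.
      rewrite Cmod_minus_sym in P1.
      eapply Rle_trans; [apply (Cmod_triangle_minus3 _ (g c))|]. lra. }
  intros t s Ht Hs. destruct (Rle_dec t s) as [L|L].
  - rewrite Rabs_minus_sym, Rabs_pos_eq, Cmod_minus_sym by lra. apply Hmain; lra.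
  - rewrite Rabs_pos_eq by lra. apply Hmain; lra.
Qed.

Lemma lipschitz_on_bounded g a b : a <= b -> lipschitz_on g a b ->
  exists M, 0 <= M /\ forall t, a <= t <= b -> Cmod (g t) <= M.
Proof.
  intros Hab (K & HK & H). exists (Cmod (g a) + K * (b - a)).
  split; [pose proof (Cmod_ge_0 (g a)); nra|]. intros t Ht.
  pose proof (Cmod_triangle_rev (g t) (g a)). specialize (H t a Ht ltac:(lra)).
  rewrite Rabs_pos_eq in H by lra. nra.
Qed.

Lemma lipschitz_on_mult g h a b : a <= b -> lipschitz_on g a b -> lipschitz_on h a b ->
  lipschitz_on (fun t => g t * h t)%C a b.
Proof.
  intros Hab Hg Hh.
  destruct (lipschitz_on_bounded g a b Hab Hg) as (M & HM0 & HM).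
  destruct (lipschitz_on_bounded h a b Hab Hh) as (M' & HM0' & HM').
  destruct Hg as (K & HK & Hg). destruct Hh as (K' & HK' & Hh).
  exists (M * K' + K * M'). split; [nra|]. intros t s Ht Hs.
  replace (g t * h t - g s * h s)%C with (g t * (h t - h s) + (g t - g s) * h s)%C by ring.
  eapply Rle_trans; [apply Cmod_triangle|]. rewrite !Cmod_mult, Rmult_plus_distr_r.
  apply Rplus_le_compat.
  - rewrite Rmult_assoc. apply Rmult_le_compat; auto; apply Cmod_ge_0.
  - replace (K * M' * Rabs (t - s)) with (K * Rabs (t - s) * M') by ring.
    apply Rmult_le_compat; auto; apply Cmod_ge_0.
Qed.

Lemma lipschitz_on_csum (u : nat -> R -> C) n a b : (forall i, (i < n)%nat -> lipschitz_on (u i) a b) ->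
  lipschitz_on (fun t => csum (fun i => u i t) n) a b.
Proof.
  induction n as [|n IH]; intros H.
  - exists 0. split; [lra|]. intros t s _ _. simpl.
    replace (RtoC 0 - RtoC 0)%C with (RtoC 0) by ring. rewrite Cmod_0. lra.
  - destruct IH as (K & HK & HI); [auto|]. destruct (H n (Nat.lt_succ_diag_r n)) as (K' & HK' & HN).
    exists (K + K'). split; [lra|]. intros t s Ht Hs. simpl.
    match goal with |- Cmod (?x + ?y - (?z + ?w))%C <= _ =>
      replace (x + y - (z + w))%C with ((x - z) + (y - w))%C by ring end.
    eapply Rle_trans; [apply Cmod_triangle|]. rewrite Rmult_plus_distr_r.
    apply Rplus_le_compat; auto.
Qed.

Lemma tder_csum (u : nat -> R -> C) (l : nat -> C) n t : (forall i, (i < n)%nat -> tder (u i) t (l i)) ->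
  tder (fun t => csum (fun i => u i t) n) t (csum l n).
Proof.
  induction n as [|n IH]; intros H; simpl.
  - apply gder_const, locally'_increment.
  - apply gder_plus; [apply locally'_increment|apply IH; auto|apply H; lia].
Qed.

Lemma tder_reflect g T t l : tder g (T - t) l -> tder (fun s => g (T - s)%R) t (- l)%C.
Proof.
  intros H eps He. destruct (H eps He) as [d Hd]. exists d. intros s Hs Hst.
  change (Rabs (s - t) < d) in Hs.
  assert (Hb : Rabs ((T - s) - (T - t)) < d).
  { replace ((T - s) - (T - t)) with (- (s - t)) by ring. now rewrite Rabs_Ropp. }
  assert (Hne : T - s <> T - t) by (intros K; apply Hst; lra).
  specialize (Hd (T - s) Hb Hne).
  replace ((g (T - s)%R - g (T - t)%R) / RtoC (s - t) - - l)%C with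
    (- ((g (T - s)%R - g (T - t)%R) / RtoC (T - s - (T - t)) - l))%C.
  - now rewrite Cmod_opp.
  - replace (T - s - (T - t)) with (- (s - t)) by ring. rewrite RtoC_opp. field.
    intros K. apply RtoC_inj in K. apply Hst. lra.
Qed.

Lemma csum_swap (u : nat -> nat -> C) n m :
  csum (fun i => csum (fun j => u i j) m) n = csum (fun j => csum (fun i => u i j) n) m.
Proof.
  induction n as [|n IH]; simpl.
  - symmetry. now apply csum_zero.
  - rewrite IH. now rewrite <- csum_plus.
Qed.

Lemma csum_app u n m : csum u (n + m) = (csum u n + csum (fun i => u (n + i)%nat) m)%C.
Proof.
  induction m as [|m IH].
  - rewrite Nat.add_0_r. simpl. ring.
  - rewrite Nat.add_succ_r. simpl. rewrite IH. ring.
Qed.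

(** On or above the diagonal the derivative is a finite sum of multiples of continuous entries,
    hence bounded on [[a, b]]; below it the entry is zero. *)
Lemma mexp_lipschitz A m n T a b : a <= b -> lipschitz_on (fun s => mexp A (T - s) m n) a b.
Proof.
  intros Hab. destruct (Z_le_gt_dec m n) as [Hmn|Hmn].
  - set (D := fun s => (- csum (fun i => A m (m + Z.of_nat i)%Z * mexp A (T - s) (m + Z.of_nat i)%Z n)
      (Z.to_nat (n - m + 1)))%C).
    assert (HE : forall m s, pcont (fun s => mexp A (T - s) m n) s).
    { intros m' s. destruct (Z_le_gt_dec m' n) as [L|L].
      - eapply tder_pcont. apply (tder_reflect (fun s => mexp A s m' n)). now apply tder_mexp.
      - replace (fun s => mexp A (T - s) m' n) with (fun _ : R => RtoC 0); [apply pcont_const|].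
        apply functional_extensionality. intros x. symmetry. apply mexp_lower. lia. }
    assert (HD : forall s, pcont D s).
    { intros s. unfold D. set (N := Z.to_nat (n - m + 1)). clearbody N.
      apply (ctends_ext _ (fun s => RtoC (-1) *
        csum (fun i => A m (m + Z.of_nat i)%Z * mexp A (T - s) (m + Z.of_nat i)%Z n) N)%C).
      { apply filter_forall. intros x. ring. }
      eapply ctends_eq; [apply ctends_mult; [apply _|apply ctends_const, _|]|].
      - instantiate (1 := csum (fun i => A m (m + Z.of_nat i)%Z * mexp A (T - s) (m + Z.of_nat i)%Z n)%C N).
        induction N as [|N IH]; simpl; [apply ctends_const, _|].
        apply ctends_plus; [apply _|exact IH|]. apply ctends_mult; [apply _|apply ctends_const, _|apply HE].
      - ring. }
    destruct (pcont_bounded D a b Hab) as (M & HM0 & HM); [auto|].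
    apply (tder_lipschitz _ D a b M); auto.
    intros t _. apply (tder_reflect (fun s => mexp A s m n)). now apply tder_mexp.
  - exists 0. split; [lra|]. intros t s _ _. rewrite !mexp_lower by lia.
    replace (RtoC 0 - RtoC 0)%C with (RtoC 0) by ring. rewrite Cmod_0. lra.
Qed.

(* [x(s) exp((T-s)A)] has zero derivative almost everywhere. *)
Lemma linear_ode_ae (x : nat -> R -> C) (A : zmatrix) n a T T' :
  (forall i j, (j < i)%Z -> A i j = RtoC 0) -> a <= T < T' ->
  (forall k, lipschitz_on (x k) a T') ->
  almost_every (fun t => a < t < T' -> forall k,
    tder (x k) t (csum (fun j => x j t * A (n + Z.of_nat j)%Z (n + Z.of_nat k)%Z)%C (S k))) ->
  forall k, x k T = csum (fun l => x l a * mexp A (T - a) (n + Z.of_nat l)%Z (n + Z.of_nat k)%Z)%C (S k).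
Proof.
  intros HA HT Hlip Hae k.
  set (y := fun s => csum (fun l => x l s * mexp A (T - s) (n + Z.of_nat l)%Z (n + Z.of_nat k)%Z)%C (S k)).
  assert (Hy : lipschitz_on y a T').
  { apply (lipschitz_on_csum (fun l s => x l s * mexp A (T - s) (n + Z.of_nat l)%Z (n + Z.of_nat k)%Z)%C).
    intros l _. apply lipschitz_on_mult; auto; [lra|]. apply mexp_lipschitz. lra. }
  destruct Hy as (K & HK & Hy).
  assert (E : y a = y T).
  (* The interval extends beyond [T] because [lipschitz_ae_const] reaches only points strictly below
     its upper bound. *)
  { apply (lipschitz_ae_const y a T' K); auto. revert Hae. apply almost_every_impl.
    intros t Ht Hat. specialize (Ht Hat).
    set (b := fun i j : nat => A (n + Z.of_nat i)%Z (n + Z.of_nat j)%Z).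
    set (e := fun i j : nat => mexp A (T - t) (n + Z.of_nat i)%Z (n + Z.of_nat j)%Z).
    eapply ctends_eq.
    (* By the product rule, term [l] has derivative [(x A)_l e_l - x_l (A e)_l], where [e] is column
       [k] of the exponential. Both inner sums are extended to all indices up to [k] by zeros of [A]
       below the diagonal, so that the total vanishes on exchanging the summations. *)
    - apply (tder_csum (fun l s => x l s * mexp A (T - s) (n + Z.of_nat l)%Z (n + Z.of_nat k)%Z)%C
        (fun l => csum (fun j => x j t * b j l * e l k)%C (S k) - csum (fun q => x l t * b l q * e q k)%C (S k))%C).
      intros l Hl. eapply ctends_eq.
      + apply gder_mult; [apply locally'_increment|apply Ht|].
        apply (tder_reflect (fun s => mexp A s (n + Z.of_nat l)%Z (n + Z.of_nat k)%Z)). apply tder_mexp. lia.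
      + assert (E1 : csum (fun j => x j t * b j l * e l k)%C (S k) =
          (csum (fun j => x j t * b j l)%C (S l) * e l k)%C).
        { replace (S k) with (S l + (k - l))%nat by lia. rewrite csum_app, (csum_zero _ (k - l)).
          - rewrite Cmult_comm, <- csum_scal, Cplus_0_r. apply csum_ext. intros j _. ring.
          - intros j Hj. unfold b. rewrite HA by lia. ring. }
        assert (E2 : csum (fun q => x l t * b l q * e q k)%C (S k) =
          (x l t * csum (fun i => A (n + Z.of_nat l)%Z (n + Z.of_nat l + Z.of_nat i)%Z *
             mexp A (T - t) (n + Z.of_nat l + Z.of_nat i)%Z (n + Z.of_nat k)%Z)
             (Z.to_nat (n + Z.of_nat k - (n + Z.of_nat l) + 1)))%C).
        { replace (Z.to_nat (n + Z.of_nat k - (n + Z.of_nat l) + 1)) with (S k - l)%nat by lia.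
          replace (S k) with (l + (S k - l))%nat at 1 by lia. rewrite csum_app, csum_zero.
          - rewrite Cplus_0_l, <- csum_scal. apply csum_ext. intros i _. unfold b, e.
            replace (n + Z.of_nat (l + i))%Z with (n + Z.of_nat l + Z.of_nat i)%Z by lia. ring.
          - intros j Hj. unfold b. rewrite HA by lia. ring. }
        rewrite E1, E2. unfold b, e. ring.
    - rewrite (csum_ext _ (fun l => csum (fun j => x j t * b j l * e l k)%C (S k)
        + RtoC (-1) * csum (fun q => x l t * b l q * e q k)%C (S k))%C) by (intros l _; ring).
      rewrite csum_plus, csum_scal, (csum_swap (fun l j => x j t * b j l * e l k)%C). ring. }
  unfold y in E. rewrite E. rewrite Rminus_diag.
  symmetry. simpl. rewrite csum_zero.
  - rewrite mexp_0. unfold zmid. rewrite Z.eqb_refl. ring.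
  - intros l Hl. rewrite mexp_0. unfold zmid. destruct (Z.eqb_spec (n + Z.of_nat l) (n + Z.of_nat k)); [lia|ring].
Qed.

(** * Taylor coefficients and power matrices expressed by means over circles *)

Lemma locally_cnear (z : C) P : @locally C_UniformSpace z P <-> cnear z P.
Proof.
  split.
  - intros [d Hd]. exists d. split; [apply cond_pos|]. intros w Hw. apply Hd. split.
    + eapply Rle_lt_trans; [|exact Hw]. exact (re_le_Cmod (w - z)%C).
    + eapply Rle_lt_trans; [|exact Hw]. exact (im_le_Cmod (w - z)%C).
  (* Balls of [C_UniformSpace] are squares; the one of half side [d / 2] fits into the disc of
     radius [d]. *)
  - intros (d & Hd & H). assert (Hd2 : 0 < d / 2) by lra. exists (mkposreal _ Hd2).
    intros w [H1 H2]. apply H. eapply Rle_lt_trans; [apply Cmod_le_Re_Im|].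
    change (Rabs (Re (w - z)%C) < d / 2) in H1. change (Rabs (Im (w - z)%C) < d / 2) in H2. lra.
Qed.

Lemma locally'_cnear' (z : C) P : @locally' C_UniformSpace z P <-> cnear' z P.
Proof.
  unfold locally', within. rewrite locally_cnear.
  split; intros (d & Hd & H); exists d; auto.
Qed.

Lemma is_series_csum (u : nat -> C) l :
  @is_series C_AbsRing C_NormedModule u l <-> ctends eventually (csum u) l.
Proof.
  (* [sum_n u n] contains the term of index [n], whereas [csum u n] stops before it. *)
  assert (E : forall n, sum_n (G := C_NormedModule) u n = csum u (S n)).
  { induction n as [|n IH].
    - rewrite sum_O. simpl. now rewrite Cplus_0_l.
    - rewrite sum_Sn, IH. reflexivity. }
  split.
  - intros H eps He. destruct (H (fun y => Cmod (y - l)%C < eps)) as [N HN].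
    + apply locally_cnear. now exists eps.
    + exists (S N). intros [|n] Hn; [lia|]. rewrite <- E. apply HN. lia.
  - intros H P HP. apply locally_cnear in HP. destruct HP as (d & Hd & HP).
    destruct (H d Hd) as [N HN]. exists N. intros n Hn. rewrite E. apply HP, HN. lia.
Qed.

Lemma is_pseries_csum c z l :
  @is_pseries C_AbsRing C_NormedModule c z l <-> ctends eventually (psum c z) l.
Proof.
  unfold is_pseries. rewrite is_series_csum. unfold psum.
  replace (fun k => scal (pow_n z k) (c k)) with (fun k => c k * z ^ k)%C; [reflexivity|].
  apply functional_extensionality. intros k.
  replace (pow_n z k) with (z ^ k)%C; [apply Cmult_comm|].
  induction k as [|k IH]; simpl; [reflexivity|]. now rewrite IH.
Qed.

Lemma is_taylor_jet h c n : is_taylor h c -> jet h c n.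
Proof.
  intros H. apply locally_cnear in H. destruct H as (d & Hd & H).
  apply (jet_series h c d Hd). intros z Hz. apply is_pseries_csum, H.
  rewrite Cminus_0_r. lra.
Qed.

Lemma is_taylor_coef h r : (forall z, Cmod z < 1 -> cdiff h z) -> 0 < r < 1 -> is_taylor h (coef h r).
Proof.
  intros Hh Hr. assert (H0 : hol0 1 h) by (apply hol0_of_cdiff; auto; lra).
  apply locally_cnear. exists r. split; [lra|]. intros z Hz.
  rewrite Cminus_0_r in Hz. apply is_pseries_csum.
  (* [taylor_converges] concerns [z <> 0]; at the centre every nonempty partial sum already equals
     [h 0]. *)
  destruct (classic (z = RtoC 0)) as [->|n].
  - intros eps He. exists 1%nat. intros [|k] Hk; [lia|].
    rewrite psum_head, (coef_0 1); auto.
    + replace (h (RtoC 0) + RtoC 0 * psum (fun k0 => coef h r (S k0)) (RtoC 0) k - h (RtoC 0))%C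
        with (RtoC 0) by ring. now rewrite Cmod_0.
    + apply cdiff_ccont, Hh. rewrite Cmod_0. lra.
  - apply (taylor_converges 1); auto; [|lra]. split; auto. now apply Cmod_gt_0.
Qed.

(** [epsilon] can be trusted because the means over the circle of radius [1/2] provide a Taylor
    sequence. *)
Lemma taylor_coef_jet h n : (forall z, Cmod z < 1 -> cdiff h z) -> jet h (taylor_coef h) n.
Proof.
  intros Hh. apply is_taylor_jet. unfold taylor_coef. apply epsilon_spec.
  exists (coef h (/ 2)). apply is_taylor_coef; auto. lra.
Qed.

(** Serves twice: with [g = p] for the entries of [<zp>], and with [g] the reduced first power of
    [f] for the first row of the power matrix. *)
Lemma taylor_coef_mulz g h c : (forall z, Cmod z < 1 -> cdiff h z) ->
  (forall z, 0 < Cmod z < 1 -> h z = (z * g z)%C) -> (forall n, jet g c n) ->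
  forall k, taylor_coef h (S k) = c k.
Proof.
  intros Hh Hg Hc k. apply (jet_unique h (taylor_coef h) (shift c)) with (k := S k).
  - intros n. now apply taylor_coef_jet.
  - intros n. apply (jet_le _ _ n (S n)); [lia|].
    eapply jet_ext; [|apply jet_mulz, Hc]. apply (cnear'_0 1); [lra|].
    intros z Hz. symmetry. now apply Hg.
Qed.

Definition power_matrix_coef (f : C -> C) (r : R) : zmatrix := fun n m =>
  if Z.ltb m n then RtoC 0 else coef (reduced_power f n) r (Z.to_nat (m - n)).

Lemma power_matrix_coef_diag f r n j :
  power_matrix_coef f r n (n + Z.of_nat j)%Z = coef (reduced_power f n) r j.
Proof.
  unfold power_matrix_coef. destruct (Z.ltb_spec (n + Z.of_nat j) n); [lia|]. f_equal. lia.
Qed.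

Lemma reduced_power_mult f n z : schlicht_at_0 f -> 0 < Cmod z < 1 ->
  Cpowz (f z) n = (Cpowz z n * reduced_power f n z)%C.
Proof.
  intros Hf Hz. destruct (schlicht_nz f z Hf Hz) as (N1 & N2 & N3).
  unfold reduced_power. rewrite <- Cpowz_mult by auto. f_equal. now field.
Qed.

Lemma is_power_matrix_coef f r : schlicht_at_0 f -> 0 < r < 1 -> is_power_matrix f (power_matrix_coef f r).
Proof.
  intros Hf Hr. split.
  - intros n k Hk. unfold power_matrix_coef. destruct (Z.ltb_spec k n); [reflexivity|lia].
  - intros n. apply locally'_cnear'. apply (cnear'_0 r); [lra|]. intros z Hz.
    assert (Hz0 : z <> RtoC 0) by (apply Cmod_pos_nz; lra).
    apply is_series_csum. rewrite (reduced_power_mult f n z Hf) by lra.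
    apply (ctends_ext _ (fun N => Cpowz z n * psum (coef (reduced_power f n) r) z N)%C).
    + apply filter_forall. intros N. unfold psum. rewrite <- csum_scal. apply csum_ext. intros j _.
      rewrite power_matrix_coef_diag, Cpowz_add_nat by auto. ring.
    + apply ctends_scal; [apply _|]. apply (taylor_converges 1); try lra. now apply hol0_reduced_power.
Qed.

(** Division by [z^n] turns the Laurent expansion of [f(z)^n] into a power series for the reduced
    power, to which uniqueness of jets applies. *)
Lemma is_power_matrix_jet f A n N : schlicht_at_0 f -> is_power_matrix f A ->
  jet (reduced_power f n) (fun j => A n (n + Z.of_nat j)%Z) N.
Proof.
  intros Hf [_ HA]. specialize (HA n). apply locally'_cnear' in HA. destruct HA as (d & Hd & HA).
  apply (jet_series _ _ (Rmin d 1)); [apply Rmin_glb_lt; lra|]. intros z [Hz1 Hz2].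
  destruct (Rmin_Rgt_l _ _ _ Hz2) as [Hz3 Hz4].
  assert (Hz0 : z <> RtoC 0) by (now apply Cmod_pos_nz).
  assert (Hzn : Cpowz z n <> RtoC 0) by (now apply Cpowz_nz).
  assert (Hz5 : Cmod (z - RtoC 0)%C < d) by (now replace (z - RtoC 0)%C with z by ring).
  specialize (HA z Hz0 Hz5). apply is_series_csum in HA.
  rewrite (reduced_power_mult f n z Hf (conj Hz1 Hz4)) in HA.
  apply (ctends_ext _ (fun N => / Cpowz z n *
    csum (fun j => A n (n + Z.of_nat j)%Z * Cpowz z (n + Z.of_nat j)) N)%C).
  - apply filter_forall. intros M. unfold psum. rewrite <- csum_scal. apply csum_ext. intros j _.
    rewrite Cpowz_add_nat by auto. now field.
  - eapply ctends_eq; [apply ctends_scal; [apply _|exact HA]|]. now field.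
Qed.

(** Means over circles give existence for [epsilon], and jets give uniqueness. Any radius is
    allowed, so the one from [loewner_rows] can be used at both times. *)
Lemma power_matrix_eq f r : schlicht_at_0 f -> 0 < r < 1 -> power_matrix f = power_matrix_coef f r.
Proof.
  intros Hf Hr. pose proof (is_power_matrix_coef f r Hf Hr) as H1.
  assert (H2 : is_power_matrix f (power_matrix f)).
  { unfold power_matrix. apply epsilon_spec. now exists (power_matrix_coef f r). }
  apply functional_extensionality. intros n. apply functional_extensionality. intros m.
  destruct (Z_lt_le_dec m n) as [L|L].
  - rewrite (proj1 H1), (proj1 H2); auto.
  - replace m with (n + Z.of_nat (Z.to_nat (m - n)))%Z by lia.
    apply (jet_unique (reduced_power f n) (fun j => power_matrix f n (n + Z.of_nat j)%Z)
      (fun j => power_matrix_coef f r n (n + Z.of_nat j)%Z)); intros N; now apply is_power_matrix_jet.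
Qed.

Lemma bracket_lower h i j : (j < i)%Z -> bracket h i j = RtoC 0.
Proof. intros H. unfold bracket. destruct (Z.leb_spec i j); [lia|reflexivity]. Qed.

(** The row index [n + j] supplies the factor. [bracket] reads the coefficient of [z * p z] at
    [k - j + 1], which is that of [p] at [k - j]. *)
Lemma bracket_mulz p r (n : Z) j k : holomorphic_on_disc p -> 0 < r < 1 -> (j <= k)%nat ->
  bracket (fun z => z * p z)%C (n + Z.of_nat j)%Z (n + Z.of_nat k)%Z =
  (RtoC (IZR n + INR j) * coef p r (k - j))%C.
Proof.
  intros Hp Hr Hjk. unfold bracket. destruct (Z.leb_spec (n + Z.of_nat j) (n + Z.of_nat k)); [|lia].
  assert (Hpd : forall z, Cmod z < 1 -> cdiff p z) by (intros z Hz; now apply holomorphic_cdiff).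
  rewrite plus_IZR, <- INR_IZR_INZ. f_equal.
  replace (Z.to_nat (n + Z.of_nat k - (n + Z.of_nat j) + 1)) with (S (k - j)) by lia.
  apply (taylor_coef_mulz p (fun z => z * p z)%C (coef p r)); auto.
  - intros z Hz. apply cdiff_mult; [apply cdiff_id|auto].
  - intros N. apply (jet_hol0 1); auto. apply hol0_of_cdiff; auto. lra.
Qed.

Lemma power_matrix_row_1 f k : schlicht_at_0 f ->
  power_matrix f 1%Z (1 + Z.of_nat k)%Z = taylor_coef f (S k).
Proof.
  intros Hf. rewrite (power_matrix_eq f (/ 2)) by (auto; lra). rewrite power_matrix_coef_diag.
  symmetry. apply (taylor_coef_mulz (reduced_power f 1%Z)).
  - apply Hf.
  - intros z Hz. rewrite <- (Cmult_1_r (f z)) at 1. change (f z * RtoC 1)%C with (Cpowz (f z) 1%Z).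
    rewrite (reduced_power_mult f 1%Z z Hf Hz). simpl. ring.
  - intros N. apply (jet_hol0 1); [now apply hol0_reduced_power|lra].
Qed.

Theorem theorem4p1 (a : R) (p : C -> C) (f : R -> C -> C)
  (p_holomorphic : holomorphic_on_disc p)
  (p_positive : forall z, unit_disc z -> 0 < Re (p z))
  (f_chain : loewner_chain a f)
  (f_pde : loewner_pde a p f) :
  forall t, a <= t ->
    let M := zmmul (power_matrix (f a))
               (zmexp (zmscal (RtoC (t - a)) (bracket (fun z => Cmult z (p z))))) in
    power_matrix (f t) = M /\
    (forall n : nat, (1 <= n)%nat ->
       hd nil (principal_block 1 (Z.of_nat n) M) = map (taylor_coef (f t)) (seq 1 n)).
Proof.
  intros t Hat M.
  set (B := bracket (fun z => Cmult z (p z))) in *.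
  (* The horizon [t + 1] leaves room beyond [t], as [linear_ode_ae] demands. *)
  destruct (loewner_rows a p f (t + 1) p_holomorphic f_chain ltac:(lra)) as (r & Hr & Hrows).
  assert (Hs : forall s, a <= s -> schlicht_at_0 (f s)) by (intros s; now apply loewner_schlicht).
  assert (HM : power_matrix (f t) = M).
  { unfold M. rewrite (power_matrix_eq (f t) r), (power_matrix_eq (f a) r) by (auto; apply Hs; lra).
    apply functional_extensionality. intros n. apply functional_extensionality. intros m.
    destruct (Z_lt_le_dec m n) as [L|L].
    - rewrite zmmul_csum. replace (Z.to_nat (m - n + 1)) with 0%nat by lia.
      unfold power_matrix_coef. destruct (Z.ltb_spec m n); [reflexivity|lia].
    - replace m with (n + Z.of_nat (Z.to_nat (m - n)))%Z by lia.
      set (k := Z.to_nat (m - n)). clearbody k. clear m L.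
      rewrite power_matrix_coef_diag, zmmul_csum.
      replace (Z.to_nat (n + Z.of_nat k - n + 1)) with (S k) by lia.
      destruct (Hrows n) as [Hlip Hder].
      rewrite (linear_ode_ae (fun k s => coef (reduced_power (f s) n) r k) B n a t (t + 1)).
      + apply csum_ext. intros l _. rewrite power_matrix_coef_diag. reflexivity.
      + intros i j Hij. now apply bracket_lower.
      + lra.
      + intros j. exact (Hlip j).
      + revert f_pde. apply almost_every_impl. intros s Hpde Hs1 j.
        refine (tder_eq _ _ _ _ (Hder s Hs1 (Hpde (proj1 Hs1)) j) _).
        (* The Cauchy product with [p] is column [n + j] of the row times [<zp>]: both run over
           [i <= j], the matrix product by triangularity. *)
        unfold cconv. apply csum_ext. intros i Hi.
        unfold B. rewrite (bracket_mulz p r) by (auto; lia). ring. }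
  split; [exact HM|].
  intros n Hn. rewrite <- HM. unfold principal_block, zrange.
  replace (Z.to_nat (Z.of_nat n - 1 + 1)) with n by lia.
  (* Since [n >= 1] the block is nonempty, so [hd] returns its first row and not the default
     [nil]. *)
  destruct n as [|n]; [lia|]. rewrite <- seq_shift. rewrite !map_map. cbn [seq map hd].
  f_equal; [apply (power_matrix_row_1 (f t) 0); auto|].
  rewrite !map_map. apply map_ext. intros k. apply power_matrix_row_1; auto.
Qed.
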